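(* Let $\lambda\ge0$, let $\bar X\in\mathcal K$, $\bar\varrho=\bar X_\#\mathfrak m$, $\bar v\in L^2(\mathbb R,\bar\varrho)$ and $\bar V=\bar v\circ\bar X$. The unique sticky Lagrangian solution of the attractive Euler–Poisson system corresponding to the initial data $(\bar\varrho,\bar v)$ is given by the formula $$\varrho(t,\cdot)=X(t,\cdot)_\#\mathfrak m,\qquad X(t,m)=\frac{\partial}{\partial m}\mathcal X^{**}(t,m),$$ where $\mathcal X^{**}(t,\cdot)$ is the convex envelope, with respect to $m$, of $$\mathcal X(t,m):=\int_0^m\Big(\bar X(\ell)+t\,\bar V(\ell)-\lambda\frac{t^2}{4}(2\ell-1)\Big)\,d\ell .$$
   Context: $\Omega=(0,1)$, $\mathfrak m$ is Lebesgue measure on $\Omega$. $\mathcal K\subset L^2(\Omega)$ is the closed convex cone of nondecreasing functions (right-continuous representatives). For $X\in\mathcal K$: $\Omega_X$ is the set of $m\in\Omega$ such that $X$ is constant in a neighborhood of $m$, and $\partial I_{\mathcal K}(X)=\{W\in L^2(\Omega):\int_\Omega W(\tilde X-X)\,dm\le0\ \forall\tilde X\in\mathcal K\}$. The Euler–Poisson system (with vanishing background) is $\partial_t\varrho+\partial_x(\varrho v)=0$, $\partial_t(\varrho v)+\partial_x(\varrho v^2)=-\varrho\,\partial_xq_\varrho$, $-\partial_{xx}^2q_\varrho=\lambda\varrho$, where for general $\varrho$ the derivative is taken as the precise representative $\partial_xq_\varrho(x)=\tfrac\lambda2\big(\varrho((-\infty,x))+\varrho((-\infty,x])-1\big)$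 up to sign conventions so that the force is $f[\varrho]=-\tfrac\lambda2\big(\varrho((-\infty,x))+\varrho((-\infty,x])-1\big)\varrho$. Its Lagrangian force operator is $F[X](m)=-\lambda(m-\tfrac12)$ for all $X\in\mathcal K$, $m\in\Omega$. A Lagrangian solution with initial data $(\bar\varrho,\bar v)$ is given by $\varrho(t,\cdot)=X(t,\cdot)_\#\mathfrak m$, where $X\in\mathrm{Lip}_{\rm loc}([0,\infty);\mathcal K)$, $X(0)=\bar X$, and $\dot X(t)+\partial I_{\mathcal K}(X(t))\ni\bar V+\int_0^tF[X(s)]\,ds=\bar V-\lambda t(m-\tfrac12)$ for a.e. $t>0$. It is sticky if $\Omega_{X(t_1)}\subset\Omega_{X(t_2)}$ whenever $t_1\le t_2$. The convex envelope of a function $\mathcal X$ on $(0,1)$ is $\mathcal X^{**}(m):=\sup\{a+bm: a,b\in\mathbb R,\ a+bm'\le\mathcal X(m')\ \forall m'\in(0,1)\}$; $\partial/\partial m$ of a convex function is understood as its right derivative. *)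

(* Defs.v *)
From HB Require Import structures.
From mathcomp Require Import all_boot all_order all_algebra.
From mathcomp Require Import all_classical all_reals all_analysis.

Set Implicit Arguments.
Unset Strict Implicit.
Unset Printing Implicit Defensive.

Import Order.TTheory GRing.Theory Num.Theory.
Import numFieldNormedType.Exports.

Local Open Scope classical_set_scope.
Local Open Scope ring_scope.

(* Elements of L^2(0,1) and of the cone K are represented by functions R -> R
   whose values outside (0,1) are irrelevant: every notion below only looks at
   the restriction to (0,1). *)
Definition Omega (R : realType) : set R := `]0, 1[%classic.

Definition in_L2 (R : realType) (f : R -> R) : Prop :=
  ((f \_ (@Omega R) : measurableTypeR R -> R)
     \in Lfun (@lebesgue_measure R) 2%:E).

Definition L2norm (R : realType) (f : R -> R) : \bar R :=
  'N[@lebesgue_measure R]_(2%:E)[EFin \o (f \_ (@Omega R))]%E.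

(* The cone K of nondecreasing functions of L^2(0,1), each class being
   represented by its right-continuous representative. *)
Definition cone (R : realType) (X : R -> R) : Prop :=
  [/\ in_L2 X,
      (forall x y, Omega x -> Omega y -> x <= y -> X x <= X y) &
      (forall x, Omega x -> X y @[y --> x^'+] --> X x)].

Definition Omega_flat (R : realType) (X : R -> R) : set R :=
  [set m | Omega m /\ \forall x \near m, X x = X m].

Definition subdiff_cone (R : realType) (X W : R -> R) : Prop :=
  in_L2 W /\
  forall Y, cone Y ->
    (\int[@lebesgue_measure R]_(m in @Omega R)
       ((W m * (Y m - X m))%:E : \bar R) <= 0)%E.

(* X_# m, where m is the Lebesgue measure restricted to (0,1). *)
Definition push_Omega (R : realType) (X : R -> R) :
    set (measurableTypeR R) -> \bar R :=
  pushforward (T1 := measurableTypeR R) (T2 := measurableTypeR R)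
    (mrestr (@lebesgue_measure R) (measurable_itv `]0, 1[)) X.

Definition locally_lipschitz_L2 (R : realType) (X : R -> R -> R) : Prop :=
  forall T : R, 0 <= T -> exists L : R,
    forall s t, 0 <= s <= T -> 0 <= t <= T ->
      (L2norm (fun m => X t m - X s m)%R <= (L * `|t - s|)%:E)%E.

(* W is the strong derivative at time t of the curve X in L^2(0,1). *)
Definition is_L2_derivative (R : realType) (X : R -> R -> R) (t : R)
    (W : R -> R) : Prop :=
  in_L2 W /\
  L2norm (fun m => h^-1 * (X (t + h) m - X t m) - W m) @[h --> (0 : R)^']
    --> (0 : \bar R)%E.

(* Lagrangian solutions for a general Lagrangian force operator F. The
   L^2-valued integral of s |-> F[X(s)] is taken pointwise in m. *)
Record lagrangian_solution (R : realType) (F : (R -> R) -> R -> R)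
    (Xbar Vbar : R -> R) (rho : R -> probability (measurableTypeR R) R)
    (X : R -> R -> R) : Prop := LagrangianSolution {
  lagrangian_cone : forall t, 0 <= t -> cone (X t);
  lagrangian_lip : locally_lipschitz_L2 X;
  lagrangian_init : forall m, Omega m -> X 0 m = Xbar m;
  lagrangian_inclusion :
    {ae @lebesgue_measure R, forall t : R, 0 < t ->
      exists2 Xdot : R -> R, is_L2_derivative X t Xdot &
        subdiff_cone (X t) (fun m =>
          Vbar m + \int[@lebesgue_measure R]_(s in `[0, t]) F (X s) m
          - Xdot m)};
  lagrangian_law : forall t, 0 <= t ->
    forall A, measurable A -> rho t A = push_Omega (X t) A }.

Definition sticky (R : realType) (X : R -> R -> R) : Prop :=
  forall t1 t2, 0 <= t1 -> t1 <= t2 ->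
    Omega_flat (X t1) `<=` Omega_flat (X t2).

Definition euler_poisson_force (R : realType) (lambda : R)
    (X : R -> R) (m : R) : R := - lambda * (m - 2^-1).

(* Real-valued supremum: for a function with an affine minorant on (0,1), the
   set is nonempty and bounded above at every m in (0,1). *)
Definition convex_envelope (R : realType) (f : R -> R) (m : R) : R :=
  sup [set y | exists a b : R,
    (forall m', Omega m' -> a + b * m' <= f m') /\ y = a + b * m].

Definition right_derivative (R : realType) (f : R -> R) (m : R) : R :=
  lim (h^-1 * (f (m + h) - f m) @[h --> (0 : R)^'+]).

Definition EP_potential (R : realType) (lambda : R) (Xbar Vbar : R -> R)
    (t m : R) : R :=
  \int[@lebesgue_measure R]_(l in `]0, m[)
    (Xbar l + t * Vbar l - lambda * (t ^+ 2 / 4) * (2 * l - 1)).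

Definition EP_flow (R : realType) (lambda : R) (Xbar Vbar : R -> R)
    (t : R) : R -> R :=
  right_derivative (convex_envelope (EP_potential lambda Xbar Vbar t)).

(* Main.v *)
Require Import Defs.
From HB Require Import structures.
From mathcomp Require Import all_boot all_order all_algebra.
From mathcomp Require Import all_classical all_reals all_analysis.
From mathcomp Require Import measurable_realfun.
From mathcomp Require Import ring lra.
Import Order.TTheory GRing.Theory Num.Theory.
Import numFieldNormedType.Exports.
Local Open Scope classical_set_scope.
Local Open Scope ring_scope.
Set Implicit Arguments.
Unset Strict Implicit.
Unset Printing Implicit Defensive.

(** Let g(t)(m) = Xbar(m) + t Vbar(m) - (lambda t^2 / 2)(m - 1/2) be the motion of
    the labels in the absence of collisions, and X(t) the right derivative of the
    convex envelope of the primitive of g(t).  The proof rests on the following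
    facts about X.

    Projection.  X(t) is the metric projection of g(t) on the cone K
    ([envelope_projection]).  Integration by parts turns the pairing of w with a
    nondecreasing Y into the integral of - P dY, where P is the primitive of w.
    For w = g - X, P is the distance between the primitive of g and its envelope:
    it is nonnegative, so w lies in the polar cone of K, and it vanishes wherever
    the envelope is not affine, so w is orthogonal to X.  Conversely, the primitive
    of any vector of the polar cone of K that is orthogonal to some X in K vanishes
    outside the flat set of X ([polar_contact]); such a vector is therefore
    orthogonal to every Y in K that is flat wherever X is ([flat_orthogonal]).

    Stickiness.  For 0 < s <= t one has g(t) = (t / s) g(s) - kappa with
    kappa = (t / s - 1) Xbar + (lambda / 2) t (t - s) (m - 1/2), which is
    nondecreasing because lambda >= 0.  The primitive of g(t) is thus a multiple of
    that of g(s) minus a convex function.  Subtracting a convex function keeps a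
    primitive above the chords that it lies above, which gives the inclusion of the
    flat sets ([EP_flow_sticky]), and increases the distance to the envelope, so that
    the pairing of g(t) - X(t) with an element of K decreases in t ([EP_flow_polar]).
    At s = 0, where this rescaling is not available, Vbar is constant wherever Xbar
    is, and there g(t) is nonincreasing, so its primitive is concave.

    Existence.  Stickiness makes g(s) - X(s) orthogonal to X(t) for s <= t, while
    g(t) - X(t) pairs nonpositively with X(s).  In a Hilbert space, these two facts
    alone bound the speed of X by the free speed and make the difference quotients of
    X on both sides of a time converge to a common limit, except at countably many
    times ([sticky_curve_derivable]); so X has a strong derivative at almost every time.
    Dividing the monotonicity of the pairing of g(t) - X(t) with elements of K by the
    time increment yields the differential inclusion ([sticky_curve_inclusion]).

    Uniqueness.  Let Y be a sticky Lagrangian solution, t >= 0 and Z in K.  At almost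
    every s < t the vector w = g'(s) - Y'(s) lies in the subdifferential at Y(s), so
    it pairs nonpositively with Z and, by stickiness, is orthogonal to Y(t).  Hence
    the Lipschitz function mapping s to the pairing of g(s) - Y(s) with Z - Y(t)
    starts from 0 and has a nonpositive derivative almost everywhere, so that it is
    nonpositive at t ([residual_pairing_le0]): Y(t) is the projection of g(t), that
    is X(t). *)

(** * Mean values and square-integrable functions on the unit interval *)

Section unit_interval_integrals.
Context {R : realType}.
Implicit Types (f g h : R -> R) (c m : R).
Local Notation mu := (@lebesgue_measure R).
Local Notation Om := (@Omega R).

Lemma measurable_Omega : measurable (Om : set (measurableTypeR R)).
Proof. exact: measurable_itv. Qed.

Lemma mu_Omega : mu Om = 1%:E.
Proof. by rewrite /Omega lebesgue_measure_itv/= lte_fin ltr01 oppr0 adde0. Qed.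

Lemma OmegaE m : Om m = (0 < m < 1) :> Prop.
Proof. by rewrite /Omega/= in_itv. Qed.

Definition integrableO f := mu.-integrable Om (EFin \o f).
Definition meanO f : R := \int[mu]_(x in Om) f x.
Definition dotO f g : R := meanO (fun x => f x * g x).

Lemma integrableO_cst c : integrableO (fun=> c).
Proof.
apply/integrableP; split; first exact: measurable_cst.
have -> : (fun x : measurableTypeR R => `|(EFin \o (fun=> c)) x|)%E = cst (`|c|%:E) by [].
rewrite integral_cst//; last exact: measurable_Omega.
by rewrite [X in (_ * X)%E]mu_Omega mule1 ltry.
Qed.

Lemma integrableOD f g : integrableO f -> integrableO g ->
  integrableO (fun x => f x + g x).
Proof. by move=> fi gi; exact: (integrableD measurable_Omega fi gi). Qed.

Lemma integrableOZ c f : integrableO f -> integrableO (fun x => c * f x).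
Proof.
move=> fi; rewrite /integrableO.
rewrite (_ : EFin \o _ = (fun x => c%:E * (EFin \o f) x)%E)//.
exact: (integrableZl measurable_Omega).
Qed.

Lemma integrableOB f g : integrableO f -> integrableO g ->
  integrableO (fun x => f x - g x).
Proof. by move=> fi gi; exact: (integrableB measurable_Omega fi gi). Qed.

Lemma integrableO_eq f g : (forall x, Om x -> f x = g x) ->
  integrableO f -> integrableO g.
Proof.
move=> fg; apply: eq_integrable => //; first exact: measurable_Omega.
by move=> x; rewrite inE => /fg /= ->.
Qed.

Lemma integrableO_measurable f : integrableO f -> measurable_fun Om f.
Proof. by move=> /measurable_int/measurable_EFinP. Qed.

Lemma integrableO_le f g : measurable_fun Om f -> integrableO g ->
  (forall x, Om x -> `|f x| <= `|g x|) -> integrableO f.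
Proof.
move=> mf ig fg; apply: le_integrable ig => //.
- exact: measurable_Omega.
- exact/measurable_EFinP.
Qed.

Lemma meanO_eq f g : (forall x, Om x -> f x = g x) -> meanO f = meanO g.
Proof. by move=> fg; apply: eq_Rintegral => x; rewrite inE => /fg. Qed.

Lemma meanOD f g : integrableO f -> integrableO g ->
  meanO (fun x => f x + g x) = meanO f + meanO g.
Proof. by move=> fi gi; rewrite /meanO RintegralD//; exact: measurable_Omega. Qed.

Lemma meanOB f g : integrableO f -> integrableO g ->
  meanO (fun x => f x - g x) = meanO f - meanO g.
Proof. by move=> fi gi; rewrite /meanO RintegralB//; exact: measurable_Omega. Qed.

Lemma meanOZ c f : integrableO f -> meanO (fun x => c * f x) = c * meanO f.
Proof. by move=> fi; rewrite /meanO RintegralZl//; exact: measurable_Omega. Qed.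

Lemma meanO_cst c : meanO (fun=> c) = c.
Proof.
rewrite /meanO Rintegral_cst; last exact: measurable_Omega.
by rewrite [X in fine X]mu_Omega mulr1.
Qed.

Lemma le_meanO f g : integrableO f -> integrableO g ->
  (forall x, Om x -> f x <= g x) -> meanO f <= meanO g.
Proof. by move=> fi gi fg; apply: le_Rintegral => //; exact: measurable_Omega. Qed.

Lemma meanO_ge0 f : (forall x, Om x -> 0 <= f x) -> 0 <= meanO f.
Proof. by move=> f0; apply: Rintegral_ge0. Qed.

Lemma meanOE f : integrableO f ->
  (\int[mu]_(x in Om) (f x)%:E = (meanO f)%:E)%E.
Proof.
move=> fi; rewrite /meanO /Rintegral fineK//.
by apply: integrable_fin_num => //; exact: measurable_Omega.
Qed.

Lemma ae_imp (P Q : R -> Prop) : (forall x, P x -> Q x) ->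
  {ae mu, forall x, P x} -> {ae mu, forall x, Q x}.
Proof. by move=> PQ; apply: negligibleS => x /=; apply: contra_not; exact: PQ. Qed.

Lemma meanO_ae0 f : (forall x, Om x -> 0 <= f x) ->
  integrableO f -> meanO f = 0 -> {ae mu, forall x, Om x -> f x = 0}.
Proof.
move=> f0 fi f00.
have mf := measurable_int _ fi.
have H : (\int[mu]_(x in Om) `|(EFin \o f) x| = 0)%E.
  rewrite -[RHS]/(0%:E) -f00 -meanOE//; apply: eq_integral => x.
  by rewrite inE => /f0 fx; rewrite /= ger0_norm.
move/(ae_eq_integral_abs mu measurable_Omega mf): H.
by apply: filterS => x h Ox; have := h Ox => /= -[].
Qed.

(** Membership is a statement about the zero extension; this turns it into one
    about the measure on the interval itself. *)
Lemma in_L2P f :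
  in_L2 f <-> measurable_fun Om f /\ integrableO (fun x => f x ^+ 2).
Proof.
split=> [fL|[mf fi]].
  have := fL; rewrite /in_L2 inE => /andP[+ _]; rewrite inE/= => mf.
  split; first exact/(measurable_restrictT _ measurable_Omega).
  have /= := Lfun2_integrable_sqr fL => fi.
  apply/(integrable_mkcond _ measurable_Omega).
  apply: eq_integrable fi => // x _ /=.
  by rewrite /patch; case: ifP => //=; rewrite expr0n.
rewrite /in_L2 inE; apply/andP; split; rewrite inE/=.
  exact/(measurable_restrictT _ measurable_Omega).
rewrite /finite_norm unlock /= poweR_lty//.
have /integrableP[_] := fi.
rewrite integral_mkcond; apply: le_lt_trans; rewrite le_eqVlt; apply/orP; left.
apply/eqP; apply: eq_integral => x _ /=.
rewrite /patch; case: ifP => _ /=; last by rewrite normr0 powR0.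
by rewrite normrX powR_mulrn.
Qed.

Lemma in_L2_measurable f : in_L2 f -> measurable_fun Om f.
Proof. by move=> /in_L2P[]. Qed.

Lemma in_L2_sqr f : in_L2 f -> integrableO (fun x => f x ^+ 2).
Proof. by move=> /in_L2P[]. Qed.

Lemma in_L2_eq f g : (forall x, Om x -> f x = g x) -> in_L2 f -> in_L2 g.
Proof.
move=> fg; rewrite /in_L2 (_ : f \_ Om = g \_ Om)//.
by apply/funext => x; rewrite /patch; case: ifPn => //; rewrite inE => /fg.
Qed.

Lemma in_L2_le f g : measurable_fun Om f -> integrableO g ->
  (forall x, Om x -> f x ^+ 2 <= g x) -> in_L2 f.
Proof.
move=> mf ig fg; apply/in_L2P; split=> //; apply: integrableO_le ig _.
  exact: measurable_funX.
by move=> x Ox; rewrite ger0_norm ?sqr_ge0// (le_trans (fg _ Ox))// ler_norm.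
Qed.

Lemma in_L2_cst c : in_L2 (fun=> c).
Proof.
by apply: (@in_L2_le _ (fun=> c ^+ 2)) => //; exact: integrableO_cst.
Qed.

Lemma in_L2D f g : in_L2 f -> in_L2 g -> in_L2 (fun x => f x + g x).
Proof.
move=> /in_L2P[mf fi] /in_L2P[mg gi].
apply: (@in_L2_le _ (fun x => 2 * f x ^+ 2 + 2 * g x ^+ 2)).
- exact: measurable_funD.
- by apply: integrableOD; exact: integrableOZ.
- move=> x _; have := sqr_ge0 (f x - g x); nra.
Qed.

Lemma in_L2Z c f : in_L2 f -> in_L2 (fun x => c * f x).
Proof.
move=> /in_L2P[mf fi].
apply: (@in_L2_le _ (fun x => c ^+ 2 * f x ^+ 2)).
- exact: measurable_funM.
- exact: integrableOZ.
- by move=> x _; rewrite exprMn.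
Qed.

Lemma in_L2B f g : in_L2 f -> in_L2 g -> in_L2 (fun x => f x - g x).
Proof.
move=> fL /(in_L2Z (-1)) gL; apply: in_L2_eq (in_L2D fL gL).
by move=> x _; rewrite mulN1r.
Qed.

Lemma integrableO_mul f g : in_L2 f -> in_L2 g ->
  integrableO (fun x => f x * g x).
Proof.
move=> /in_L2P[mf fi] /in_L2P[mg gi].
apply: (@integrableO_le _ (fun x => f x ^+ 2 + g x ^+ 2)).
- exact: measurable_funM.
- exact: integrableOD.
- move=> x _; rewrite [leRHS]ger0_norm ?addr_ge0 ?sqr_ge0//.
  by rewrite ler_norml; apply/andP; split; nra.
Qed.

Lemma in_L2_integrable f : in_L2 f -> integrableO f.
Proof.
move=> fL; apply: integrableO_eq (integrableO_mul fL (in_L2_cst 1)).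
by move=> x _; rewrite mulr1.
Qed.

Lemma dotOC f g : dotO f g = dotO g f.
Proof. by apply: meanO_eq => x _; rewrite mulrC. Qed.

Lemma dotODl f g h : in_L2 f -> in_L2 g -> in_L2 h ->
  dotO (fun x => f x + g x) h = dotO f h + dotO g h.
Proof.
move=> fL gL hL; rewrite /dotO -meanOD; [|exact: integrableO_mul..].
by apply: meanO_eq => x _; rewrite mulrDl.
Qed.

Lemma dotOBl f g h : in_L2 f -> in_L2 g -> in_L2 h ->
  dotO (fun x => f x - g x) h = dotO f h - dotO g h.
Proof.
move=> fL gL hL; rewrite /dotO -meanOB; [|exact: integrableO_mul..].
by apply: meanO_eq => x _; rewrite mulrBl.
Qed.

Lemma dotOZl c f h : in_L2 f -> in_L2 h ->
  dotO (fun x => c * f x) h = c * dotO f h.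
Proof.
move=> fL hL; rewrite /dotO -meanOZ; last exact: integrableO_mul.
by apply: meanO_eq => x _; rewrite mulrA.
Qed.

Lemma dotODr f g h : in_L2 f -> in_L2 g -> in_L2 h ->
  dotO h (fun x => f x + g x) = dotO h f + dotO h g.
Proof. by move=> fL gL hL; rewrite dotOC dotODl// dotOC [dotO g h]dotOC. Qed.

Lemma dotOBr f g h : in_L2 f -> in_L2 g -> in_L2 h ->
  dotO h (fun x => f x - g x) = dotO h f - dotO h g.
Proof. by move=> fL gL hL; rewrite dotOC dotOBl// dotOC [dotO g h]dotOC. Qed.

Lemma dotOZr c f h : in_L2 f -> in_L2 h ->
  dotO h (fun x => c * f x) = c * dotO h f.
Proof. by move=> fL hL; rewrite dotOC dotOZl// dotOC. Qed.

Lemma dotO_eq f f' g g' : (forall x, Om x -> f x = f' x) ->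
  (forall x, Om x -> g x = g' x) -> dotO f g = dotO f' g'.
Proof. by move=> ff' gg'; apply: meanO_eq => x Ox; rewrite ff' ?gg'. Qed.

Lemma dotO_ge0 f : 0 <= dotO f f.
Proof. by apply: meanO_ge0 => x _; rewrite -expr2 sqr_ge0. Qed.

Lemma dotO_CS f g : in_L2 f -> in_L2 g ->
  dotO f g ^+ 2 <= dotO f f * dotO g g.
Proof.
move=> fL gL.
(* [H] is the nonnegativity of the square of f + t g, evaluated below at the
   minimizing t, or at a t large enough to force [dotO f g = 0] when
   [dotO g g = 0]. *)
have H t : 0 <= dotO f f + 2 * t * dotO f g + t ^+ 2 * dotO g g.
  have := dotO_ge0 (fun x => f x + t * g x).
  have tgL := in_L2Z t gL.
  rewrite dotODl ?dotODr ?dotOZl ?dotOZr//; try exact: in_L2D.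
  rewrite [dotO g f]dotOC => /le_trans; apply; rewrite le_eqVlt; apply/orP; left.
  by apply/eqP; ring.
have := dotO_ge0 g; rewrite le_eqVlt => /predU1P[g0|g0].
  rewrite -g0 mulr0.
  have [->|fg0] := eqVneq (dotO f g) 0; first by rewrite expr0n.
  have := H (- (dotO f f + 1) / (2 * dotO f g)).
  rewrite -g0 mulr0 addr0.
  rewrite (_ : 2 * _ * _ = - (dotO f f + 1)); last by field.
  lra.
have := H (- dotO f g / dotO g g).
rewrite (_ : _ + _ = dotO f f - dotO f g ^+ 2 / dotO g g); last first.
  by field; rewrite gt_eqF.
by rewrite subr_ge0 ler_pdivrMr.
Qed.

Lemma L2normE f : in_L2 f -> L2norm f = (Num.sqrt (dotO f f))%:E.
Proof.
move=> fL; rewrite /L2norm unlock /=.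
have -> : (\int[mu]_x (`|((f \_ Om) x)%:E| `^ 2)%E = (dotO f f)%:E)%E.
  rewrite -meanOE; last exact: integrableO_mul.
  rewrite [RHS]integral_mkcond; apply: eq_integral => x _ /=.
  rewrite /patch; case: ifP => _ /=; last by rewrite normr0 powR0.
  by rewrite powR_mulrn// -normrX ger0_norm ?sqr_ge0// expr2.
by rewrite poweR_EFin powR12_sqrt ?dotO_ge0.
Qed.

Lemma dotO_ae0 f : in_L2 f -> dotO f f = 0 -> {ae mu, forall x, Om x -> f x = 0}.
Proof.
move=> fL ff0.
have := @meanO_ae0 (fun x => f x * f x).
move=> /(_ _ (integrableO_mul fL fL) ff0) H.
have {}H : {ae mu, forall x, Om x -> f x * f x = 0}.
  by apply: H => x _; rewrite -expr2 sqr_ge0.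
by apply: ae_imp H => x h Ox; move/eqP: (h Ox); rewrite mulf_eq0 orbb => /eqP.
Qed.

End unit_interval_integrals.
Arguments integrableO {R} f.
Arguments meanO {R} f.
Arguments dotO {R} f g.

(** * Pairing with nondecreasing functions *)

Section step_functions.
Context {R : realType}.
Implicit Types (N : nat) (z d : R).

(** The integer part of z truncated to the range from -N to N, written with
    indicators of half-lines so that the pairing of w with [steps N (d * Y x)]
    only involves superlevel sets of Y. *)
Definition steps N z : R :=
  \sum_(k < N) ((k.+1%:R <= z)%R%:R + (- k%:R <= z)%R%:R - 1).

Lemma stepsS N z :
  steps N.+1 z = steps N z + ((N.+1%:R <= z)%R%:R + (- N%:R <= z)%R%:R - 1).
Proof. by rewrite /steps big_ord_recr. Qed.

Lemma steps_bounds N z :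
  [/\ - N%:R <= steps N z <= N%:R,
      (- N%:R <= z -> steps N z <= z) & (z <= N%:R + 1 -> z - 1 <= steps N z)].
Proof.
(* The two extra clauses, on the saturated ranges, are what the induction
   needs. *)
have : [/\ - N%:R <= steps N z <= N%:R,
      (- N%:R <= z -> steps N z <= z), (z < - N%:R -> steps N z <= - N%:R),
      (z <= N%:R + 1 -> z - 1 <= steps N z) &
      (N%:R + 1 < z -> N%:R <= steps N z)].
  elim: N => [|N [/andP[IH1 IH2] IH3 IH4 IH5 IH6]].
    rewrite /steps big_ord0 oppr0 lexx; split=> //; lra.
  rewrite stepsS -natr1; have [h|h] := leP (N%:R + 1) z.
    have -> : (- N%:R <= z) by have := ler0n R N; lra.
    have ? : N%:R <= steps N z.
      have [h'|h'] := leP z (N%:R + 1); last exact: IH6.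
      by have := IH5 h'; lra.
    rewrite /=; split; try lra; apply/andP; split; lra.
  have [h'|h'] := leP (- N%:R) z.
    rewrite /= add0r subrr addr0.
    have ? := IH3 h'; have ? := IH5 (ltW h).
    split; try lra; apply/andP; split; lra.
  rewrite /= addr0 add0r; have ? := IH4 h'.
  split; try lra; apply/andP; split; lra.
by case.
Qed.

Lemma steps_le N z : `|steps N z| <= `|z| + 1.
Proof.
have [/andP[h1 h2] h3 h4] := steps_bounds N z.
move: (ler_norm z) (ler_norm (- z)); rewrite normrN => h5 h6.
rewrite ler_norml; apply/andP; split.
  have [/h4|] := leP z (N%:R + 1); first lra.
  have := ler0n R N; lra.
have [/h3|] := leP (- N%:R) z; first lra.
have := ler0n R N; lra.
Qed.

Lemma steps_dist N z : `|z| <= N%:R -> `|steps N z - z| <= 1.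
Proof.
have [/andP[h1 h2] h3 h4] := steps_bounds N z.
rewrite ler_norml => /andP[a b].
have ? := h3 a; have ? : z - 1 <= steps N z by apply: h4; lra.
by rewrite ler_norml; apply/andP; split; lra.
Qed.

Definition staircase (n : nat) (y : R) : R :=
  n.+1%:R^-1 * steps (n.+1 ^ 2) (n.+1%:R * y).

Lemma staircase_le n y : `|staircase n y| <= `|y| + 1.
Proof.
rewrite /staircase normrM gtr0_norm ?invr_gt0// mulrC ler_pdivrMr//.
apply: le_trans (steps_le _ _) _.
rewrite normrM gtr0_norm// mulrDl mul1r mulrC lerD2l.
by rewrite ler1n.
Qed.

Lemma staircase_cvg y : staircase n y @[n --> \oo] --> y.
Proof.
apply/cvgrPdist_le => /= e e0; near=> n.
rewrite /staircase distrC.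
have n0 : 0 < n.+1%:R :> R by [].
rewrite -[X in _ - X](mulKf (lt0r_neq0 n0)) -mulrBr normrM.
rewrite gtr0_norm ?invr_gt0//.
apply: (@le_trans _ _ (n.+1%:R^-1 * 1)); last first.
  by rewrite mulr1 ltW//; near: n; exact: (near_infty_natSinv_lt (PosNum e0)).
rewrite ler_wpM2l ?invr_ge0//; apply: steps_dist.
rewrite normrM natrX expr2 ger0_norm// ler_wpM2l//.
near: n; exists (Num.truncn `|y|).+1 => // n /= hn.
by rewrite (le_trans (ltW (truncnS_gt _)))// ler_nat (leq_trans hn).
Unshelve. all: end_near. Qed.

End step_functions.

Section duality.
Context {R : realType}.
Implicit Types (f g w Y : R -> R) (c m r : R).
Local Notation mu := (@lebesgue_measure R).
Local Notation Om := (@Omega R).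

Lemma integrableO_if (b : R -> bool) f : measurable_fun Om b -> integrableO f ->
  integrableO (fun x => (b x)%R%:R * f x).
Proof.
move=> mb fi; apply: (integrableO_le _ fi).
  apply: measurable_funM; last exact: integrableO_measurable.
  exact: (@measurableT_comp _ _ _ _ _ _ (fun b : bool => b%:R : R)).
move=> x _; rewrite normrM; case: (b x); rewrite /= ?normr1 ?mul1r//.
by rewrite normr0 mul0r.
Qed.

Lemma measurable_ltc (c : R) : measurable_fun Om (fun x => x < c).
Proof. exact: measurable_fun_ltr. Qed.

Lemma measurable_ler_cst r Y : measurable_fun Om Y ->
  measurable_fun Om (fun x => r <= Y x).
Proof. by move=> mY; apply: measurable_fun_ler. Qed.

(** Each term of [steps] contributes the pairings with two superlevel sets,
    minus the mean of w, which vanishes. *)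
Lemma superposition_steps w Y N d : integrableO w -> measurable_fun Om Y ->
  meanO w = 0 -> (forall r, meanO (fun x => (r <= Y x)%R%:R * w x) <= 0) ->
  0 < d ->
  integrableO (fun x => w x * steps N (d * Y x)) /\
  meanO (fun x => w x * steps N (d * Y x)) <= 0.
Proof.
move=> wi mY w0 H d0; elim: N => [|N [IHi IH]].
  split.
    apply: integrableO_eq (integrableO_cst 0) => x _.
    by rewrite /steps big_ord0 mulr0.
  rewrite (@meanO_eq _ _ (fun=> 0)) ?meanO_cst// => x _.
  by rewrite /steps big_ord0 mulr0.
pose u r x := (r <= Y x)%R%:R * w x.
have ui r : integrableO (u r) by apply: integrableO_if => //; exact: measurable_ler_cst.
have E x : w x * steps N.+1 (d * Y x) =
    w x * steps N (d * Y x) + (u (N.+1%:R / d) x + u (- N%:R / d) x - w x).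
  rewrite stepsS /u !ler_pdivrMr// ![_ * d]mulrC mulrDr; congr (_ + _).
  by ring.
have ii : integrableO (fun x => u (N.+1%:R / d) x + u (- N%:R / d) x - w x).
  by apply: integrableOB => //; exact: integrableOD.
split.
  by apply: integrableO_eq (integrableOD IHi ii) => x _; rewrite E.
rewrite (meanO_eq (fun x _ => E x)) meanOD// meanOB//; last exact: integrableOD.
rewrite meanOD// w0 subr0.
have := H (N.+1%:R / d); have := H (- N%:R / d); rewrite /u; lra.
Qed.

(** A layer-cake argument: since w has mean zero, its pairing with Y is a
    superposition of its pairings with the indicators of the superlevel sets of
    Y. The staircases approximate Y with the dominant [`|Y x| + 1]. *)
Lemma superposition_le w Y : integrableO w -> measurable_fun Om Y ->
  integrableO (fun x => w x * Y x) -> meanO w = 0 ->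
  (forall r, meanO (fun x => (r <= Y x)%R%:R * w x) <= 0) ->
  meanO (fun x => w x * Y x) <= 0.
Proof.
move=> wi mY wYi w0 H.
have S n := superposition_steps (n.+1 ^ 2) wi mY w0 H (ltr0Sn R n).
have si n : integrableO (fun x => w x * staircase n (Y x)).
  apply: integrableO_eq (integrableOZ n.+1%:R^-1 (S n).1) => x _.
  by rewrite /staircase mulrCA.
have s0 n : meanO (fun x => w x * staircase n (Y x)) <= 0.
  rewrite (@meanO_eq _ _ (fun x => n.+1%:R^-1 * (w x * steps (n.+1 ^ 2) (n.+1%:R * Y x)))).
    by rewrite meanOZ ?(S n).1// pmulr_rle0 ?invr_gt0//; exact: (S n).2.
  by move=> x _; rewrite /staircase mulrCA.
have := @dominated_convergence _ _ R mu Om (@measurable_Omega R)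
  (fun n x => (w x * staircase n (Y x))%:E) (fun x => (w x * Y x)%:E)
  (fun x => (`|w x * Y x| + `|w x|)%:E).
case.
- by move=> n; exact: (measurable_int _ (si n)).
- exact: (measurable_int _ wYi).
- apply: aeW => x _; apply: cvg_EFin; first exact: nearW.
  by apply: cvgM; [exact: cvg_cst|exact: staircase_cvg].
- have ai f : integrableO f -> integrableO (fun x => `|f x|).
    move=> fi; apply: (integrableO_le _ fi).
      exact: (measurableT_comp (@normr_measurable _ _) (integrableO_measurable fi)).
    by move=> x _; rewrite normr_id.
  by apply: integrableOD; exact: ai.
- apply: aeW => x n _; rewrite lee_fin normrM [in leRHS]normrM.
  by rewrite -[X in _ + X]mulr1 -mulrDr ler_wpM2l// staircase_le.
move=> _ _ /= cv.
rewrite -lee_fin -meanOE//.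
rewrite -(cvg_lim (@ereal_hausdorff R) cv); apply: lime_le.
  by apply/cvg_ex; eexists; exact: cv.
by apply: nearW => n; rewrite meanOE// lee_fin.
Qed.

Definition prim w c : R := meanO (fun x => (x < c)%R%:R * w x).

Lemma meanO_eq1 c f g : integrableO f -> integrableO g ->
  (forall x, Om x -> x != c -> f x = g x) -> meanO f = meanO g.
Proof.
move=> fi gi fg; congr fine; apply: ae_eq_integral.
- exact: measurable_Omega.
- exact: measurable_int fi.
- exact: measurable_int gi.
- exists [set c]; split; first exact: measurable_set1.
    exact: lebesgue_measure_set1.
  move=> x /= h; apply: contrapT => /eqP xc; apply: h => Ox.
  by rewrite /= fg.
Qed.

Lemma Omega_flatP Y c : Omega_flat Y c <->
  exists d, [/\ 0 < d, 0 <= c - d, c + d <= 1 &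
    forall x, c - d < x < c + d -> Y x = Y c].
Proof.
split=> [[]|[d [d0 cd0 cd1 H]]]; last first.
  split; first by rewrite OmegaE; apply/andP; split; lra.
  exists d => //= x; rewrite /ball_/= => xd; apply: H.
  by move: xd; rewrite ltr_norml => /andP[? ?]; apply/andP; split; lra.
rewrite OmegaE => /andP[c0 c1] [e /= e0 H].
exists (Num.min e (Num.min c (1 - c))); split.
- by rewrite !lt_min e0 c0 subr_gt0.
- by rewrite subr_ge0 !ge_min lexx orbT.
- by rewrite -lerBrDl !ge_min lexx !orbT.
- move=> x /andP[h1 h2]; apply: H; rewrite /ball_/=.
  have h3 : Num.min e (Num.min c (1 - c)) <= e by rewrite ge_min lexx.
  by rewrite ltr_norml; apply/andP; split; lra.
Qed.

(** The superlevel sets of a nondecreasing function are half-lines, and Y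
    crosses the level r at the threshold c, so that it cannot be constant around
    c. *)
Lemma monotone_level Y r :
  (forall x y, Om x -> Om y -> x <= y -> Y x <= Y y) ->
  exists c, [/\ 0 <= c <= 1, (forall x, Om x -> x < c -> Y x < r),
    (forall x, Om x -> c < x -> r <= Y x) & (0 < c < 1 -> ~ Omega_flat Y c)].
Proof.
move=> nY; pose A := 0 |` [set x | Om x /\ Y x < r].
have hA : has_sup A.
  split; first by exists 0; left.
  by exists 1 => x [->|[]]//; rewrite OmegaE => /andP[_ /ltW].
have c0 : 0 <= sup A by apply: sup_upper_bound => //; left.
have c1 : sup A <= 1.
  by apply: ge_sup; [exact: hA.1|move=> x [->|[]]//; rewrite OmegaE => /andP[_ /ltW]].
have lo x : Om x -> x < sup A -> Y x < r.
  move=> Ox xA; have [a [a0|[Oa ar]] xa] := sup_gt hA.1 xA.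
    by move: Ox; rewrite OmegaE => /andP[x0 _]; rewrite a0 ltNge (ltW x0) in xa.
  by apply: le_lt_trans ar; apply: nY => //; exact: ltW.
have hi x : Om x -> sup A < x -> r <= Y x.
  move=> Ox Ax; rewrite leNgt; apply/negP => Yr.
  by move: Ax; apply/negP; rewrite -leNgt; apply: sup_upper_bound => //; right.
exists (sup A); split.
- by rewrite c0.
- exact: lo.
- exact: hi.
- move=> /andP[p0 p1] /Omega_flatP[d [d0 d1 d2 H]].
  have h1 : Y (sup A - d / 2) = Y (sup A) by apply: H; apply/andP; split; lra.
  have h2 : Y (sup A + d / 2) = Y (sup A) by apply: H; apply/andP; split; lra.
  have := lo (sup A - d / 2); have := hi (sup A + d / 2).
  rewrite !OmegaE h1 h2 => h3 h4.
  have : r <= Y (sup A) by apply: h3; [apply/andP; split; lra|lra].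
  by apply/negP; rewrite -ltNge; apply: h4; [apply/andP; split; lra|lra].
Qed.

Lemma prim0 w : prim w 0 = 0.
Proof.
rewrite /prim (@meanO_eq _ _ (fun=> 0)) ?meanO_cst// => x.
by rewrite OmegaE => /andP[x0 _]; rewrite ltNge (ltW x0) mul0r.
Qed.

Lemma prim1 w : prim w 1 = meanO w.
Proof.
by apply: meanO_eq => x; rewrite OmegaE => /andP[_ ->]; rewrite mul1r.
Qed.

Lemma primB f g c : integrableO f -> integrableO g ->
  prim (fun x => f x - g x) c = prim f c - prim g c.
Proof.
move=> fi gi; rewrite /prim -meanOB.
- by apply: meanO_eq => x _; rewrite mulrBr.
- by apply: integrableO_if => //; exact: measurable_ltc.
- by apply: integrableO_if => //; exact: measurable_ltc.
Qed.

Lemma primZ a f c : integrableO f -> prim (fun x => a * f x) c = a * prim f c.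
Proof.
move=> fi; rewrite /prim -meanOZ.
- by apply: meanO_eq => x _; rewrite mulrCA.
- by apply: integrableO_if => //; exact: measurable_ltc.
Qed.

Lemma prim_eq f g c : (forall x, Om x -> f x = g x) -> prim f c = prim g c.
Proof. by move=> fg; apply: meanO_eq => x Ox; rewrite fg. Qed.

Lemma primN f c : integrableO f -> prim (fun x => - f x) c = - prim f c.
Proof.
move=> fi; rewrite -mulN1r -primZ//.
by apply: prim_eq => x _; rewrite mulN1r.
Qed.

Lemma nondecreasing_Omega_measurable Y :
  (forall x y, Om x -> Om y -> x <= y -> Y x <= Y y) -> measurable_fun Om Y.
Proof.
move=> nY mO; apply: (measurability (@RGenCInfty.G R)).
- exact: RGenCInfty.measurableE.
- move=> /= _ [_] [r] -> <-.
  apply: is_interval_measurable => s t/=.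
  move=> [Os]; rewrite in_itv/= andbT => rs [Ot]; rewrite in_itv/= andbT => rt u /andP[su ut].
  have Ou : Om u.
    move: Os Ot; rewrite !OmegaE => /andP[s0 _] /andP[_ t1].
    by rewrite (lt_le_trans s0 su) (le_lt_trans ut t1).
  by split=> //; rewrite in_itv/= andbT (le_trans rs)// nY.
- exact: measurable_Omega.
Qed.

(** The superlevel set and the half-line may differ at the threshold itself,
    which has measure zero. *)
Lemma level_mean w Y r : integrableO w ->
  (forall x y, Om x -> Om y -> x <= y -> Y x <= Y y) ->
  exists c, [/\ 0 <= c <= 1, (0 < c < 1 -> ~ Omega_flat Y c) &
    meanO (fun x => (r <= Y x)%R%:R * w x) = meanO w - prim w c].
Proof.
move=> wi nY; have [c [c01 lo hi nf]] := monotone_level r nY.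
exists c; split => //.
have mY := nondecreasing_Omega_measurable nY.
have i1 := integrableO_if (measurable_ltc c) wi.
rewrite -meanOB//; apply: (@meanO_eq1 c).
- exact: (integrableO_if (measurable_ler_cst r mY)).
- exact: integrableOB.
- move=> x Ox xc; have [h|h] := ltP x c.
    by rewrite leNgt lo// mul0r mul1r subrr.
  by rewrite hi// ?lt_neqAle 1?eq_sym ?xc// mul0r mul1r subr0.
Qed.

(** The integration by parts formula, giving the integral of w Y as that of
    - P dY with P the primitive of w, in a form that avoids the Stieltjes
    measure dY: the pairing of w with a superlevel set of Y is - P(c) at its
    threshold c, which is a point where Y is not flat. *)
Lemma polar_le w Y : integrableO w ->
  (forall x y, Om x -> Om y -> x <= y -> Y x <= Y y) ->
  integrableO (fun x => w x * Y x) -> meanO w = 0 ->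
  (forall c, 0 < c < 1 -> ~ Omega_flat Y c -> 0 <= prim w c) ->
  meanO (fun x => w x * Y x) <= 0.
Proof.
move=> wi nY wYi w0 P.
apply: superposition_le => //; first exact: nondecreasing_Omega_measurable.
move=> r; have [c [/andP[c0 c1] nf ->]] := level_mean r wi nY.
rewrite w0 sub0r oppr_le0.
move: c0; rewrite le_eqVlt => /predU1P[<-|c0]; first by rewrite prim0.
move: c1; rewrite le_eqVlt => /predU1P[->|c1]; first by rewrite prim1 w0.
by apply: P; [rewrite c0|apply: nf; rewrite c0].
Qed.

Lemma polar_eq w Y : integrableO w ->
  (forall x y, Om x -> Om y -> x <= y -> Y x <= Y y) ->
  integrableO (fun x => w x * Y x) -> meanO w = 0 ->
  (forall c, 0 < c < 1 -> ~ Omega_flat Y c -> prim w c = 0) ->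
  meanO (fun x => w x * Y x) = 0.
Proof.
move=> wi nY wYi w0 P; apply/eqP; rewrite eq_le; apply/andP; split.
  by apply: polar_le => // c c01 nf; rewrite P.
have E f : (fun x : R => - f x) = (fun x => -1 * f x).
  by apply/funext => x; rewrite mulN1r.
have wiN : integrableO (fun x => - w x) by rewrite E; exact: integrableOZ.
rewrite -oppr_le0 -mulN1r -meanOZ//.
rewrite (@meanO_eq _ _ (fun x => - w x * Y x)); last first.
  by move=> x _; rewrite mulN1r mulNr.
apply: polar_le => //.
- by apply: integrableO_eq (integrableOZ (-1) wYi) => x _; rewrite mulN1r mulNr.
- by rewrite E meanOZ// w0 mulr0.
- by move=> c c01 nf; rewrite primN// P// oppr0.
Qed.

Lemma prim_sub w x y : integrableO w -> x <= y ->
  prim w y - prim w x = meanO (fun z => (x <= z < y)%R%:R * w z).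
Proof.
move=> wi xy; rewrite /prim -meanOB.
- apply: meanO_eq => z _; rewrite -mulrBl; congr (_ * _).
  have [zx|zx] := ltP z x; first by rewrite (lt_le_trans zx xy) subrr.
  by case: (z < y); rewrite subr0.
- by apply: integrableO_if => //; exact: measurable_ltc.
- by apply: integrableO_if => //; exact: measurable_ltc.
Qed.

Lemma measurable_lec_ltc x y : measurable_fun Om (fun z : R => x <= z < y).
Proof.
by apply: measurable_and; [exact: measurable_fun_ler|exact: measurable_fun_ltr].
Qed.

(** Absolute continuity of the integral. *)
Lemma prim_continuous w : integrableO w -> continuous (prim w).
Proof.
move=> wi; pose f := w \_ Om.
have fi : mu.-integrable setT (EFin \o f).
  by rewrite -restrict_EFin; apply/(integrable_mkcond _ (@measurable_Omega R)).
have key e : 0 < e -> exists2 d, 0 < d & forall x y, x <= y -> y - x < d ->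
    `|prim w y - prim w x| < e.
  move=> e0; have [d [d0 H]] := integral_normr_continuous fi e0.
  exists d => // x y xy yxd.
  have muE : mu `[x, y[ = (y - x)%:E.
    rewrite lebesgue_measure_itv/= lte_fin.
    by case: ifP => // /negbT; rewrite -leNgt => yx; congr EFin; lra.
  have := H `[x, y[%classic (measurable_itv _).
  rewrite [X in (X < _)%E -> _]muE lte_fin => /(_ yxd); apply: le_lt_trans.
  have ii := integrableO_if (measurable_lec_ltc x y) wi.
  rewrite prim_sub//; apply: le_trans (le_normr_Rintegral (@measurable_Omega R) ii) _.
  rewrite le_eqVlt; apply/orP; left; apply/eqP.
  rewrite [RHS]Rintegral_mkcond [LHS]Rintegral_mkcond.
  apply: eq_Rintegral => z _; rewrite /f /patch.
  rewrite [z \in `[x, y[%classic](_ : _ = (x <= z < y)); last first.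
    by apply/idP/idP; rewrite inE/= in_itv.
  by case: ifP => Oz; case: ifP => h; rewrite ?normr0 ?mul1r ?mul0r ?normr0.
move=> x; apply/cvgrPdist_lt => e e0; have [d d0 H] := key e e0.
exists d => //= y; rewrite /ball_/= => xyd.
have [xy|xy] := leP x y.
  by rewrite distrC; apply: H => //; rewrite ltr_distlC in xyd; lra.
by apply: H; [exact: ltW|move: xyd; rewrite ltr_norml; lra].
Qed.

End duality.

(** * The cone of nondecreasing functions and its polar *)

Section monotone_cone.
Context {R : realType}.
Implicit Types (f g w X Y : R -> R) (a b c m r : R).
Local Notation mu := (@lebesgue_measure R).
Local Notation Om := (@Omega R).

Lemma cone_mono X x y : cone X -> Om x -> Om y -> x <= y -> X x <= X y.
Proof. by case=> _ + _; apply. Qed.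

Lemma cone_L2 X : cone X -> in_L2 X.
Proof. by case. Qed.

Lemma cone_cst c : cone (fun=> c : R).
Proof. by split; [exact: in_L2_cst| |move=> x _; exact: cvg_cst]. Qed.

Lemma coneD X Y : cone X -> cone Y -> cone (fun x => X x + Y x).
Proof.
move=> [XL Xm Xc] [YL Ym Yc]; split.
- exact: in_L2D.
- by move=> x y Ox Oy xy; rewrite lerD ?Xm ?Ym.
- by move=> x Ox; apply: cvgD; [exact: Xc|exact: Yc].
Qed.

Lemma coneZ a X : 0 <= a -> cone X -> cone (fun x => a * X x).
Proof.
move=> a0 [XL Xm Xc]; split.
- exact: in_L2Z.
- by move=> x y Ox Oy xy; rewrite ler_wpM2l ?Xm.
- by move=> x Ox; apply: cvgM; [exact: cvg_cst|exact: Xc].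
Qed.

Lemma cone_comp (phi : R -> R) X : {homo phi : x y / x <= y} ->
  (forall x y, `|phi y - phi x| <= `|y - x|) -> cone X -> cone (phi \o X).
Proof.
move=> ph pl CX; have [XL Xm Xc] := CX; split.
- apply: (@in_L2_le _ _ (fun x => (2 * `|phi 0| ^+ 2 + 2 * X x ^+ 2))).
  + apply: nondecreasing_Omega_measurable => x y Ox Oy xy.
    by apply: ph; exact: Xm.
  + by apply: integrableOD; [exact: integrableO_cst|exact/integrableOZ/in_L2_sqr].
  + move=> x _ /=; have := pl 0 (X x); rewrite subr0 => h.
    have h2 : `|phi (X x) - phi 0| ^+ 2 <= `|X x| ^+ 2 by rewrite lerXn2r ?nnegrE.
    rewrite real_normK ?num_real//; rewrite !real_normK ?num_real// in h2.
    by have := sqr_ge0 (2 * phi 0 - phi (X x)); nra.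
- by move=> x y Ox Oy xy; apply: ph; exact: Xm.
- move=> x Ox; apply/cvgrPdist_le => /= e e0.
  have /cvgrPdist_le /(_ e e0) := Xc x Ox.
  by apply: filterS => y; apply: le_trans; exact: pl.
Qed.

Lemma indicator_itv_L2 a b : in_L2 (fun x : R => (a <= x < b)%R%:R).
Proof.
apply: (@in_L2_le _ _ (fun=> 1)); last 1 first.
- by move=> x _; case: (a <= x < b)%R; rewrite ?expr1n ?expr0n.
- apply: (@measurableT_comp _ _ _ _ _ _ (fun b : bool => b%:R : R)) => //.
  exact: measurable_lec_ltc.
- exact: integrableO_cst.
Qed.

Lemma cone_step c : cone (fun x : R => (c <= x)%R%:R).
Proof.
split.
- apply: (@in_L2_le _ _ (fun=> 1)); last 1 first.
  + by move=> x _; case: (c <= x)%R; rewrite ?expr1n ?expr0n.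
  + apply: (@measurableT_comp _ _ _ _ _ _ (fun b : bool => b%:R : R)) => //.
    exact: measurable_fun_ler.
  + exact: integrableO_cst.
- move=> x y _ _ xy; have [h|//] := leP c x; by rewrite (le_trans h xy).
- move=> x _; have [h|h] := leP c x.
    apply: cvg_near_cst; near=> y; rewrite (le_trans h)//.
  apply: cvg_near_cst; near=> y.
  by rewrite leNgt (_ : y < c)//; near: y; exact: nbhs_right_lt.
Unshelve. all: end_near. Qed.

Definition clamp a b (z : R) := Num.min (Num.max z a) b.

Lemma clamp_props a b : a <= b ->
  [/\ {homo clamp a b : x y / x <= y}, {homo (fun z => z - clamp a b z) : x y / x <= y},
   (forall x y, `|clamp a b y - clamp a b x| <= `|y - x|) &
   (forall x y, `|(y - clamp a b y) - (x - clamp a b x)| <= `|y - x|)].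
Proof.
move=> ab.
have key x y : x <= y -> 0 <= clamp a b y - clamp a b x <= y - x.
  move=> xy; rewrite /clamp /Num.min /Num.max.
  by case: (ltP x a) => h1; case: (ltP y a) => h2; (try (case: ltP => h3));
    (try (case: ltP => h4)); apply/andP; split; lra.
split.
- by move=> x y /key /andP[? _]; lra.
- by move=> x y /key /andP[? ?]; lra.
- move=> x y; have [/key/andP[h1 h2]|/ltW/key/andP[h1 h2]] := leP x y.
    by rewrite !ger0_norm//; lra.
  by rewrite distrC [leRHS]distrC !ger0_norm//; lra.
- move=> x y; have [/key/andP[h1 h2]|/ltW/key/andP[h1 h2]] := leP x y.
    by rewrite !ger0_norm//; lra.
  by rewrite distrC [leRHS]distrC !ger0_norm//; lra.
Qed.

Definition polar_cone w := in_L2 w /\ forall Y, cone Y -> dotO w Y <= 0.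

(** The normal cone of a convex cone at X consists of the vectors of the polar
    cone that are orthogonal to X: testing with 0 and 2 X gives both signs of
    the pairing with X. *)
Lemma subdiff_coneP X w : cone X ->
  subdiff_cone X w <-> polar_cone w /\ dotO w X = 0.
Proof.
move=> CX; have XL := cone_L2 CX.
have E Y : in_L2 w -> cone Y -> (\int[mu]_(m in Om)
    ((w m * (Y m - X m))%:E : \bar R))%E = (dotO w Y - dotO w X)%:E.
  move=> wL CY; have YL := cone_L2 CY.
  rewrite meanOE; last by apply: integrableO_mul => //; exact: in_L2B.
  by congr EFin; rewrite -dotOBr.
split=> [[wL H]|[[wL H] H0]]; last first.
  by split=> // Y CY; rewrite E// lee_fin H0 subr0 H.
have wX : dotO w X = 0.
  have h1 := H _ (cone_cst 0).
  rewrite E// in h1; last exact: cone_cst.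
  have h2 := H _ (coneD CX CX); rewrite E// in h2; last exact: coneD.
  rewrite lee_fin dotODr// in h2.
  rewrite lee_fin (_ : dotO w (fun=> 0) = 0) in h1; first by lra.
  by rewrite /dotO (@meanO_eq _ _ (fun=> 0)) ?meanO_cst// => x _; rewrite mulr0.
split=> //; split=> // Y CY; have := H _ CY.
by rewrite E// lee_fin wX subr0.
Qed.

(** Test with the constants 1 and -1, then with the unit steps. *)
Lemma polar_prim w : polar_cone w ->
  meanO w = 0 /\ forall c, 0 <= prim w c.
Proof.
move=> [wL H]; have wi := in_L2_integrable wL.
have w0 : meanO w = 0.
  have h1 := H _ (cone_cst 1); have h2 := H _ (cone_cst (-1)).
  move: h1 h2; rewrite /dotO.
  have -> : (fun x => w x * 1) = w by apply/funext => x; rewrite mulr1.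
  have -> : (fun x => w x * -1) = (fun x => -1 * w x).
    by apply/funext => x; rewrite mulrC.
  by rewrite meanOZ//; lra.
split=> // c; have := H _ (cone_step c).
have -> : dotO w (fun x => (c <= x)%R%:R) = meanO (fun x => w x - (x < c)%R%:R * w x).
  apply: meanO_eq => x _; rewrite leNgt; case: (x < c)%R.
    by rewrite mulr0 mul1r subrr.
  by rewrite mulr1 mul0r subr0.
rewrite meanOB//; first by rewrite w0 /prim; lra.
exact: (integrableO_if (measurable_ltc c) wi).
Qed.

Lemma prim_cst a c : 0 <= c <= 1 -> prim (fun=> a) c = a * c.
Proof.
move=> /andP[c0 c1]; rewrite /prim.
have -> : (fun x : R => (x < c)%R%:R * a) = (fun x => a * (x < c)%R%:R).
  by apply/funext => x; rewrite mulrC.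
have ii : integrableO (fun x : R => (x < c)%R%:R).
  apply: integrableO_eq (integrableO_if (measurable_ltc c) (integrableO_cst 1)) => x _.
  by rewrite mulr1.
rewrite meanOZ//; congr (_ * _).
rewrite (@meanO_eq _ _ (fun x => (cst (1:R) \_ `]-oo, c[%classic) x)).
  rewrite /meanO -Rintegral_mkcondr Rintegral_cst; last first.
    by apply: measurableI; exact: measurable_itv.
  rewrite mul1r.
  have -> : Om `&` `]-oo, c[ = `]0, c[%classic.
    apply/seteqP; split=> x /=; rewrite /Omega/= !in_itv/=.
      by move=> [/andP[-> _] ->].
    by move=> /andP[-> xc]; rewrite xc (lt_le_trans xc c1).
  have -> : fine (mu `]0, c[%classic) = c; last by [].
  rewrite lebesgue_measure_itv/= lte_fin.
  case: ifP => [_|/negbT]; rewrite ?oppr0 ?addr0//= -leNgt => c00.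
  by apply/eqP; rewrite eq_le c0 c00.
move=> x _ /=; rewrite /patch.
by rewrite (_ : (x \in `]-oo, c[%classic) = (x < c)%R)//;
  [case: (x < c)%R|apply/idP/idP; rewrite inE/= in_itv].
Qed.

Lemma mean_itv a b : 0 <= a -> a <= b -> b <= 1 ->
  meanO (fun x : R => (a <= x < b)%R%:R) = b - a.
Proof.
move=> a0 ab b1.
rewrite (@meanO_eq _ _ (fun x : R => (a <= x < b)%R%:R * 1)); last first.
  by move=> x _; rewrite mulr1.
rewrite -(prim_sub (integrableO_cst 1))// !prim_cst ?mul1r//.
  by rewrite a0 (le_trans ab).
by rewrite (le_trans a0).
Qed.

(** The density whose primitive is a trapezoid: it grows from 0 to 1 to the left
    of c, stays equal to 1 at a distance less than d / 2 of c, and comes back to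
    0 at c + d. *)
Definition dipole c d x : R :=
  2 / d * ((c - d <= x < c - d / 2)%R%:R - (c + d / 2 <= x < c + d)%R%:R).

Section dipole.
Variables (c d : R).
Hypotheses (d0 : 0 < d) (dc : d <= c) (dc1 : d <= 1 - c).
Let r1 x : R := (c - d <= x < c - d / 2)%R%:R.
Let r2 x : R := (c + d / 2 <= x < c + d)%R%:R.

Let r1L : in_L2 r1. Proof. exact: indicator_itv_L2. Qed.
Let r2L : in_L2 r2. Proof. exact: indicator_itv_L2. Qed.
Let r1i : integrableO r1. Proof. exact: in_L2_integrable. Qed.
Let r2i : integrableO r2. Proof. exact: in_L2_integrable. Qed.
Let m1 : meanO r1 = d / 2.
Proof. by have := (d0, dc, dc1) => -[[]] *; rewrite /r1 mean_itv; lra. Qed.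
Let m2 : meanO r2 = d / 2.
Proof. by have := (d0, dc, dc1) => -[[]] *; rewrite /r2 mean_itv; lra. Qed.

Lemma dipole_L2 : in_L2 (dipole c d).
Proof. by apply: in_L2Z; exact: in_L2B. Qed.

Lemma mean_dipole : meanO (dipole c d) = 0.
Proof.
by rewrite /dipole meanOZ ?meanOB ?m1 ?m2 ?subrr ?mulr0//; exact: integrableOB.
Qed.

Let prim_dipole m : prim (dipole c d) m = 2 / d * (prim r1 m - prim r2 m).
Proof. by rewrite primZ ?primB//; exact: integrableOB. Qed.

Lemma prim_dipole_le1 m : prim (dipole c d) m <= 1.
Proof.
have h1 : prim r1 m <= d / 2.
  rewrite -m1; apply: le_meanO => //.
    exact: (integrableO_if (measurable_ltc m)).
  by move=> x _; rewrite /r1; case: (x < m)%R; case: (c - d <= x < c - d / 2)%R;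
    rewrite ?mul1r ?mul0r.
have h2 : 0 <= prim r2 m by apply: meanO_ge0 => x _; rewrite mulr_ge0.
rewrite prim_dipole [leRHS](_ : 1 = 2 / d * (d / 2)); last first.
  by field; rewrite gt_eqF.
by rewrite ler_pM2l ?divr_gt0//; lra.
Qed.

Lemma prim_dipole_lt m : m < c - d -> prim (dipole c d) m = 0.
Proof.
have := d0 => d_gt0 h; rewrite /prim (@meanO_eq _ _ (fun=> 0)) ?meanO_cst// => x _.
have [xm|xm] := ltP x m; last by rewrite mul0r.
rewrite /dipole !leNgt (lt_trans xm h).
have -> : (x < c + d / 2)%R = true by lra.
by rewrite /= subr0 !mulr0.
Qed.

Lemma prim_dipole_gt m : c + d < m -> prim (dipole c d) m = 0.
Proof.
have := d0 => d_gt0 h; rewrite prim_dipole.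
have full (r : R -> R) : (forall x, m <= x -> r x = 0) -> prim r m = meanO r.
  move=> r0; apply: meanO_eq => x _; have [xm|xm] := ltP x m; first by rewrite mul1r.
  by rewrite r0// mul0r.
rewrite !full ?m1 ?m2 ?subrr ?mulr0// => x mx.
  by rewrite /r2 (_ : (x < c + d)%R = false) ?andbF//; apply/negbTE; rewrite -leNgt; lra.
by rewrite /r1 (_ : (x < c - d / 2)%R = false) ?andbF//; apply/negbTE; rewrite -leNgt; lra.
Qed.

Lemma dot_dipole J alpha beta : in_L2 J ->
  (forall x, Om x -> c - d <= x < c - d / 2 -> J x = alpha) ->
  (forall x, Om x -> c + d / 2 <= x < c + d -> J x = beta) ->
  dotO (dipole c d) J = alpha - beta.
Proof.
move=> JL Ja Jb; rewrite /dipole dotOZl//; last exact: in_L2B.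
rewrite dotOBl//.
have -> : dotO r1 J = alpha * (d / 2).
  rewrite -m1 -meanOZ//; apply: meanO_eq => x Ox; rewrite mulrC /r1.
  by case: (boolP (c - d <= x < c - d / 2)%R) => [/(Ja _ Ox)->|_]; rewrite ?mulr0.
have -> : dotO r2 J = beta * (d / 2).
  rewrite -m2 -meanOZ//; apply: meanO_eq => x Ox; rewrite mulrC /r2.
  by case: (boolP (c + d / 2 <= x < c + d)%R) => [/(Jb _ Ox)->|_]; rewrite ?mulr0.
by field; rewrite gt_eqF.
Qed.

End dipole.

(** Suppose that the primitive of w is positive at a point c where X is not
    flat. Subtracting from w a small multiple of a dipole around c keeps the
    primitive nonnegative, so the difference still lies in the polar cone. Let J
    be X clamped between its values at the two sides of c. Both J and X - J are
    in K and their pairings with w add up to zero, so w is orthogonal to J,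
    whereas the pairing of the dipole with J is the difference of these two
    values, which is negative: a contradiction. *)
Lemma polar_contact w X c : polar_cone w -> cone X -> dotO w X = 0 ->
  0 < c < 1 -> ~ Omega_flat X c -> prim w c = 0.
Proof.
move=> pw CX wX /andP[c0 c1] nf.
have [w0 P] := polar_prim pw; have [wL H] := pw.
have wi := in_L2_integrable wL.
apply/eqP; rewrite eq_le P andbT leNgt; apply/negP => p0.
set p := prim w c in p0.
have p20 : 0 < p / 2 by rewrite divr_gt0.
have /cvgrPdist_lt /(_ _ p20) [e /= e0 He] := prim_continuous wi (x := c).
pose d := Num.min (e / 2) (Num.min c (1 - c)).
have d0 : 0 < d by rewrite !lt_min; apply/and3P; split; lra.
have de : d <= e / 2 by rewrite ge_min lexx.
have dc : d <= c by rewrite !ge_min lexx orbT.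
have dc1 : d <= 1 - c by rewrite !ge_min lexx !orbT.
have {He de e0} Pd m : c - d <= m <= c + d -> p / 2 <= prim w m.
  move=> /andP[h1 h2].
  have : `|p - prim w m| < p / 2.
    by apply: He; rewrite /ball_/= ltr_norml; apply/andP; split; lra.
  by rewrite ltr_norml => /andP[? ?]; lra.
have Oa : Om (c - d / 2) by rewrite OmegaE; apply/andP; split; lra.
have Ob : Om (c + d / 2) by rewrite OmegaE; apply/andP; split; lra.
have [a aE] : exists a : R, c - d / 2 = a by eexists.
have [b bE] : exists b : R, c + d / 2 = b by eexists.
rewrite aE bE in Oa Ob.
have Xab : X a < X b.
  rewrite ltNge; apply/negP => Xba; apply: nf.
  apply/Omega_flatP; exists (d / 2); split; try lra.
  have key x : a <= x <= b -> X x = X a.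
    move=> /andP[h1 h2]; have Ox : Om x.
      move: Oa Ob; rewrite !OmegaE => /andP[? ?] /andP[? ?].
      by apply/andP; split; lra.
    apply/eqP; rewrite eq_le (cone_mono CX Oa Ox h1) andbT.
    by apply: le_trans Xba; exact: cone_mono.
  by move=> x /andP[h1 h2]; rewrite (key x) ?(key c)//; apply/andP; split; lra.
have [cl1 cl2 cl3 cl4] := clamp_props (ltW Xab).
pose J := clamp (X a) (X b) \o X.
have CJ : cone J by exact: cone_comp.
have CXJ : cone ((fun z => z - clamp (X a) (X b) z) \o X) by exact: cone_comp.
have JL := cone_L2 CJ.
have wJ : dotO w J = 0.
  have h1 := H _ CJ; have := H _ CXJ.
  rewrite (_ : dotO w _ = dotO w X - dotO w J); first by rewrite wX; lra.
  by rewrite -dotOBr//; exact: cone_L2.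
pose rho := dipole c d.
have rhoL : in_L2 rho by exact: dipole_L2.
have rhoi := in_L2_integrable rhoL.
have : dotO (fun x => w x - p / 2 * rho x) J <= 0.
  apply: polar_le.
  - by apply: integrableOB => //; exact: integrableOZ.
  - by move=> x y; exact: cone_mono.
  - by apply: integrableO_mul => //; apply: in_L2B => //; exact: in_L2Z.
  - by rewrite (meanOB wi (integrableOZ _ rhoi)) meanOZ// w0 mean_dipole// mulr0 subr0.
  - move=> m _ _; rewrite primB ?(@primZ _ (p / 2) rho)//; last exact: integrableOZ.
    have Pm := P m; have [h|h] := ltP m (c - d).
      by rewrite prim_dipole_lt// mulr0 subr0.
    have [h'|h'] := leP m (c + d); last by rewrite prim_dipole_gt// mulr0 subr0.
    rewrite subr_ge0; apply: le_trans (Pd m _); last by rewrite h h'.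
    by rewrite -[leRHS]mulr1 ler_pM2l// prim_dipole_le1.
rewrite dotOBl//; last exact: in_L2Z.
rewrite wJ dotOZl// sub0r oppr_le0 pmulr_rge0//.
rewrite (@dot_dipole _ _ _ dc dc1 J (X a) (X b))//; first by lra.
- move=> x Ox /andP[_ xa]; have h : X x <= X a by apply: cone_mono => //; lra.
  by rewrite /J /= /clamp (max_idPr h) (min_idPl (ltW Xab)).
- move=> x Ox /andP[bx _]; have h : X b <= X x by apply: cone_mono => //; lra.
  by rewrite /J /= /clamp (max_idPl (le_trans (ltW Xab) h)) (min_idPr h).
Qed.

(** Points where Y is not flat are points where X is not flat, and there the
    primitive of w vanishes; so nothing is left of the integral of - P dY. *)
Lemma flat_orthogonal w X Y : polar_cone w -> cone X -> dotO w X = 0 ->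
  cone Y -> Omega_flat X `<=` Omega_flat Y -> dotO w Y = 0.
Proof.
move=> pw CX wX CY XY; have [w0 _] := polar_prim pw.
have wL := pw.1; apply: polar_eq => //.
- exact: in_L2_integrable.
- by move=> x y; exact: cone_mono.
- by apply: integrableO_mul => //; exact: cone_L2.
- move=> c c01 nf; apply: (polar_contact pw CX wX c01).
  by apply: contra_not nf; exact: XY.
Qed.

End monotone_cone.

(** * Convex envelopes of continuous functions on the unit interval *)

Section envelope.
Context {R : realType}.
Variable G : R -> R.
Hypothesis cG : continuous G.
Implicit Types (a b c d e h m p q x y z : R).
Local Notation Om := (@Omega R).
Local Notation Phi := (convex_envelope G).
Local Notation X := (right_derivative Phi).

Definition minorant a b := forall x, Om x -> a + b * x <= G x.

Lemma affine_continuous a b : continuous (fun x : R => a + b * x).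
Proof.
move=> x; apply: cvgD; first exact: cvg_cst.
by apply: cvgM; [exact: cvg_cst|exact: cvg_id].
Qed.

Lemma gap_continuous a b : continuous (fun x => G x - (a + b * x)).
Proof. by move=> x; apply: cvgB; [exact: cG|exact: affine_continuous]. Qed.

Lemma gap_pos_near a b x : a + b * x < G x ->
  exists2 d : R, 0 < d & forall y, x - d < y < x + d -> a + b * y < G y.
Proof.
rewrite -subr_gt0 => h.
have /cvgrPdist_lt /(_ _ h)[d /= d0 H] := @gap_continuous a b x.
exists d => // y /andP[h1 h2]; have : ball_ Num.norm x d y.
  by rewrite /ball_/= ltr_norml; apply/andP; split; lra.
by move/H; rewrite ltr_norml => /andP[_]; lra.
Qed.

Lemma gap_neg_near a b x : G x < a + b * x ->
  exists2 d : R, 0 < d & forall y, x - d < y < x + d -> G y < a + b * y.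
Proof.
rewrite -subr_gt0 => h.
have /cvgrPdist_lt /(_ _ h)[d /= d0 H] := @gap_continuous a b x.
exists d => // y /andP[h1 h2]; have : ball_ Num.norm x d y.
  by rewrite /ball_/= ltr_norml; apply/andP; split; lra.
by move/H; rewrite ltr_norml => /andP[]; lra.
Qed.

Lemma near_Omega (x d : R) : 0 <= x -> x <= 1 -> 0 < d ->
  exists2 y, Om y & x - d < y < x + d.
Proof.
move=> x0 x1 d0; have [h|h] := leP x (1 / 2).
  exists (Num.min (x + d / 2) (3 / 4)); rewrite ?OmegaE /Num.min;
    case: (ltP (x + d / 2) (3 / 4)) => h'; apply/andP; split; lra.
exists (Num.max (x - d / 2) (1 / 4)); rewrite ?OmegaE /Num.max;
  case: (ltP (x - d / 2) (1 / 4)) => h'; apply/andP; split; lra.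
Qed.

Lemma minorant_closed a b x : minorant a b -> 0 <= x <= 1 -> a + b * x <= G x.
Proof.
move=> H /andP[x0 x1]; rewrite leNgt; apply/negP => /gap_neg_near[d d0 Hd].
have [y Oy /Hd] := near_Omega x0 x1 d0.
by apply/negP; rewrite -leNgt; exact: H.
Qed.

Lemma gap_min a b p q : p <= q ->
  exists2 c, p <= c <= q & forall x, p <= x <= q ->
    G c - (a + b * c) <= G x - (a + b * x).
Proof.
move=> pq; have [|c cpq H] := @EVT_min _ (fun x => G x - (a + b * x)) p q pq.
  by apply: continuous_subspaceT; exact: gap_continuous.
exists c; first by rewrite in_itv/= in cpq.
by move=> x hx; apply: H; rewrite in_itv.
Qed.

Lemma exists_minorant : exists a, minorant a 0.
Proof.
have [c _ H] := gap_min 0 0 (@ler01 R).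
exists (G c) => x; rewrite OmegaE => /andP[x0 x1]; have := H x.
by rewrite !mul0r !addr0 !subr0; apply; rewrite !ltW.
Qed.

Lemma envelope_lub x C : (forall a b, minorant a b -> a + b * x <= C) -> Phi x <= C.
Proof.
move=> H; apply: ge_sup => [|_ [a [b [ab ->]]]]; last exact: H.
by have [a ha] := exists_minorant; exists (a + 0 * x), a, 0.
Qed.

Lemma envelope_le x : 0 <= x <= 1 -> Phi x <= G x.
Proof. by move=> x01; apply: envelope_lub => a b ab; exact: minorant_closed. Qed.

Lemma minorant_envelope a b x : minorant a b -> 0 <= x <= 1 -> a + b * x <= Phi x.
Proof.
move=> ab x01; apply: ub_le_sup; last by exists a, b.
by exists (G x) => _ [a' [b' [ab' ->]]]; exact: minorant_closed.
Qed.

Lemma envelope_convex x y z : 0 <= x -> z <= 1 -> x <= y -> y <= z ->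
  (z - x) * Phi y <= (z - y) * Phi x + (y - x) * Phi z.
Proof.
move=> x0 z1 xy yz.
have [xz|zx] := ltP x z; last first.
  have -> : y = x by lra.
  have -> : z = x by lra.
  lra.
rewrite mulrC -ler_pdivlMr ?subr_gt0//; apply: envelope_lub => a b ab.
rewrite ler_pdivlMr ?subr_gt0//.
have hx : a + b * x <= Phi x by apply: minorant_envelope => //; apply/andP; split; lra.
have hz : a + b * z <= Phi z by apply: minorant_envelope => //; apply/andP; split; lra.
have : (z - y) * (a + b * x) <= (z - y) * Phi x by apply: ler_wpM2l => //; lra.
have : (y - x) * (a + b * z) <= (y - x) * Phi z by apply: ler_wpM2l => //; lra.
nra.
Qed.

Lemma envelope_slope_le x y z : 0 <= x -> z <= 1 -> x < y -> y < z ->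
  (Phi y - Phi x) / (y - x) <= (Phi z - Phi x) / (z - x) /\
  (Phi y - Phi x) / (y - x) <= (Phi z - Phi y) / (z - y).
Proof.
move=> x0 z1 xy yz; have h := envelope_convex x0 z1 (ltW xy) (ltW yz).
split.
  rewrite ler_pdivrMr ?subr_gt0// mulrAC ler_pdivlMr ?subr_gt0 ?(lt_trans xy)//.
  nra.
rewrite ler_pdivrMr ?subr_gt0// mulrAC ler_pdivlMr ?subr_gt0//.
nra.
Qed.

Definition slopes m := [set h^-1 * (Phi (m + h) - Phi m) | h in `]0, 1 - m[%classic].

Lemma slopes_lbound m x : 0 <= x -> x < m -> m < 1 ->
  lbound (slopes m) ((Phi m - Phi x) / (m - x)).
Proof.
move=> x0 xm m1 y [h /=]; rewrite in_itv/= => /andP[h0 h1] <-.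
have mh : m + h <= 1 by lra.
have [_] := envelope_slope_le x0 mh xm (ltr_pwDr h0 (lexx m)).
by rewrite (addrC m h) addrK (addrC h m) [h^-1 * _]mulrC.
Qed.

(** Difference quotients of a convex function are monotone, so that the limit
    defining the right derivative exists and is their infimum. *)
Lemma right_derivative_inf m : Om m -> X m = inf (slopes m).
Proof.
rewrite OmegaE => /andP[m0 m1]; apply: cvg_lim; first exact: Rhausdorff.
apply: (@nondecreasing_at_right_cvgr _ _ _ (BLeft (1 - m))).
- by rewrite bnd_simp subr_gt0.
- move=> h k; rewrite !in_itv/= => /andP[h0 h1] /andP[k0 k1].
  rewrite le_eqVlt => /predU1P[->//|hk].
  have mk : m + k <= 1 by lra.
  have mh : m < m + h by lra.
  have mhk : m + h < m + k by lra.
  have [+ _] := envelope_slope_le (ltW m0) mk mh mhk.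
  by rewrite ![m + _]addrC !addrK ![_ / _]mulrC.
- by exists ((Phi m - Phi 0) / (m - 0)); exact: slopes_lbound.
Qed.

Lemma slopes_has_inf m : Om m -> has_inf (slopes m).
Proof.
rewrite OmegaE => /andP[m0 m1]; split.
  by eexists; exists ((1 - m) / 2) => //=; rewrite in_itv/=; apply/andP; split; lra.
by exists ((Phi m - Phi 0) / (m - 0)); exact: slopes_lbound.
Qed.

Lemma envelope_support m y : Om m -> 0 <= y <= 1 ->
  Phi m + X m * (y - m) <= Phi y.
Proof.
move=> Om_m /andP[y0 y1]; have := Om_m; rewrite OmegaE => /andP[m0 m1].
have [ym|my|->] := ltgtP y m; last by rewrite subrr mulr0 addr0.
  have : (Phi m - Phi y) / (m - y) <= X m.
    rewrite right_derivative_inf//; apply: lb_le_inf.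
      exact: (slopes_has_inf Om_m).1.
    exact: slopes_lbound.
  by rewrite ler_pdivrMr ?subr_gt0//; lra.
have key z : m < z -> z < 1 -> X m <= (Phi z - Phi m) / (z - m).
  move=> mz z1; rewrite right_derivative_inf//; apply: ge_inf.
    exact: (slopes_has_inf Om_m).2.
  exists (z - m); first by rewrite /= in_itv/=; apply/andP; split; lra.
  by rewrite (addrC m) subrK mulrC.
have : X m <= (Phi y - Phi m) / (y - m).
  have h1 : m < (m + y) / 2 by lra.
  have h2 : (m + y) / 2 < y by lra.
  apply: le_trans (envelope_slope_le (ltW m0) y1 h1 h2).1.
  by apply: key; lra.
by rewrite ler_pdivlMr ?subr_gt0//; lra.
Qed.

Lemma envelope_slope_approx m e : Om m -> 0 < e ->
  exists2 z, m < z < 1 & Phi z - Phi m < (X m + e) * (z - m).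
Proof.
move=> Om_m e0; have [_ [h /= + <-]] := inf_adherent e0 (slopes_has_inf Om_m).
rewrite in_itv/= -right_derivative_inf// => /andP[h0 h1].
rewrite mulrC ltr_pdivrMr// => H; exists (m + h); first by apply/andP; split; lra.
by rewrite [m + h - m](_ : _ = h)//; lra.
Qed.

Lemma right_derivative_slope x y : Om x -> Om y -> x < y ->
  X x * (y - x) <= Phi y - Phi x /\ Phi y - Phi x <= X y * (y - x).
Proof.
move=> Ox Oy xy.
have y01 : 0 <= y <= 1 by move: Oy; rewrite OmegaE => /andP[/ltW-> /ltW->].
have x01 : 0 <= x <= 1 by move: Ox; rewrite OmegaE => /andP[/ltW-> /ltW->].
have := envelope_support Ox y01; have := envelope_support Oy x01.
by split; lra.
Qed.

Lemma right_derivative_mono x y : Om x -> Om y -> x <= y -> X x <= X y.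
Proof.
move=> Ox Oy; rewrite le_eqVlt => /predU1P[->//|xy].
have [h1 h2] := right_derivative_slope Ox Oy xy.
have : X x * (y - x) <= X y * (y - x) by lra.
by rewrite ler_pM2r ?subr_gt0.
Qed.

(** Close to x on its right, the slope at y is at most the slope of the chord
    from y to a fixed z whose chord from x is nearly as flat as the tangent at
    x. *)
Lemma right_derivative_right_continuous x : Om x -> X y @[y --> x^'+] --> X x.
Proof.
move=> Ox; apply/cvgrPdist_le => /= e e0.
have := Ox; rewrite OmegaE => /andP[x0 x1].
have e20 : 0 < e / 2 by rewrite divr_gt0.
have [z /andP[xz z1] hz] := envelope_slope_approx Ox e20.
pose d := (z - x) / 2.
have d0 : 0 < d by rewrite divr_gt0// subr_gt0.
near=> y.
have xy : x < y by near: y; exact: nbhs_right_gt.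
have yd : y < x + d by near: y; apply: nbhs_right_lt; rewrite ltrDl.
have Oy : Om y by rewrite OmegaE; rewrite /d in yd; apply/andP; split; lra.
have Oz : Om z by rewrite OmegaE; apply/andP; split; lra.
have h1 := right_derivative_mono Ox Oy (ltW xy).
rewrite ler0_norm ?subr_le0// opprB lerBlDl.
have yz : y < z by rewrite /d in yd; lra.
have [h2 _] := right_derivative_slope Oy Oz yz.
have [h3 _] := right_derivative_slope Ox Oy xy.
have : (X y - X x) * (z - y) <= e * (z - y).
  by rewrite /d in yd; nra.
by rewrite ler_pM2r ?subr_gt0//; lra.
Unshelve. all: end_near. Qed.

Lemma support_minorant m : Om m -> minorant (Phi m - X m * m) (X m).
Proof.
move=> Om_m y; rewrite OmegaE => /andP[/ltW y0 /ltW y1].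
have y01 : 0 <= y <= 1 by rewrite y0.
have := envelope_support Om_m y01; have := envelope_le y01; lra.
Qed.

(** An affine minorant with a positive gap to G on the compact interval from p
    to q can be rotated slightly about z: it rises where k (z - y) is positive,
    which only happens in that interval. Hence the envelope exceeds it there. *)
Lemma tilt_minorant a b p q k z x : minorant a b -> p <= q ->
  (forall y, p <= y <= q -> a + b * y < G y) ->
  (forall y, Om y -> ~~ (p <= y <= q) -> k * (z - y) <= 0) ->
  0 <= x <= 1 -> 0 < k * (z - x) -> a + b * x < Phi x.
Proof.
move=> ab pq gap out x01 kx.
(* D is the least gap and B a bound on the rotation, so a slope change of D / B
   is safe. *)
have [c cpq cmin] := gap_min a b pq.
have := gap _ cpq; rewrite -subr_gt0; set D := G c - _ => D0.
pose B := `|k| * (`|z| + 1) + 1.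
have B0 : 0 < B by rewrite ltr_wpDl// mulr_ge0// addr_ge0.
have e0 : 0 < D / B by rewrite divr_gt0.
have kB y : 0 <= y <= 1 -> k * (z - y) <= B.
  move=> /andP[y0 y1]; apply: le_trans (ler_norm _) _; rewrite normrM /B.
  rewrite ler_wpDr// ler_wpM2l// (le_trans (ler_normB _ _))// lerD2l.
  by rewrite ger0_norm.
have : minorant (a + D / B * k * z) (b - D / B * k).
  move=> y Oy; have E : a + D / B * k * z + (b - D / B * k) * y =
      a + b * y + D / B * (k * (z - y)) by ring.
  rewrite E; have y01 : 0 <= y <= 1 by move: Oy; rewrite OmegaE => /andP[/ltW-> /ltW->].
  have [ypq|ypq] := boolP (p <= y <= q).
    have h1 := cmin _ ypq.
    have h2 : D / B * (k * (z - y)) <= D / B * B by rewrite ler_pM2l// kB.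
    rewrite divfK ?gt_eqF// in h2; rewrite -/D in h1; lra.
  have h1 := ab _ Oy; have h2 := out _ Oy ypq.
  have : D / B * (k * (z - y)) <= 0 by rewrite pmulr_rle0.
  lra.
move/minorant_envelope => /(_ _ x01).
have : 0 < D / B * (k * (z - x)) by rewrite mulr_gt0.
lra.
Qed.

(** Otherwise there would be a positive gap on the whole interval from 0 to c,
    and the minorant could be rotated about c to rise above the envelope at
    x. *)
Lemma contact_left a b x c : minorant a b -> 0 <= x -> x < c -> c <= 1 ->
  Phi x = a + b * x -> exists2 al, 0 <= al <= c & G al = a + b * al.
Proof.
move=> ab x0 xc c1 Px; apply: contrapT => H.
have : a + b * x < Phi x.
  apply: (@tilt_minorant _ _ 0 c 1 c) => //.
  - lra.
  - move=> y y0c; rewrite lt_neqAle; apply/andP; split; last first.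
      by apply: minorant_closed => //; case/andP: y0c => -> /= /le_trans ->.
    by apply/eqP => E; apply: H; exists y.
  - by move=> y; rewrite OmegaE => /andP[y0 _]; rewrite negb_and -!ltNge => /orP[]; lra.
  - by apply/andP; split; lra.
  - lra.
by rewrite Px ltxx.
Qed.

Lemma contact_right a b x c : minorant a b -> 0 <= c -> c < x -> x <= 1 ->
  Phi x = a + b * x -> exists2 be, c <= be <= 1 & G be = a + b * be.
Proof.
move=> ab c0 cx x1 Px; apply: contrapT => H.
have : a + b * x < Phi x.
  apply: (@tilt_minorant _ _ c 1 (-1) c) => //.
  - lra.
  - move=> y yc1; rewrite lt_neqAle; apply/andP; split; last first.
      by apply: minorant_closed => //; case/andP: yc1 => /(le_trans c0) -> ->.
    by apply/eqP => E; apply: H; exists y.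
  - by move=> y; rewrite OmegaE => /andP[_ y1]; rewrite negb_and -!ltNge => /orP[]; lra.
  - by apply/andP; split; lra.
  - lra.
by rewrite Px ltxx.
Qed.

(** The chord inequality multiplied by [be - al], which leaves the degenerate
    case harmless. *)
Definition above_chord al be := forall x, al <= x <= be ->
  (be - x) * G al + (x - al) * G be <= (be - al) * G x.

Lemma contacts_above_chord a b al be : minorant a b ->
  0 <= al -> al <= be -> be <= 1 ->
  G al = a + b * al -> G be = a + b * be -> above_chord al be.
Proof.
move=> ab al0 albe be1 Ea Eb x /andP[h1 h2].
have : a + b * x <= G x by apply: minorant_closed => //; apply/andP; split; lra.
rewrite Ea Eb => h; have : (be - al) * (a + b * x) <= (be - al) * G x.
  by apply: ler_wpM2l => //; lra.
lra.
Qed.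

(** The line through the values of the envelope at al and be lies below G:
    between al and be because G lies above its own chord there, and outside by
    convexity of the envelope. So it is a minorant, the envelope coincides with
    it between al and be, and its slope is constant. *)
Lemma above_chord_flat al be m : 0 <= al -> be <= 1 -> al < m -> m < be ->
  above_chord al be -> Omega_flat X m.
Proof.
move=> al0 be1 alm mbe H; have albe : al < be by lra.
pose k := (Phi be - Phi al) / (be - al); pose K x := Phi al - k * al + k * x.
have D0 : 0 < be - al by lra.
have kE : k * (be - al) = Phi be - Phi al by rewrite /k divfK// gt_eqF.
have KE x : (be - al) * K x = (be - x) * Phi al + (x - al) * Phi be.
  rewrite /K; have -> : (be - al) * (Phi al - k * al + k * x) =
    (be - al) * Phi al + (x - al) * (k * (be - al)) by ring.
  by rewrite kE; ring.
have Pa : Phi al <= G al by apply: envelope_le; apply/andP; split; lra.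
have Pb : Phi be <= G be by apply: envelope_le; apply/andP; split; lra.
have mK : minorant (Phi al - k * al) k.
  move=> x Ox; have := Ox; rewrite OmegaE => /andP[x0 x1]; rewrite -/(K x).
  have PG : Phi x <= G x by apply: envelope_le; apply/andP; split; lra.
  rewrite -(ler_pM2l D0).
  have [xal|alx] := ltP x al.
    have := envelope_convex (ltW x0) be1 (ltW xal) (ltW albe).
    have : (be - al) * Phi x <= (be - al) * G x by rewrite ler_pM2l.
    by rewrite KE; lra.
  have [xbe|bex] := leP x be.
    have := H x; rewrite alx xbe => /(_ isT); rewrite KE; apply: le_trans.
    by apply: lerD; apply: ler_wpM2l => //; lra.
  have := envelope_convex al0 (ltW x1) (ltW albe) (ltW bex).
  have : (be - al) * Phi x <= (be - al) * G x by rewrite ler_pM2l.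
  by rewrite KE; lra.
have PK x : al <= x <= be -> Phi x = K x.
  move=> /andP[h1 h2]; apply/eqP; rewrite eq_le; apply/andP; split; last first.
    by apply: minorant_envelope => //; apply/andP; split; lra.
  by rewrite -(ler_pM2l D0) KE; exact: envelope_convex.
have Xk x : al < x < be -> X x = k.
  move=> /andP[h1 h2].
  have Ox : Om x by rewrite OmegaE; apply/andP; split; lra.
  have al01 : 0 <= al <= 1 by apply/andP; split; lra.
  have be01 : 0 <= be <= 1 by apply/andP; split; lra.
  have := envelope_support Ox al01; have := envelope_support Ox be01.
  rewrite !PK /K; try (apply/andP; split; lra).
  move=> g1 g2; apply/eqP; rewrite eq_le; apply/andP; split.
    have : X x * (be - x) <= k * (be - x) by lra.
    by rewrite ler_pM2r ?subr_gt0.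
  have : k * (x - al) <= X x * (x - al) by lra.
  by rewrite ler_pM2r ?subr_gt0.
split; first by rewrite OmegaE; apply/andP; split; lra.
near=> x; rewrite !Xk// ?alm ?mbe//.
by apply/andP; split; near: x; [exact: lt_nbhsr|exact: lt_nbhsl].
Unshelve. all: end_near. Qed.

(** The supporting line at m touches G on both sides of m, and G lies above the
    chord between two contact points. *)
Lemma off_contact_flat m : Om m -> Phi m < G m -> Omega_flat X m.
Proof.
move=> Om_m lt; have := Om_m; rewrite OmegaE => /andP[m0 m1].
have mi := support_minorant Om_m.
have PE : Phi m = Phi m - X m * m + X m * m by rewrite subrK.
have [d d0 Hd] : exists2 d : R, 0 < d & forall y, m - d < y < m + d ->
    Phi m - X m * m + X m * y < G y by apply: gap_pos_near; rewrite subrK.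
have [al] : exists2 al, 0 <= al <= Num.min 1 (m + d / 2) &
    G al = Phi m - X m * m + X m * al.
  apply: (contact_left mi (ltW m0)) => //.
  - by rewrite lt_min m1/=; lra.
  - by rewrite ge_min lexx.
have [be] : exists2 be, Num.max 0 (m - d / 2) <= be <= 1 &
    G be = Phi m - X m * m + X m * be.
  apply: (@contact_right _ _ m) => //.
  - by rewrite le_max lexx.
  - by rewrite gt_max m0/=; lra.
  - exact: ltW.
rewrite ge_max => /andP[/andP[be0 bed] be1] Eb.
rewrite le_min => /andP[al0 /andP[al1 ald]] Ea.
have alm : al < m.
  rewrite ltNge; apply/negP => h; have : m - d < al < m + d by apply/andP; split; lra.
  by move/Hd; rewrite Ea ltxx.
have mbe : m < be.
  rewrite ltNge; apply/negP => h; have : m - d < be < m + d by apply/andP; split; lra.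
  by move/Hd; rewrite Eb ltxx.
apply: (above_chord_flat al0 be1 alm mbe).
by apply: contacts_above_chord Ea Eb => //; lra.
Qed.

(** The supporting line at m coincides with the envelope around m, so the
    contact points can be found on both sides of m. *)
Lemma flat_above_chord m : Omega_flat X m ->
  exists al be, [/\ 0 <= al, al < m, m < be, be <= 1 & above_chord al be].
Proof.
move=> fl; have [Om_m _] := fl; move/Omega_flatP: fl => [d [d0 dm0 dm1 Xd]].
have := Om_m; rewrite OmegaE => /andP[m0 m1].
have mi := support_minorant Om_m.
have PE y : m - d < y < m + d -> Phi y = Phi m - X m * m + X m * y.
  move=> yd; have := Xd _ yd; move: yd => /andP[h1 h2] Xy.
  have Oy : Om y by rewrite OmegaE; apply/andP; split; lra.
  have m01 : 0 <= m <= 1 by apply/andP; split; lra.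
  have y01 : 0 <= y <= 1 by apply/andP; split; lra.
  have := envelope_support Oy m01; have := envelope_support Om_m y01.
  by rewrite Xy; lra.
have [||||al /andP[al0 al1] Ea] := @contact_left _ _ (m - d / 2) (m - d / 4) mi.
- lra.
- lra.
- lra.
- by apply: PE; apply/andP; split; lra.
have [||||be /andP[be0 be1] Eb] := @contact_right _ _ (m + d / 2) (m + d / 4) mi.
- lra.
- lra.
- lra.
- by apply: PE; apply/andP; split; lra.
exists al, be; split => //; try lra.
by apply: contacts_above_chord Ea Eb => //; lra.
Qed.

(** Near 0 the envelope is squeezed between G and the minorant issued from a
    value slightly below G 0 with a slope -b steep enough to pass below the
    minimum of G. *)
Lemma envelope_end0 e : 0 < e ->
  exists2 d : R, 0 < d & forall y, 0 <= y <= 1 -> y < d -> `|Phi y - G 0| <= e.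
Proof.
move=> e0.
have [d1 d10 H1] : exists2 d : R, 0 < d & forall y, 0 - d < y < 0 + d ->
    G 0 - e / 2 + 0 * y < G y by apply: gap_pos_near; lra.
have [d2 d20 H2] : exists2 d : R, 0 < d & forall y, 0 - d < y < 0 + d ->
    G y < G 0 + e + 0 * y by apply: gap_neg_near; lra.
have [c _ Hc] := gap_min 0 0 (@ler01 R).
pose b := `|G 0 - e / 2 - G c| / d1.
have b0 : 0 <= b by rewrite divr_ge0// ltW.
have mi : minorant (G 0 - e / 2) (- b).
  move=> y; rewrite OmegaE => /andP[y0 y1]; have [yd|yd] := ltP y d1.
    have := H1 y; have : 0 <= b * y by rewrite mulr_ge0// ltW.
    by move=> h /(_ _); rewrite mul0r addr0 => /(_ ltac:(apply/andP; split; lra)); lra.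
  have h1 : b * d1 <= b * y by rewrite ler_wpM2l.
  rewrite /b divfK ?gt_eqF// -/b in h1.
  have h2 := ler_norm (G 0 - e / 2 - G c).
  by have h3 := Hc y ltac:(apply/andP; split; lra); lra.
have [d3 d30 H3] : exists2 d : R, 0 < d & b * d <= e / 2.
  exists (e / 2 / (b + 1)); first by rewrite !divr_gt0// ltr_wpDl.
  by rewrite mulrCA ger_pMr ?divr_gt0// ler_pdivrMr ?ltr_wpDl// mul1r lerDl.
exists (Num.min d2 d3); first by rewrite lt_min d20.
move=> y /andP[y0 y1]; rewrite lt_min => /andP[yd2 yd3].
have y01 : 0 <= y <= 1 by rewrite y0.
have h1 := minorant_envelope mi y01; have h2 := envelope_le y01.
have := H2 y; rewrite mul0r addr0 => /(_ ltac:(apply/andP; split; lra)) h3.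
have h4 : b * y <= b * d3 by rewrite ler_wpM2l// ltW.
by rewrite ler_norml; apply/andP; split; lra.
Qed.

Lemma envelope_end1 e : 0 < e ->
  exists2 d : R, 0 < d & forall y, 0 <= y <= 1 -> 1 - d < y -> `|Phi y - G 1| <= e.
Proof.
move=> e0.
have [d1 d10 H1] : exists2 d : R, 0 < d & forall y, 1 - d < y < 1 + d ->
    G 1 - e / 2 + 0 * y < G y by apply: gap_pos_near; lra.
have [d2 d20 H2] : exists2 d : R, 0 < d & forall y, 1 - d < y < 1 + d ->
    G y < G 1 + e + 0 * y by apply: gap_neg_near; lra.
have [c _ Hc] := gap_min 0 0 (@ler01 R).
pose b := `|G 1 - e / 2 - G c| / d1.
have b0 : 0 <= b by rewrite divr_ge0// ltW.
have mi : minorant (G 1 - e / 2 - b) b.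
  move=> y; rewrite OmegaE => /andP[y0 y1]; have [yd|yd] := ltP (1 - d1) y.
    have := H1 y; have : 0 <= b * (1 - y) by rewrite mulr_ge0// subr_ge0 ltW.
    by move=> h /(_ _); rewrite mul0r addr0 => /(_ ltac:(apply/andP; split; lra)); lra.
  have h1 : b * d1 <= b * (1 - y) by rewrite ler_wpM2l//; lra.
  rewrite /b divfK ?gt_eqF// -/b in h1.
  have h2 := ler_norm (G 1 - e / 2 - G c).
  by have h3 := Hc y ltac:(apply/andP; split; lra); lra.
have [d3 d30 H3] : exists2 d : R, 0 < d & b * d <= e / 2.
  exists (e / 2 / (b + 1)); first by rewrite !divr_gt0// ltr_wpDl.
  by rewrite mulrCA ger_pMr ?divr_gt0// ler_pdivrMr ?ltr_wpDl// mul1r lerDl.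
exists (Num.min d2 d3); first by rewrite lt_min d20.
move=> y /andP[y0 y1] h0.
have yd2 : 1 - y < d2 by have : Num.min d2 d3 <= d2 by [rewrite ge_min lexx]; lra.
have yd3 : 1 - y < d3 by have : Num.min d2 d3 <= d3 by [rewrite ge_min lexx orbT]; lra.
have y01 : 0 <= y <= 1 by rewrite y0.
have h1 := minorant_envelope mi y01; have h2 := envelope_le y01.
have := H2 y; rewrite mul0r addr0 => /(_ ltac:(apply/andP; split; lra)) h3.
have h4 : b * (1 - y) <= b * d3 by rewrite ler_wpM2l// ltW.
by rewrite ler_norml; apply/andP; split; lra.
Qed.

End envelope.

(** ** Subtracting a convex function *)

Section rescaled_envelopes.
Context {R : realType}.
Implicit Types (G K : R -> R) (theta x y : R).
Local Notation Om := (@Omega R).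

(** Being above a chord is preserved by scaling and by subtracting a convex
    function K. *)
Lemma rescaled_envelope_flat G1 G2 K theta : continuous G1 -> continuous G2 ->
  0 <= theta -> (forall x, 0 <= x <= 1 -> G2 x = theta * G1 x - K x) ->
  (forall al be x, 0 <= al -> be <= 1 -> al <= x -> x <= be ->
    (be - al) * K x <= (be - x) * K al + (x - al) * K be) ->
  Omega_flat (right_derivative (convex_envelope G1)) `<=`
  Omega_flat (right_derivative (convex_envelope G2)).
Proof.
move=> c1 c2 t0 E Kc m /(flat_above_chord c1)[al [be [al0 alm mbe be1 H]]].
apply: (above_chord_flat c2 al0 be1 alm mbe) => x /andP[h1 h2].
have := H x; rewrite h1 h2 => /(_ isT) {}H.
have {}Kc := Kc _ _ _ al0 be1 h1 h2.
have : theta * ((be - x) * G1 al + (x - al) * G1 be) <= theta * ((be - al) * G1 x).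
  by rewrite ler_wpM2l.
rewrite !E; try (apply/andP; split; lra).
lra.
Qed.

(** The supporting line of the envelope of G2 at m plus that of K is, after
    division by theta, a minorant of G1. *)
Lemma rescaled_envelope_gap G1 G2 K theta m : continuous G1 -> continuous G2 ->
  0 < theta -> (forall x, 0 <= x <= 1 -> G2 x = theta * G1 x - K x) ->
  (forall x, Om x -> exists k, forall y, Om y -> K x + k * (y - x) <= K y) ->
  Om m ->
  theta * (G1 m - convex_envelope G1 m) <= G2 m - convex_envelope G2 m.
Proof.
move=> c1 c2 t0 E Ks Om_m; have [k Hk] := Ks _ Om_m.
have O01 y : Om y -> 0 <= y <= 1 by rewrite OmegaE => /andP[/ltW-> /ltW->].
set X2 := right_derivative (convex_envelope G2) m.
have mi : minorant G1 (theta^-1 * (convex_envelope G2 m + K m - (X2 + k) * m))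
    (theta^-1 * (X2 + k)).
  move=> y Oy; rewrite -(ler_pM2l t0).
  have -> : theta * (theta^-1 * (convex_envelope G2 m + K m - (X2 + k) * m) +
      theta^-1 * (X2 + k) * y) =
      (convex_envelope G2 m + X2 * (y - m)) + (K m + k * (y - m)).
    by field; rewrite gt_eqF.
  have := envelope_support c2 Om_m (O01 _ Oy); have := Hk _ Oy.
  have := envelope_le c2 (O01 _ Oy); rewrite E ?O01// -/X2; lra.
have := minorant_envelope c1 mi (O01 _ Om_m).
rewrite -(ler_pM2l t0).
have -> : theta * (theta^-1 * (convex_envelope G2 m + K m - (X2 + k) * m) +
      theta^-1 * (X2 + k) * m) = convex_envelope G2 m + K m.
  by field; rewrite gt_eqF.
by rewrite E ?O01//; lra.
Qed.

End rescaled_envelopes.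

(** * The slope of the envelope as a metric projection *)

Section fatou_mean.
Context {R : realType}.
Local Notation mu := (@lebesgue_measure R).
Local Notation Om := (@Omega R).

Lemma fatou_meanO (f : R -> R) (u : nat -> R -> R) C :
  measurable_fun Om f -> (forall n, integrableO (u n)) ->
  (forall n x, Om x -> 0 <= u n x) ->
  {ae mu, forall x, Om x -> u n x @[n --> \oo] --> f x} ->
  (forall n, meanO (u n) <= C) ->
  integrableO f /\ meanO f <= C.
Proof.
move=> mf ui u0 uf uC.
have mO := @measurable_Omega R.
have mu_ n : measurable_fun Om (fun x => (u n x)%:E) by exact: measurable_int (ui n).
have u0' n x : Om x -> (0 <= (u n x)%:E)%E by move=> Ox; rewrite lee_fin; exact: u0.
have h := @fatou _ _ R mu Om mO (fun n x => (u n x)%:E) mu_ u0'.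
have {}h : (\int[mu]_(x in Om) limn_einf (fun n => (u n x)%:E) <= C%:E)%E.
  apply: le_trans h _; rewrite limn_einf_lim; apply: lime_le.
    by apply: is_cvg_einfs.
  apply: nearW => n; apply: le_trans (ereal_inf_lbound _) _.
    by exists n => //=; exact: leqnn.
  by rewrite meanOE// lee_fin.
have E : (\int[mu]_(x in Om) limn_einf (fun n => (u n x)%:E) =
    \int[mu]_(x in Om) `|(f x)%:E|)%E.
  apply: ae_eq_integral => //.
  - rewrite (_ : (fun x => _) = (fun x => - limn_esup (fun n => - (u n x)%:E))%E).
      apply: measurableT_comp => //; apply: measurable_fun_limn_esup => n.
      apply: (eq_measurable_fun (fun x => (-1 * u n x)%:E)).
        by move=> x _; rewrite mulN1r EFinN.
      exact: measurable_int (integrableOZ (-1) (ui n)).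
    apply/funext => x; rewrite -limn_einfN; congr limn_einf.
    by apply/funext => n /=; rewrite opprK.
  - by apply: measurableT_comp => //; exact/measurable_EFinP.
  - move: uf; apply: ae_imp => x H Ox; have {}H := H Ox.
    have HE : (u n x)%:E @[n --> \oo] --> (f x)%:E by apply: cvg_EFin => //; exact: nearW.
    have [-> _] := cvg_limn_einf_sup HE.
    congr EFin; rewrite ger0_norm//.
    rewrite -(cvg_lim (@Rhausdorff R) H); apply: limr_ge.
      by apply/cvg_ex; exists (f x).
    by apply: nearW => n; exact: u0.
have fi : integrableO f.
  apply/integrableP; split; first exact/measurable_EFinP.
  by rewrite -E (le_lt_trans h)// ltry.
split => //; rewrite -lee_fin -meanOE//; apply: le_trans h; rewrite E.
apply: le_integral => //.
- by apply: integrable_abse.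
- by move=> x _; rewrite lee_fin ler_norm.
Qed.

End fatou_mean.

Section envelope_projection.
Context {R : realType}.
Variable g : R -> R.
Hypothesis gL : in_L2 g.
Implicit Types (a b c d e h m x y z : R).
Local Notation mu := (@lebesgue_measure R).
Local Notation Om := (@Omega R).
Local Notation G := (prim g).
Local Notation Phi := (convex_envelope G).
Local Notation X := (right_derivative Phi).

Let gi : integrableO g. Proof. exact: in_L2_integrable. Qed.
Let cG : continuous G. Proof. exact: prim_continuous. Qed.
Let mX x y : Om x -> Om y -> x <= y -> X x <= X y.
Proof. exact: right_derivative_mono. Qed.
Let X_measurable : measurable_fun Om X.
Proof. exact: nondecreasing_Omega_measurable. Qed.

Let itv_mean a b := meanO (fun x => (a <= x < b)%R%:R * X x).

Let itv_integrable a b : Om a -> Om b -> integrableO (fun x => (a <= x < b)%R%:R * X x).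
Proof.
move=> Oa Ob; apply: (@integrableO_le _ _ (fun=> `|X a| + `|X b|)).
- apply: measurable_funM => //.
  apply: (@measurableT_comp _ _ _ _ _ _ (fun b : bool => b%:R : R)) => //.
  exact: measurable_lec_ltc.
- exact: integrableO_cst.
- move=> x Ox; case: (boolP (a <= x < b)%R) => [/andP[ax xb]|_]; last first.
    by rewrite mul0r normr0.
  rewrite mul1r [leRHS]ger0_norm ?addr_ge0//.
  have h1 := mX Oa Ox ax; have h2 := mX Ox Ob (ltW xb).
  have h3 := ler_norm (X b); have h4 := ler_norm (- X a); rewrite normrN in h4.
  have h5 := normr_ge0 (X a); have h6 := normr_ge0 (X b).
  by rewrite ler_norml; apply/andP; split; lra.
Qed.

Let itv_mean_bounds a b : Om a -> Om b -> a <= b ->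
  X a * (b - a) <= itv_mean a b <= X b * (b - a).
Proof.
move=> Oa Ob ab; have := Oa; have := Ob; rewrite !OmegaE => /andP[b0 b1] /andP[a0 a1].
have ii := in_L2_integrable (indicator_itv_L2 a b).
rewrite -(mean_itv (ltW a0) ab (ltW b1)) -!meanOZ//.
apply/andP; split; apply: le_meanO => //; try exact: itv_integrable; try exact: integrableOZ.
  move=> x Ox; case: (boolP (a <= x < b)%R) => [/andP[ax xb]|_].
    by rewrite mulr1 mul1r mX.
  by rewrite mulr0 mul0r.
move=> x Ox; case: (boolP (a <= x < b)%R) => [/andP[ax xb]|_].
  by rewrite mulr1 mul1r mX// ltW.
by rewrite mulr0 mul0r.
Qed.

Let itv_meanD a b c : Om a -> Om b -> Om c -> a <= b -> b <= c ->
  itv_mean a c = itv_mean a b + itv_mean b c.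
Proof.
move=> Oa Ob Oc ab bc; rewrite /itv_mean -meanOD; try exact: itv_integrable.
apply: meanO_eq => x Ox; rewrite -mulrDl; congr (_ * _).
have [xb|bx] := ltP x b.
  by rewrite (lt_le_trans xb bc) !andbT addr0.
by rewrite (le_trans ab bx)/= add0r.
Qed.

(** The slope X is monotone, so on an interval both the increment of the
    envelope and the integral of X lie between the extreme values of X times the
    length; halving the interval n times divides the error by [2 ^+ n]. *)
Let ftc_error n a b : Om a -> Om b -> a <= b ->
  `|Phi b - Phi a - itv_mean a b| <= (b - a) / 2 ^+ n * (X b - X a).
Proof.
elim: n a b => [|n IH] a b Oa Ob ab.
  rewrite expr0 divr1; have /andP[h1 h2] := itv_mean_bounds Oa Ob ab.
  move: ab; rewrite le_eqVlt => /predU1P[E|ab].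
    by move: h1 h2; rewrite E !subrr => h1 h2; rewrite ler_norml; apply/andP; split; lra.
  have [h3 h4] := right_derivative_slope cG Oa Ob ab.
  by rewrite ler_norml; apply/andP; split; lra.
pose c := (a + b) / 2.
have Oc : Om c.
  move: Oa Ob; rewrite !OmegaE /c => /andP[? ?] /andP[? ?]; apply/andP; split; lra.
have ac : a <= c by rewrite /c; lra.
have cb : c <= b by rewrite /c; lra.
rewrite (itv_meanD Oa Oc Ob ac cb).
have -> : Phi b - Phi a - (itv_mean a c + itv_mean c b) =
  (Phi c - Phi a - itv_mean a c) + (Phi b - Phi c - itv_mean c b) by ring.
apply: le_trans (ler_normD _ _) _.
apply: le_trans (lerD (IH _ _ Oa Oc ac) (IH _ _ Oc Ob cb)) _.
have -> : c - a = (b - a) / 2 by rewrite /c; field.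
have -> : b - c = (b - a) / 2 by rewrite /c; field.
rewrite exprS le_eqVlt; apply/orP; left; apply/eqP; field.
by rewrite expf_neq0.
Qed.

Let ftc a b : Om a -> Om b -> a <= b -> itv_mean a b = Phi b - Phi a.
Proof.
move=> Oa Ob ab; apply/eqP; rewrite eq_sym -subr_eq0 -normr_le0.
apply/ler_addgt0Pr => e e0; rewrite add0r.
have C0 : 0 <= (b - a) * (X b - X a) by rewrite mulr_ge0 ?subr_ge0// mX.
pose C := (b - a) * (X b - X a); pose n := (Num.truncn (C / e)).+1.
apply: le_trans (ftc_error n Oa Ob ab) _.
rewrite mulrAC ler_pdivrMr ?exprn_gt0// -ler_pdivrMl// mulrC.
apply: (@le_trans _ _ n%:R); first exact/ltW/truncnS_gt.
by rewrite -natrX ler_nat ltnW// ltn_expl.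
Qed.

Let O01 x : Om x -> 0 <= x <= 1.
Proof. by rewrite OmegaE => /andP[/ltW-> /ltW->]. Qed.

Let Phi_bounded : exists B, forall x, Om x -> `|Phi x| <= B.
Proof.
have [a ha] := exists_minorant cG.
have [c _ Hc] := @EVT_max _ G 0 1 ler01 (continuous_subspaceT cG).
exists (`|a| + `|G c|) => x Ox.
have h1 := minorant_envelope cG ha (O01 Ox); rewrite mul0r addr0 in h1.
have h2 := envelope_le cG (O01 Ox).
have h3 : G x <= G c by apply: Hc; rewrite in_itv/= O01.
have h4 := ler_norm (G c); have h5 := ler_norm (- a); rewrite normrN in h5.
have h6 := normr_ge0 a; have h7 := normr_ge0 (G c).
by rewrite ler_norml; apply/andP; split; lra.
Qed.

Let half : Om (1 / 2). Proof. by rewrite OmegaE; apply/andP; split; lra. Qed.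

Let cut n : R := n.+3%:R^-1.

Let cut_Omega n : [/\ Om (cut n), Om (1 - cut n), cut n <= 1 / 2 & 1 / 2 <= 1 - cut n].
Proof.
have h0 : 0 < cut n by rewrite invr_gt0.
have h1 : cut n <= 1 / 3.
  by rewrite /cut div1r lef_pV2 ?posrE// ler_nat.
rewrite !OmegaE; split; try (apply/andP; split); lra.
Qed.

Let cut_cvg x : Om x -> \forall n \near \oo, cut n <= x < 1 - cut n.
Proof.
rewrite OmegaE => /andP[x0 x1].
have e0 : 0 < Num.min x (1 - x) by rewrite lt_min x0 subr_gt0.
near=> n.
have h : cut n < Num.min x (1 - x).
  apply: (@le_lt_trans _ _ n.+1%:R^-1).
    by rewrite lef_pV2 ?posrE// ler_nat (leqW (leqnSn _)).
  by near: n; exact: (near_infty_natSinv_lt (PosNum e0)).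
move: h; rewrite lt_min => /andP[h1 h2]; apply/andP; split; lra.
Unshelve. all: end_near. Qed.

(** The slope may be unbounded at the ends of the interval. On the intervals
    from [cut n] to [1 - cut n] the integral of [`|X - X (1 / 2)|] is, by
    monotonicity, a combination of values of the bounded envelope, and the Fatou
    lemma applies. *)
Let X_integrable : integrableO X.
Proof.
have [B HB] := Phi_bounded.
pose f x := `|X x - X (1 / 2)|.
have mf : measurable_fun Om f.
  by apply: measurableT_comp => //; exact: measurable_funB.
pose u n x := (cut n <= x < 1 - cut n)%R%:R * f x.
pose s n x := (1 / 2 <= x < 1 - cut n)%R%:R * X x - X (1 / 2) * (1 / 2 <= x < 1 - cut n)%R%:R
   - ((cut n <= x < 1 / 2)%R%:R * X x - X (1 / 2) * (cut n <= x < 1 / 2)%R%:R).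
have us n x : Om x -> s n x = u n x.
  move=> Ox; have [_ _ h1 h2] := cut_Omega n; rewrite /u /s /f.
  have [xh|hx] := ltP x (1 / 2).
    rewrite (lt_le_trans xh h2) !andbT/= mul0r mulr0 subr0 sub0r.
    have := mX Ox half (ltW xh); rewrite -subr_le0 => /ler0_norm ->.
    by case: (cut n <= x)%R; rewrite /=; ring.
  rewrite (le_trans h1 hx) andbF/= mul0r mulr0 !subr0.
  have := mX half Ox hx; rewrite -subr_ge0 => /ger0_norm ->.
  by case: (x < 1 - cut n)%R; rewrite /=; ring.
have i1 a b : integrableO (fun x : R => X (1 / 2) * (a <= x < b)%R%:R).
  exact/integrableOZ/in_L2_integrable/indicator_itv_L2.
have si n : integrableO (s n).
  have [h1 h2 h3 h4] := cut_Omega n.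
  by apply: integrableOB; apply: integrableOB => //; exact: itv_integrable.
have ui n : integrableO (u n) by apply: integrableO_eq (si n); exact: us.
have [|||fi _] := @fatou_meanO _ f u (4 * B + `|X (1 / 2)|) mf ui.
- by move=> n x _; apply: mulr_ge0; [exact: ler0n|exact: normr_ge0].
- apply: aeW => x Ox; apply: cvg_near_cst; near=> n.
  by rewrite /u (_ : (cut n <= x < 1 - cut n)%R) ?mul1r//; near: n; exact: cut_cvg.
- move=> n; rewrite -(meanO_eq (us n)).
  have [h1 h2 h3 h4] := cut_Omega n.
  rewrite /s meanOB; try (apply: integrableOB => //; exact: itv_integrable).
  rewrite !meanOB//; try exact: itv_integrable.
  rewrite !meanOZ; try exact/in_L2_integrable/indicator_itv_L2.
  have := h1; have := h2; rewrite !OmegaE => /andP[? ?] /andP[? ?].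
  rewrite !mean_itv//; try exact: ltW; try lra.
  rewrite -/(itv_mean (cut n) (1 / 2)) -/(itv_mean (1 / 2) (1 - cut n)) !ftc//.
  have := HB _ h1; have := HB _ h2; have := HB _ half.
  rewrite !ler_norml => /andP[? ?] /andP[? ?] /andP[? ?].
  rewrite (_ : 1 - cut n - 1 / 2 = 1 / 2 - cut n); last by lra.
  by have := normr_ge0 (X (1 / 2)); lra.
apply: (@integrableO_le _ _ (fun x => f x + `|X (1 / 2)|)) => //.
  by apply: integrableOD => //; exact: integrableO_cst.
move=> x _; rewrite [leRHS]ger0_norm ?addr_ge0 ?normr_ge0//.
by rewrite -[X in `|X| <= _](subrK (X (1 / 2))) ler_normD.
Unshelve. all: end_near. Qed.

Let G0 : G 0 = 0. Proof. exact: prim0. Qed.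

(** The fundamental theorem of calculus holds from any interior point;
    continuity of the envelope at 0 fixes the constant. *)
Lemma prim_right_derivative m : Om m -> prim X m = Phi m.
Proof.
move=> Omm; apply/eqP; rewrite -subr_eq0 -normr_le0.
apply/ler_addgt0Pr => e e0; rewrite add0r.
have := Omm; rewrite OmegaE => /andP[m0 m1].
have e20 : 0 < e / 2 by rewrite divr_gt0.
have [d d0 Hd] := envelope_end0 cG e20.
have /cvgrPdist_le /(_ _ e20)[d' /= d'0 Hd'] := @prim_continuous _ _ X_integrable 0.
pose a := Num.min m (Num.min (d / 2) (d' / 2)).
have a0 : 0 < a by rewrite !lt_min m0 !divr_gt0.
have am : a <= m by rewrite ge_min lexx.
have ad : a <= d / 2 by rewrite !ge_min lexx orbT.
have ad' : a <= d' / 2 by rewrite !ge_min lexx !orbT.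
have Oa : Om a by rewrite OmegaE; apply/andP; split; lra.
have := prim_sub X_integrable am; rewrite -/(itv_mean a m) ftc// => E.
have h1 : `|Phi a - G 0| <= e / 2 by apply: Hd; [exact: O01|lra].
have h2 : `|prim X 0 - prim X a| <= e / 2.
  by apply: Hd'; rewrite /ball_/= sub0r normrN gtr0_norm//; lra.
rewrite G0 subr0 in h1; rewrite prim0 sub0r normrN in h2.
have -> : prim X m - Phi m = prim X a - Phi a by lra.
by apply: le_trans (ler_normB _ _) _; lra.
Qed.

Let meanX : meanO X = meanO g.
Proof.
rewrite -!prim1; apply/eqP; rewrite -subr_eq0 -normr_le0.
apply/ler_addgt0Pr => e e0; rewrite add0r.
have e20 : 0 < e / 2 by rewrite divr_gt0.
have [d d0 Hd] := envelope_end1 cG e20.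
have /cvgrPdist_le /(_ _ e20)[d' /= d'0 Hd'] := @prim_continuous _ _ X_integrable 1.
pose k := Num.min (1 / 2) (Num.min (d / 2) (d' / 2)).
have k0 : 0 < k by rewrite !lt_min !divr_gt0.
have k1 : k <= 1 / 2 by rewrite ge_min lexx.
have kd : k <= d / 2 by rewrite !ge_min lexx orbT.
have kd' : k <= d' / 2 by rewrite !ge_min lexx !orbT.
have Oa : Om (1 - k) by rewrite OmegaE; apply/andP; split; lra.
have h1 : `|Phi (1 - k) - G 1| <= e / 2 by apply: Hd; [exact: O01|lra].
have h2 : `|prim X 1 - prim X (1 - k)| <= e / 2.
  by apply: Hd'; rewrite /ball_/= opprB addrC subrK gtr0_norm//; lra.
rewrite (prim_right_derivative Oa) in h2.
have -> : prim X 1 - G 1 = (prim X 1 - Phi (1 - k)) + (Phi (1 - k) - G 1) by ring.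
by apply: le_trans (ler_normD _ _) _; lra.
Qed.

Let xi x := g x - X x.

Let xi_integrable : integrableO xi. Proof. exact: integrableOB. Qed.

Let xi_mean : meanO xi = 0.
Proof. by rewrite /xi meanOB// meanX subrr. Qed.

Lemma prim_residual c : Om c -> prim (fun x => g x - X x) c = G c - Phi c.
Proof. by move=> Oc; rewrite primB// prim_right_derivative. Qed.

(** The envelope is locally affine where it differs from G. *)
Let xi_contact c : 0 < c < 1 -> ~ Omega_flat X c -> prim xi c = 0.
Proof.
move=> c01 nf; have Oc : Om c by rewrite OmegaE.
rewrite prim_residual//; apply/eqP; rewrite subr_eq0 eq_le envelope_le ?O01// andbT.
by rewrite leNgt; apply/negP => h; apply: nf; exact: off_contact_flat.
Qed.

(** Let Z be X truncated at level n. As Z is flat where X is, it is orthogonal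
    to g - X, so Z^2 <= X Z and X Z has the same integral as g Z; thus the norm
    of Z is at most that of g. *)
Let X_L2 : in_L2 X.
Proof.
pose Z (n : nat) x := clamp (- n%:R) n%:R (X x).
have n0 (n : nat) : - n%:R <= n%:R :> R by have := ler0n R n; lra.
have ZX n x : Z n x ^+ 2 <= X x * Z n x /\ `|Z n x| <= n%:R.
  have := ler0n R n; rewrite /Z /clamp /Num.min /Num.max => h0.
  case: (ltP (X x) (- n%:R)) => h1; case: ltP => h2; split;
    rewrite ?ler_norml; try (apply/andP; split); try lra; nra.
have mZ n : measurable_fun Om (Z n).
  apply: nondecreasing_Omega_measurable => x y Ox Oy xy.
  by have [+ _ _ _] := clamp_props (n0 n); apply; exact: mX.
have bi f n : integrableO f -> integrableO (fun x => f x * Z n x).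
  move=> fi; apply: (@integrableO_le _ _ (fun x => n%:R * f x)).
  - by apply: measurable_funM => //; exact: integrableO_measurable.
  - exact: integrableOZ.
  - move=> x _; rewrite !normrM mulrC ler_wpM2r// (le_trans (ZX n x).2)//.
    by rewrite ger0_norm.
have ZL n : in_L2 (Z n).
  apply: (@in_L2_le _ _ (fun=> n%:R ^+ 2)) => //; first exact: integrableO_cst.
  move=> x _; rewrite -real_normK ?num_real// lerXn2r ?nnegrE//.
  exact: (ZX n x).2.
have Zx n : meanO (fun x => xi x * Z n x) = 0.
  apply: polar_eq => //.
  - move=> x y Ox Oy xy; have [+ _ _ _] := clamp_props (n0 n); apply; exact: mX.
  - exact: bi.
  - move=> c c01 nf; apply: xi_contact => //; apply: contra_not nf => -[Oc fl].
    by split=> //; move: fl; apply: filterS => x; rewrite /Z => ->.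
have key n : meanO (fun x => Z n x ^+ 2) <= meanO (fun x => g x ^+ 2).
  have E : meanO (fun x => X x * Z n x) = meanO (fun x => g x * Z n x).
    apply/eqP; rewrite eq_sym -subr_eq0 -(Zx n) -meanOB; try exact: bi.
    by apply/eqP/meanO_eq => x _; rewrite /xi mulrBl.
  have h1 : meanO (fun x => Z n x ^+ 2) <= meanO (fun x => X x * Z n x).
    apply: le_meanO; [exact: in_L2_sqr|exact: bi|].
    by move=> x _; exact: (ZX n x).1.
  have h2 : meanO (fun x => g x * Z n x) <=
      meanO (fun x => 2^-1 * (g x ^+ 2 + Z n x ^+ 2)).
    apply: le_meanO; first exact: bi.
      by apply/integrableOZ/integrableOD; exact: in_L2_sqr.
    by move=> x _; have := sqr_ge0 (g x - Z n x); nra.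
  rewrite E in h1; move: h2; rewrite meanOZ ?meanOD; try exact: in_L2_sqr;
    last by apply: integrableOD; exact: in_L2_sqr.
  lra.
apply/in_L2P; split=> //.
have [|||||? _] := @fatou_meanO _ (fun x => X x ^+ 2) (fun n x => Z n x ^+ 2)
  (meanO (fun x => g x ^+ 2)) => //.
- exact: measurable_funX.
- by move=> n; exact: in_L2_sqr.
- by move=> n x _; exact: sqr_ge0.
- apply: aeW => x _; apply: cvg_near_cst; near=> n.
  have : `|X x| <= n%:R by near: n; exact: nbhs_infty_ger.
  rewrite ler_norml => /andP[h1 h2]; congr (_ ^+ 2).
  by rewrite /Z /clamp max_l// min_l.
Unshelve. all: end_near. Qed.

(** The primitive of g - X is the distance from G to its envelope: it is
    nonnegative, and zero where X is not flat. *)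
Lemma envelope_projection : [/\ cone X, polar_cone (fun x => g x - X x) &
  dotO (fun x => g x - X x) X = 0].
Proof.
have CX : cone X.
  by split => // x Ox; exact: right_derivative_right_continuous.
have xiL : in_L2 xi by exact: in_L2B.
split=> //.
  split=> // Y CY; apply: polar_le => //.
  - by move=> x y; exact: cone_mono.
  - by apply: integrableO_mul => //; exact: cone_L2.
  - move=> c c01 _; have Oc : Om c by rewrite OmegaE.
    by rewrite prim_residual// subr_ge0 envelope_le// O01.
by apply: polar_eq => //; exact: integrableO_mul.
Qed.

End envelope_projection.

(** * Sticky curves in a Hilbert space *)

Section sticky_curve.
Context {R : realType} {H : lmodType R}.
Variable ip : H -> H -> R.
Hypothesis ipC : forall x y, ip x y = ip y x.
Hypothesis ipDl : forall x y z, ip (x + y) z = ip x z + ip y z.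
Hypothesis ipZl : forall (a : R) x z, ip (a *: x) z = a * ip x z.
Hypothesis ip_ge0 : forall x, 0 <= ip x x.
Hypothesis ip_complete : forall w : nat -> H,
  (forall k, ip (w k.+1 - w k) (w k.+1 - w k) <= 4^-1 ^+ k) ->
  exists D, forall e : R, 0 < e ->
    exists N, forall k, (N <= k)%N -> ip (w k - D) (w k - D) <= e.
Variables (X0 V M : H) (lam : R) (X : R -> H).
Hypothesis lam0 : 0 <= lam.
Implicit Types (r s t tau T e : R).

Let ipDr x y z : ip z (x + y) = ip z x + ip z y.
Proof. by rewrite ipC ipDl ipC [ip y z]ipC. Qed.
Let ipZr (a : R) x z : ip z (a *: x) = a * ip z x.
Proof. by rewrite ipC ipZl ipC. Qed.
Let ipNl x z : ip (- x) z = - ip x z.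
Proof. by rewrite -scaleN1r ipZl mulN1r. Qed.
Let ipNr x z : ip z (- x) = - ip z x.
Proof. by rewrite ipC ipNl ipC. Qed.
Let ipE := (ipDl, ipDr, ipZl, ipZr, ipNl, ipNr).

Let sq x := ip x x.

Let sq_triangle x y z : sq (x - z) <= 2 * sq (x - y) + 2 * sq (y - z).
Proof.
have := ip_ge0 (x - y - (y - z)); rewrite /sq !ipE.
by rewrite [ip y x]ipC [ip z x]ipC [ip z y]ipC; lra.
Qed.

Let ip_young x y : `|ip x y| <= (sq x + sq y) / 2.
Proof.
have := ip_ge0 (x - y); have := ip_ge0 (x + y); rewrite /sq !ipE [ip y x]ipC => h1 h2.
by rewrite ler_norml; apply/andP; split; lra.
Qed.

Definition free_path t := X0 + t *: V - (lam * (t ^+ 2 / 2)) *: M.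
Local Notation g := free_path.
Let xi t := g t - X t.
(** Stickiness enters through [orth]: the residual at a given time is orthogonal
    to all later positions, not only to the current one. *)
Hypothesis orth : forall s t, 0 <= s -> s <= t -> ip (g s - X s) (X t) = 0.
Hypothesis polar : forall s t, 0 <= s -> 0 <= t -> ip (g t - X t) (X s) <= 0.

(** [v s t] is the mean over the times between s and t of the free velocity [u],
    so the free displacement is [(t - s) *: v s t]. *)
Let q s t := (t - s)^-1 *: (X t - X s).
Let u tau := V - (lam * tau) *: M.
Let v s t := V - (lam * ((s + t) / 2)) *: M.

Let free_pathB s t z : ip (g t) z - ip (g s) z = (t - s) * ip (v s t) z.
Proof. by rewrite /g /v !ipE; field. Qed.

(** The increment of the residual pairs nonnegatively with the displacement
    [X t - X s]. *)
Let step s t : 0 <= s -> s <= t ->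
  sq (X t - X s) <= (t - s) * ip (v s t) (X t - X s).
Proof.
move=> s0 st; have t0 := le_trans s0 st.
have := free_pathB s t (X t); have := free_pathB s t (X s); move: (v s t) => w.
have := orth s0 st; have := orth s0 (lexx s); have := orth t0 (lexx t).
have := polar s0 t0; rewrite /sq !ipE => h1 h2 h3 h4.
rewrite [ip (X t) (X s)]ipC in h1 *; lra.
Qed.

(** By [step] and the Cauchy-Schwarz inequality, the mean velocity is no larger
    than the mean free one. *)
Lemma sticky_curve_lipschitz s t : 0 <= s -> s <= t ->
  ip (X t - X s) (X t - X s) <= (t - s) ^+ 2 * ip (v s t) (v s t).
Proof.
move=> s0 st; have := step s0 st; rewrite /sq.
move: (X t - X s) (v s t) => d w h.
have := ip_ge0 (d - (t - s) *: w); rewrite !ipE [ip d w]ipC; lra.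
Qed.

Let q_sq s t : 0 <= s -> s < t -> sq (q s t) <= ip (v s t) (q s t).
Proof.
move=> s0 st; have := step s0 (ltW st).
rewrite /q /sq; move: (X t - X s) (v s t) => d w h.
have ts : 0 < t - s by lra.
by rewrite !ipZl !ipZr ler_pM2l ?invr_gt0// ler_pdivrMl.
Qed.

Let q_sq_v s t : 0 <= s -> s < t -> sq (q s t) <= sq (v s t).
Proof.
move=> s0 st; have := q_sq s0 st; have := ip_young (v s t) (q s t).
by rewrite ler_norml => /andP[_]; lra.
Qed.

(** Paired with a later displacement, the mean velocity cannot be told from the
    mean free velocity, since residuals are orthogonal to later positions. *)
Let cross r s t : 0 <= r -> r < s -> s < t ->
  ip (q r s) (q s t) = ip (v r s) (q s t).
Proof.
move=> r0 rs st; have s0 : 0 <= s by lra.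
have rt : r <= t by lra.
have E : ip (X s - X r) (X t - X s) = (s - r) * ip (v r s) (X t - X s).
  have := free_pathB r s (X t); have := free_pathB r s (X s).
  have := orth r0 (ltW rs); have := orth r0 rt.
  have := orth s0 (ltW st); have := orth s0 (lexx s).
  by move: (v r s) => w; rewrite !ipE; lra.
rewrite /q ipZl 2!ipZr E; field.
by rewrite !subr_eq0 !gt_eqF.
Qed.

Section bounded_times.
Variable T : R.
Hypothesis T0 : 0 < T.

Let B := sq M + sq V + (lam * T) ^+ 2 * sq M.
Let K := 4 * lam * B.

Let B0 : 0 <= B.
Proof.
have := ip_ge0 M; have := ip_ge0 V; rewrite /B -/(sq M) -/(sq V) => V0 M0.
by rewrite !addr_ge0// mulr_ge0// sqr_ge0.
Qed.
Let K0 : 0 <= K. Proof. by rewrite /K; apply: mulr_ge0 => //; exact: mulr_ge0. Qed.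

Let sq_u tau : 0 <= tau <= T ->
  sq (V - (lam * tau) *: M) <= 2 * (sq V + (lam * T) ^+ 2 * sq M).
Proof.
move=> /andP[h1 h2].
have := ip_ge0 (V + (lam * tau) *: M).
have : (lam * tau) ^+ 2 * sq M <= (lam * T) ^+ 2 * sq M.
  by rewrite ler_wpM2r// ?ip_ge0// lerXn2r ?nnegrE ?mulr_ge0 ?ler_wpM2l//; lra.
rewrite /sq !ipE; nra.
Qed.

Let q_bound s t : 0 <= s -> s < t -> t <= T ->
  sq (q s t) <= 2 * (sq V + (lam * T) ^+ 2 * sq M).
Proof.
move=> s0 st tT; apply: le_trans (q_sq_v s0 st) _.
by apply: sq_u; apply/andP; split; lra.
Qed.

Let Mq_bound s t : 0 <= s -> s < t -> t <= T -> `|ip M (q s t)| <= B.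
Proof.
move=> s0 st tT; apply: le_trans (ip_young _ _) _.
have := q_bound s0 st tT; have := ip_ge0 M; rewrite -/(sq M) /B; lra.
Qed.

(** If the free velocity were a constant u, then [q_sq] and [cross] would bound
    the square of q r s - q s t by the drop of the pairing with u from one
    quotient to the next. The true mean free velocities differ from [u tau] by
    at most a multiple of t - r, which makes the last term. *)
Let three_points r s t tau : 0 <= r -> r < s -> s < t -> t <= T ->
  r <= tau <= t ->
  sq (q r s - q s t) <= ip (u tau) (q r s) - ip (u tau) (q s t) + K * (t - r).
Proof.
move=> r0 rs st tT /andP[rtau taut].
have s0 : 0 <= s by lra.
have sT : s <= T by lra.
have := Mq_bound s0 st tT; have := Mq_bound r0 rs sT.
have := cross r0 rs st; have := q_sq r0 rs; have := q_sq s0 st.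
rewrite /sq /u /v; move: (q r s) (q s t) => q' q''.
rewrite !ipE [ip q'' q']ipC.
set a' := ip V q'; set a := ip V q''; set m' := ip M q'; set m := ip M q''.
move=> h1 h2 h3; rewrite !ler_norml => /andP[h4 h5] /andP[h6 h7].
have k1 : lam * (tau - (r + s) / 2) * m' <= lam * (t - r) * B.
  rewrite -!mulrA; apply: ler_wpM2l => //; nra.
have k2 : - (lam * (tau - (r + s) / 2 + (t - r) / 2) * m) <= 2 * (lam * (t - r) * B).
  have : - ((tau - (r + s) / 2 + (t - r) / 2) * m) <= 2 * ((t - r) * B) by nra.
  move=> /(ler_wpM2l lam0); lra.
have k3 : 0 <= lam * (t - r) * B by rewrite !mulr_ge0//; lra.
rewrite /K; lra.
Qed.

(** Pairings of the free velocity at t0 with the right and left difference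
    quotients there. Up to errors of the size of the interval, [three_points]
    makes them monotone, and the right ones smaller than the left ones. *)
Let up t0 t := ip (u t0) (q t0 t).
Let um t0 s := ip (u t0) (q s t0).

Let up_quasi t0 t' t : 0 <= t0 -> t0 < t' -> t' < t -> t <= T ->
  up t0 t - K * (t - t0) <= up t0 t'.
Proof.
move=> t00 h1 h2 tT; have := @three_points t0 t' t t0 t00 h1 h2 tT.
have -> : t0 <= t0 <= t by rewrite lexx/=; lra.
move=> /(_ isT); have := ip_ge0 (q t0 t' - q t' t); rewrite -/(sq _) => h3 h4.
rewrite /up; move: h3 h4 (K0); rewrite /q.
set a := ip (u t0) ((t' - t0)^-1 *: _); set b := ip (u t0) ((t - t')^-1 *: _).
move=> h3 h4 k0.
have -> : ip (u t0) ((t - t0)^-1 *: (X t - X t0)) =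
    (t - t0)^-1 * ((t' - t0) * a + (t - t') * b).
  rewrite /a /b; move: (u t0) => w; rewrite !ipE; field.
  by rewrite !subr_eq0 !gt_eqF//; lra.
have tt : 0 < t - t0 by lra.
suff : (t - t0)^-1 * ((t' - t0) * a + (t - t') * b) <= a + K * (t - t0) by lra.
rewrite ler_pdivrMl//.
have : (t - t') * b <= (t - t') * (a + K * (t - t0)) by rewrite ler_pM2l; lra.
have : 0 <= (t' - t0) * (K * (t - t0)) by rewrite !mulr_ge0//; lra.
lra.
Qed.

Let um_quasi t0 s s' : 0 <= s -> s < s' -> s' < t0 -> t0 <= T ->
  um t0 s' <= um t0 s + K * (t0 - s).
Proof.
move=> s0 h1 h2 tT; have := @three_points s s' t0 t0 s0 h1 h2 tT.
have -> : s <= t0 <= t0 by rewrite lexx andbT; lra.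
move=> /(_ isT); have := ip_ge0 (q s s' - q s' t0); rewrite -/(sq _) => h3 h4.
rewrite /um; move: h3 h4 (K0); rewrite /q.
set a := ip (u t0) ((s' - s)^-1 *: _); set b := ip (u t0) ((t0 - s')^-1 *: _).
move=> h3 h4 k0.
have -> : ip (u t0) ((t0 - s)^-1 *: (X t0 - X s)) =
    (t0 - s)^-1 * ((s' - s) * a + (t0 - s') * b).
  rewrite /a /b; move: (u t0) => w; rewrite !ipE; field.
  by rewrite !subr_eq0 !gt_eqF//; lra.
have tt : 0 < t0 - s by lra.
suff : b - K * (t0 - s) <= (t0 - s)^-1 * ((s' - s) * a + (t0 - s') * b) by lra.
rewrite ler_pdivlMl//.
have : (s' - s) * (b - K * (t0 - s)) <= (s' - s) * a by rewrite ler_pM2l; lra.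
have : 0 <= (t0 - s') * (K * (t0 - s)) by rewrite !mulr_ge0//; lra.
lra.
Qed.

Let gap s t0 t : 0 <= s -> s < t0 -> t0 < t -> t <= T ->
  sq (q s t0 - q t0 t) <= um t0 s - up t0 t + K * (t - s).
Proof.
move=> s0 h1 h2 tT; apply: three_points => //.
by apply/andP; split; lra.
Qed.

Let rset t0 := [set up t0 t - K * (t - t0) | t in `]t0, T]%classic].
Let lset t0 := [set um t0 s + K * (t0 - s) | s in `[0, t0[%classic].
(** The limits of [up] and [um] at t0, obtained as extrema after correcting the
    pairings by the error bound. *)
Let rslope t0 := sup (rset t0).
Let lslope t0 := inf (lset t0).

Let rl_le t0 x y : rset t0 x -> lset t0 y -> x <= y.
Proof.
move=> [t /=]; rewrite in_itv/= => /andP[t0t tT] <- [s /=].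
rewrite in_itv/= => /andP[s0 st] <-.
have := gap s0 st t0t tT; have := ip_ge0 (q s t0 - q t0 t); rewrite -/(sq _); lra.
Qed.

Let rset0 t0 : 0 < t0 < T -> rset t0 !=set0.
Proof.
move=> /andP[h1 h2]; exists (up t0 T - K * (T - t0)), T => //=.
by rewrite in_itv/= h2 lexx.
Qed.

Let lset0 t0 : 0 < t0 < T -> lset t0 !=set0.
Proof.
move=> /andP[h1 h2]; exists (um t0 0 + K * (t0 - 0)), 0 => //=.
by rewrite in_itv/= h1 lexx.
Qed.

Let rsup t0 : 0 < t0 < T -> has_sup (rset t0).
Proof.
move=> h; split; first exact: rset0.
by have [y hy] := lset0 h; exists y => x hx; exact: rl_le hx hy.
Qed.

Let linf t0 : 0 < t0 < T -> has_inf (lset t0).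
Proof.
move=> h; split; first exact: lset0.
by have [y hy] := rset0 h; exists y => x hx; exact: rl_le hy hx.
Qed.

Let rslope_le t0 : 0 < t0 < T -> rslope t0 <= lslope t0.
Proof.
move=> h; apply: ge_sup => [|x hx]; first exact: rset0.
by apply: lb_le_inf => [|y hy]; [exact: lset0|exact: rl_le hx hy].
Qed.

(** Both slopes are compared with the single quotient between t0 and t1. *)
Let lslope_next t0 t1 : 0 < t0 -> t0 < t1 -> t1 < T ->
  lslope t1 - 3 * K * t1 <= rslope t0 - 3 * K * t0.
Proof.
move=> h0 h1 h2.
have a0 : 0 < t0 < T by apply/andP; split; lra.
have a1 : 0 < t1 < T by apply/andP; split; lra.
have : lslope t1 <= um t1 t0 + K * (t1 - t0).
  apply: ge_inf; first exact: (linf a1).2.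
  by exists t0 => //=; rewrite in_itv/= h1 ltW.
have : up t0 t1 - K * (t1 - t0) <= rslope t0.
  apply: ub_le_sup; first exact: (rsup a0).2.
  by exists t1 => //=; rewrite in_itv/= h1 ltW.
have t00 : 0 <= t0 by lra.
have t1T : t1 <= T by lra.
have := Mq_bound t00 h1 t1T; rewrite ler_norml => /andP[m1 m2].
rewrite /um /up /u; move: (q t0 t1) m1 m2 => w m1 m2; rewrite !ipE.
have : - (lam * (t1 - t0) * ip M w) <= lam * (t1 - t0) * B.
  by rewrite -mulrN; apply: ler_wpM2l; [rewrite mulr_ge0//; lra|lra].
have : 0 <= lam * (t1 - t0) * B by rewrite !mulr_ge0//; lra.
rewrite /K; lra.
Qed.

Let jumps := [set t | 0 < t < T /\ rslope t < lslope t].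

(** By [lslope_next], after subtraction of a linear drift the intervals from
    right to left slope at distinct jump times are disjoint. *)
Let jumps_countable : countable jumps.
Proof.
pose I t : set R := if pselect (jumps t) then
  `]rslope t - 3 * K * t, lslope t - 3 * K * t[%classic else setT.
apply: (@separated_open_countable R R I).
- by move=> t; rewrite /I; case: pselect => jt /=; [exact: interval_open|exact: openT].
- move=> t; rewrite /I; case: pselect => [[_ h]|jt]/=; last by exists 0.
  exists ((rslope t + lslope t) / 2 - 3 * K * t) => /=.
  by rewrite in_itv/=; apply/andP; split; lra.
- move=> s t js jt [x []]; rewrite /I; do 2 (case: pselect => // ?) => /=.
  rewrite !in_itv/= => /andP[h1 h2] /andP[h3 h4].
  have [[/andP[s0 sT] _] [/andP[t0 tT] _]] := (js, jt).
  have [st|ts|//] := ltgtP s t.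
    by have := lslope_next s0 st tT; lra.
  by have := lslope_next t0 ts sT; lra.
Qed.

(** When the two slopes agree, [gap] forces the left and right quotients towards
    each other in norm. *)
Let no_jump t0 e : 0 < t0 < T -> ~ jumps t0 -> 0 < e ->
  exists2 d : R, 0 < d & forall s t, 0 <= s -> t0 - d < s -> s < t0 ->
    t0 < t -> t < t0 + d -> t <= T -> sq (q s t0 - q t0 t) <= e.
Proof.
move=> a0 nj e0; have e3 : 0 < e / 3 by lra.
have E : rslope t0 = lslope t0.
  apply/eqP; rewrite eq_le rslope_le//= leNgt; apply/negP => h; exact: nj.
have [_ [t1 /= + <-]] := sup_adherent e3 (rsup a0).
rewrite in_itv/= -/(rslope t0) => /andP[h1 h2] h3.
have [_ [s1 /= + <-]] := inf_adherent e3 (linf a0).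
rewrite in_itv/= -/(lslope t0) => /andP[h4 h5] h6.
pose d := Num.min (t1 - t0) (Num.min (t0 - s1) (e / (6 * (K + 1)))).
have K1 : 0 < K + 1 by have := K0; lra.
have d0 : 0 < d by rewrite !lt_min !subr_gt0 h1 h5/= divr_gt0// mulr_gt0.
have d1 : d <= t1 - t0 by rewrite ge_min lexx.
have d2 : d <= t0 - s1 by rewrite !ge_min lexx orbT.
have d3 : d <= e / (6 * (K + 1)) by rewrite !ge_min lexx !orbT.
exists d => // s t s0 sd st0 t0t td tT.
have g1 := gap s0 st0 t0t tT.
have g2 : up t0 t1 - K * (t1 - t0) <= up t0 t by apply: up_quasi => //; lra.
have g3 : um t0 s <= um t0 s1 + K * (t0 - s1).
  by apply: um_quasi => //; lra.
have g4 : K * (t - s) <= e / 3.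
  have : K * (t - s) <= (K + 1) * (2 * d) by apply: ler_pM; rewrite ?K0//; lra.
  have : (K + 1) * (2 * d) <= (K + 1) * (2 * (e / (6 * (K + 1)))).
    by rewrite ler_pM2l//; lra.
  have -> : (K + 1) * (2 * (e / (6 * (K + 1)))) = e / 3 by field; lra.
  lra.
lra.
Qed.

(** Right quotients taken at ever smaller scales are close to a common left
    quotient, hence to each other; their limit D is then approached by all
    quotients on both sides. *)
Lemma countable_jumps : exists N : set R, countable N /\
  forall t0, 0 < t0 < T -> ~ N t0 -> exists D, forall e, 0 < e ->
  exists2 d : R, 0 < d & forall h, h != 0 -> `|h| < d ->
    ip (h^-1 *: (X (t0 + h) - X t0) - D) (h^-1 *: (X (t0 + h) - X t0) - D) <= e.
Proof.
(* The tolerance [ek k] is a quarter of the bound required for completeness,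
   because the triangle inequality for squares costs a factor 2 on each of two
   terms. *)
exists jumps; split=> // t0 a0 nj; have [t00 t0T] := andP a0.
pose ek k : R := 4^-1 ^+ k / 4.
have ek0 k : 0 < ek k by rewrite divr_gt0// exprn_gt0.
have /choice [d Hd] : forall k, exists d : R, 0 < d /\ forall s t, 0 <= s -> t0 - d < s ->
    s < t0 -> t0 < t -> t < t0 + d -> t <= T -> sq (q s t0 - q t0 t) <= ek k.
  by move=> k; have [d ? ?] := no_jump a0 nj (ek0 k); exists d.
pose tk k := Num.min T (t0 + d k / 2).
have tkP k : [/\ t0 < tk k, tk k < t0 + d k & tk k <= T].
  have [dk _] := Hd k; rewrite /tk; split.
  - by rewrite lt_min t0T/=; lra.
  - by rewrite gt_min; apply/orP; right; lra.
  - by rewrite ge_min lexx.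
pose w k := q t0 (tk k).
have left_near k s : 0 <= s -> t0 - d k < s -> s < t0 -> sq (q s t0 - w k) <= ek k.
  by move=> s0 h1 h2; have [? ? ?] := tkP k; have [_] := Hd k; apply.
have [D HD] : exists D, forall e : R, 0 < e -> exists N, forall k, (N <= k)%N ->
    ip (w k - D) (w k - D) <= e.
  apply: ip_complete => k.
  pose m := Num.min t0 (Num.min (d k) (d k.+1)).
  have m0 : 0 < m by rewrite !lt_min t00 (Hd k).1 (Hd k.+1).1.
  have m1 : m <= t0 by rewrite ge_min lexx.
  have m2 : m <= d k by rewrite !ge_min lexx orbT.
  have m3 : m <= d k.+1 by rewrite !ge_min lexx !orbT.
  have := @left_near k (t0 - m / 2); have := @left_near k.+1 (t0 - m / 2).
  move=> /(_ ltac:(lra) ltac:(lra) ltac:(lra)) h1 /(_ ltac:(lra) ltac:(lra) ltac:(lra)) h2.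
  have := sq_triangle (w k.+1) (q (t0 - m / 2) t0) (w k).
  have -> : sq (w k.+1 - q (t0 - m / 2) t0) = sq (q (t0 - m / 2) t0 - w k.+1).
    by rewrite -[in LHS]opprB /sq ipNl ipNr opprK.
  have : ek k.+1 <= ek k by rewrite /ek exprS; have := ek0 k; rewrite /ek; lra.
  have -> : 4^-1 ^+ k = 4 * ek k by rewrite /ek; field.
  by rewrite -/(sq _); lra.
exists D => e e0.
have e16 : 0 < e / 16 by lra.
have [N HN] := HD _ e16.
have [N' HN'] : exists N', forall k, (N' <= k)%N -> ek k <= e / 16.
  have : (4^-1 : R) ^+ k @[k --> \oo] --> (0 : R).
    by apply: cvg_expr; rewrite ger0_norm ?invr_ge0// invf_lt1// ltr1n.
  move/cvgrPdist_le => /(_ _ e16)[N' _ HN']; exists N' => k /HN' /=.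
  rewrite sub0r normrN ger0_norm ?exprn_ge0 ?invr_ge0//.
  rewrite /ek => h; apply: le_trans h; rewrite ler_pdivrMr// ler_peMr ?exprn_ge0 ?invr_ge0//.
  by rewrite ler1n.
pose k := maxn N N'.
have hk1 := HN k (leq_maxl _ _); have hk2 := HN' k (leq_maxr _ _).
rewrite -/(sq _) in hk1.
have [dk0 Hk] := Hd k.
exists (Num.min (d k) (Num.min t0 (T - t0))).
  by rewrite !lt_min dk0 t00 subr_gt0.
move=> h h0; rewrite !lt_min => /andP[hd /andP[ht hT]].
pose s := t0 - Num.min t0 (d k) / 2.
have m1 : Num.min t0 (d k) <= t0 by rewrite ge_min lexx.
have m2 : Num.min t0 (d k) <= d k by rewrite ge_min lexx orbT.
have m0 : 0 < Num.min t0 (d k) by rewrite lt_min t00.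
have [s0 s1 s2] : [/\ 0 <= s, t0 - d k < s & s < t0] by rewrite /s; split; lra.
rewrite -/(sq _).
have [hpos|hneg|/eqP] := ltgtP 0 h; last by rewrite eq_sym (negbTE h0).
  rewrite gtr0_norm// in hd ht hT.
  have -> : h^-1 *: (X (t0 + h) - X t0) = q t0 (t0 + h).
    by rewrite /q (addrC t0 h) addrK.
  have b1 := Hk s (t0 + h) s0 s1 s2 ltac:(lra) ltac:(lra) ltac:(lra).
  have b2 := left_near k s s0 s1 s2.
  have := sq_triangle (q t0 (t0 + h)) (q s t0) D.
  have := sq_triangle (q s t0) (w k) D.
  have -> : sq (q t0 (t0 + h) - q s t0) = sq (q s t0 - q t0 (t0 + h)).
    by rewrite -[in LHS]opprB /sq ipNl ipNr opprK.
  lra.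
rewrite ltr0_norm// in hd ht hT.
have -> : h^-1 *: (X (t0 + h) - X t0) = q (t0 + h) t0.
  rewrite /q -opprB scalerN -scaleNr; congr (_ *: _).
  by rewrite -invrN; congr (_^-1); lra.
have b2 := left_near k (t0 + h) ltac:(lra) ltac:(lra) ltac:(lra).
have := sq_triangle (q (t0 + h) t0) (w k) D; lra.
Qed.

End bounded_times.

Lemma sticky_curve_derivable : exists N : set R, countable N /\
  forall t0, 0 < t0 -> ~ N t0 -> exists D, forall e, 0 < e ->
  exists2 d : R, 0 < d & forall h, h != 0 -> `|h| < d ->
    ip (h^-1 *: (X (t0 + h) - X t0) - D) (h^-1 *: (X (t0 + h) - X t0) - D) <= e.
Proof.
have /choice[N HN] := fun n : nat => countable_jumps n.+1%:R.
exists (\bigcup_n N n); split.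
  by apply: bigcup_countable => // n _; exact: (HN n).1.
move=> t0 t00 nN; have [_] := HN (Num.truncn t0); apply.
  by rewrite t00 truncnS_gt.
by apply: contra_not nN => h; exists (Num.truncn t0).
Qed.

(** Divide the inequality between the times t0 - h and t0 by h: the free path
    contributes its velocity [V - (lam * t0) *: M] and the curve its derivative
    D. *)
Lemma sticky_curve_inclusion t0 D y : 0 < t0 ->
  (forall e, 0 < e -> exists2 d : R, 0 < d & forall h, h != 0 -> `|h| < d ->
    ip (h^-1 *: (X (t0 + h) - X t0) - D) (h^-1 *: (X (t0 + h) - X t0) - D) <= e) ->
  (forall s, 0 < s -> s < t0 -> ip (g t0 - X t0) y <= ip (g s - X s) y) ->
  ip (V - (lam * t0) *: M - D) y <= 0.
Proof.
move=> t00 HD Hy; apply/ler_addgt0Pr => e e0; rewrite add0r.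
have e2 : 0 < e / 2 by rewrite divr_gt0.
(* With this c, the estimate 2 c <z, y> <= c^2 <z, z> + <y, y> makes <z, y> at
   most e / 2. *)
pose c := (sq y + 1) / (e / 2).
have y1 : 0 < sq y + 1 by rewrite ltr_wpDl// ip_ge0.
have c0 : 0 < c by rewrite divr_gt0.
have [d d0 Hd] := HD _ (divr_gt0 e2 c0).
pose B := `|lam * ip M y| + 1.
have B0 : 0 < B by rewrite ltr_wpDl.
pose h := Num.min (d / 2) (Num.min (t0 / 2) (e / (2 * B))).
have h0 : 0 < h by rewrite !lt_min !divr_gt0// mulr_gt0.
have h1 : h <= d / 2 by rewrite ge_min lexx.
have h2 : h <= t0 / 2 by rewrite !ge_min lexx orbT.
have h3 : h <= e / (2 * B) by rewrite !ge_min lexx !orbT.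
have := Hd (- h); rewrite oppr_eq0 gt_eqF// normrN gtr0_norm// => /(_ isT ltac:(lra)).
set z := _ - D => hz.
have {}hz : ip z y <= e / 2.
  move: hz; move: z => z hz; have := ip_ge0 (c *: z - y).
  rewrite !ipE [ip y z]ipC -/(sq z) -/(sq y) => k1.
  have k2 : c * (c * sq z) <= c * (e / 2).
    rewrite ler_pM2l//; have -> : e / 2 = c * (e / 2 / c) by field; rewrite gt_eqF.
    by rewrite ler_pM2l.
  have k3 : sq y <= c * (e / 2).
    by rewrite /c divfK ?gt_eqF//; lra.
  have : c * ip z y <= c * (e / 2) by lra.
  by rewrite ler_pM2l.
have s0 : 0 < t0 - h by lra.
have st : t0 - h < t0 by lra.
have k1 := Hy _ s0 st.
have k2 := free_pathB (t0 - h) t0 y.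
have k3 : - (lam * ip M y) * h <= e / 2.
  apply: le_trans (ler_wpM2r (ltW h0) (ler_norm _)) _; rewrite normrN.
  apply: (@le_trans _ _ (B * (e / (2 * B)))).
    by apply: ler_pM => //; [exact: ltW|rewrite /B lerDl].
  by rewrite le_eqVlt; apply/orP; left; apply/eqP; field; rewrite gt_eqF.
have k4 : ip (X t0) y - ip (X (t0 - h)) y = h * (ip z y + ip D y).
  by rewrite /z !ipE; field; rewrite gt_eqF.
rewrite -(ler_pM2l h0); move: k1 k2; rewrite /v.
have -> : ip (V - (lam * t0) *: M - D) y = ip V y - lam * t0 * ip M y - ip D y.
  by rewrite !ipE.
have -> : ip (V - (lam * ((t0 - h + t0) / 2)) *: M) y =
  ip V y - lam * ((t0 - h + t0) / 2) * ip M y by rewrite !ipE.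
rewrite !(ipDl, ipNl).
have : h * ip z y <= h * (e / 2) by rewrite ler_pM2l.
have : h * (- (lam * ip M y) * h) <= h * (e / 2) by rewrite ler_pM2l.
have : 0 <= h * e by rewrite mulr_ge0// ltW.
lra.
Qed.

End sticky_curve.

(** * Completeness of the space of square-integrable functions *)

Section riesz_fischer.
Context {R : realType}.
Local Notation mu := (@lebesgue_measure R).
Local Notation Om := (@Omega R).
Implicit Types (f g : R -> R).

Let nsqE f g : dotO (fun x => f x - g x) (fun x => f x - g x) =
  meanO (fun x => (f x - g x) ^+ 2).
Proof. by apply: meanO_eq => x _; rewrite expr2. Qed.

Variable w : nat -> R -> R.
Hypothesis wL : forall k, in_L2 (w k).
Hypothesis fast : forall k,
  dotO (fun x => w k.+1 x - w k x) (fun x => w k.+1 x - w k x) <= 4^-1 ^+ k.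

Let wB k l : in_L2 (fun x => w k x - w l x). Proof. exact: in_L2B. Qed.

Let a k x := `|w k.+1 x - w k x|.

Let a_integrable k : integrableO (a k).
Proof.
apply: (integrableO_le _ (in_L2_integrable (wB k.+1 k))).
  apply: measurableT_comp => //; exact: in_L2_measurable (wB k.+1 k).
by move=> x _; rewrite normr_id.
Qed.

Let a_mean k : meanO (a k) <= 2^-1 ^+ k.
Proof.
pose p : R := 2^-1 ^+ k; have p0 : 0 < p by rewrite exprn_gt0.
have pp : p * p = 4^-1 ^+ k.
  by rewrite -expr2 -exprM mulnC exprM; congr (_ ^+ k); field.
have ii := in_L2_sqr (wB k.+1 k).
apply: (@le_trans _ _ (meanO (fun x => (2 * p)^-1 * (w k.+1 x - w k x) ^+ 2 + p / 2))).
  apply: le_meanO => //.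
    by apply: integrableOD; [exact: integrableOZ|exact: integrableO_cst].
  move=> x _; rewrite -(ler_pM2l (_ : 0 < 2 * p)) ?mulr_gt0//.
  rewrite mulrDr mulVKf ?gt_eqF ?mulr_gt0// /a.
  rewrite -[in leRHS](real_normK (num_real _)).
  have := sqr_ge0 (`|w k.+1 x - w k x| - p); nra.
rewrite meanOD; [|exact: integrableOZ|exact: integrableO_cst].
have -> : meanO (fun=> p / 2) = p / 2 by exact: meanO_cst.
rewrite meanOZ// -nsqE.
have : (2 * p)^-1 * dotO (fun x => w k.+1 x - w k x) (fun x => w k.+1 x - w k x)
   <= (2 * p)^-1 * (p * p).
  by rewrite ler_pM2l ?invr_gt0 ?mulr_gt0// pp.
have -> : (2 * p)^-1 * (p * p) = p / 2 by field; rewrite gt_eqF.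
by rewrite -/p; lra.
Qed.

Let sum_half n : \sum_(0 <= k < n) (2^-1 : R) ^+ k = 2 - 2 * 2^-1 ^+ n.
Proof.
elim: n => [|n IH]; first by rewrite big_geq// expr0; ring.
by rewrite big_nat_recr//= IH exprS; field.
Qed.

(** The increments have summable means, so their sum is finite almost everywhere
    and the sequence converges absolutely there. *)
Let w_cvg_ae : {ae mu, forall x, Om x -> cvgn (w^~ x)}.
Proof.
have mO := @measurable_Omega R.
pose F x := (\sum_(k <oo) (a k x)%:E)%E.
have ma k : measurable_fun Om (fun x => (a k x)%:E).
  exact: measurable_int (a_integrable k).
have a0 k x : Om x -> (0 <= (a k x)%:E)%E by rewrite lee_fin normr_ge0.
have mF : measurable_fun Om F by exact: (@ge0_emeasurable_sum _ _ _ Om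
    (fun k x => (a k x)%:E) xpredT (fun k x Ox _ => a0 k x Ox) (fun k _ => ma k)).
have F2 : (\int[mu]_(x in Om) F x <= 2%:E)%E.
  rewrite integral_nneseries//.
  apply: lime_le.
    by apply: is_cvg_nneseries => n _ _; apply: integral_ge0 => x; exact: a0.
  apply: nearW => n.
  rewrite (eq_bigr (fun k => (meanO (a k))%:E)); last by move=> k _; rewrite meanOE.
  rewrite sumEFin lee_fin.
  apply: (@le_trans _ _ (\sum_(0 <= k < n) (2^-1 : R) ^+ k)).
    by apply: ler_sum => k _; exact: a_mean.
  by rewrite sum_half lerBlDr lerDl mulr_ge0 ?exprn_ge0 ?invr_ge0.
have F0 x : Om x -> (0 <= F x)%E by move=> Ox; apply: nneseries_ge0 => k _ _; exact: a0.
have Fi : mu.-integrable Om F.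
  apply/integrableP; split => //.
  have -> : (\int[mu]_(x in Om) `|F x| = \int[mu]_(x in Om) F x)%E.
    by apply: eq_integral => x; rewrite inE => /F0 /gee0_abs.
  by rewrite (le_lt_trans F2)// ltry.
have := integrable_ae mO Fi; apply: ae_imp => x H Ox; have Ffin := H Ox.
have ca : cvgn (series (a^~ x)).
  apply: nondecreasing_is_cvgn.
    by apply: nondecreasing_series => k _ _; exact: normr_ge0.
  exists (fine (F x)) => _ [n _ <-]; rewrite -lee_fin fineK// /series/= -sumEFin.
  by apply: nneseries_lim_ge => k _ _; exact: a0.
have /normed_cvg cb : cvgn [normed series (telescope (w^~ x))] by exact: ca.
rewrite (_ : w^~ x = (fun n => series (telescope (w^~ x)) n + w 0%N x)).
  by apply: is_cvgD => //; exact: is_cvg_cst.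
by apply/funext => n; rewrite telescopeK subrK.
Qed.

(** The pointwise limit is controlled by applying the Fatou lemma to the squared
    distances. *)
Lemma riesz_fischer : exists2 D : R -> R, in_L2 D &
  forall e : R, 0 < e -> exists N, forall k, (N <= k)%N ->
    dotO (fun x => w k x - D x) (fun x => w k x - D x) <= e.
Proof.
pose D x := fine (limn_esup (fun k => (w k x)%:E)).
have mD : measurable_fun Om D.
  apply: measurableT_comp => //; apply: measurable_fun_limn_esup => k.
  by apply/measurable_EFinP; exact: in_L2_measurable.
have wD : {ae mu, forall x, Om x -> w k x @[k --> \oo] --> D x}.
  apply: ae_imp w_cvg_ae => x H Ox; have /cvg_ex[/= l Hl] := H Ox.
  suff -> : D x = l by [].
  have E : (w k x)%:E @[k --> \oo] --> l%:E by apply: cvg_EFin => //; exact: nearW.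
  by rewrite /D; have [_ ->] := cvg_limn_einf_sup E.
have dist i n : meanO (fun x => (w (n + i)%N x - w n x) ^+ 2) <= 4 * 4^-1 ^+ n.
  elim: i n => [|i IH] n.
    rewrite addn0 (@meanO_eq _ _ (fun=> 0)) ?meanO_cst ?mulr_ge0 ?exprn_ge0 ?invr_ge0//.
    by move=> x _; rewrite subrr expr0n.
  rewrite addnS -addSn.
  apply: (@le_trans _ _ (meanO (fun x => 2 * (w n.+1 x - w n x) ^+ 2 +
      2 * (w (n.+1 + i)%N x - w n.+1 x) ^+ 2))).
    apply: le_meanO.
    - exact: in_L2_sqr (wB _ _).
    - by apply: integrableOD; apply: integrableOZ; exact: in_L2_sqr (wB _ _).
    - move=> x _; have := sqr_ge0 (w (n.+1 + i)%N x - w n.+1 x - (w n.+1 x - w n x)); nra.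
  rewrite meanOD; try (apply: integrableOZ; exact: in_L2_sqr (wB _ _)).
  rewrite !meanOZ; try exact: in_L2_sqr (wB _ _).
  have := IH n.+1; have := fast n; rewrite nsqE exprS; lra.
have key n : integrableO (fun x => (w n x - D x) ^+ 2) /\
    meanO (fun x => (w n x - D x) ^+ 2) <= 4 * 4^-1 ^+ n.
  apply: (@fatou_meanO _ _ (fun i x => (w (n + i)%N x - w n x) ^+ 2)).
  - by apply: measurable_funX; apply: measurable_funB => //; exact: in_L2_measurable.
  - by move=> i; exact: in_L2_sqr (wB _ _).
  - by move=> i x _; exact: sqr_ge0.
  - apply: ae_imp wD => x H Ox; have {}H := H Ox.
    have Hs : w (n + i)%N x @[i --> \oo] --> D x.
      exact: (cvg_comp _ _ (cvg_addnl n) H).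
    rewrite -sqrrN opprB; apply: (@cvg_comp _ _ _
      (fun i => w (n + i)%N x - w n x) (fun y => y ^+ 2)).
      by apply: cvgB; [exact: Hs|exact: cvg_cst].
    exact: exprn_continuous.
  - by move=> i; exact: dist.
exists D.
  have : in_L2 (fun x => w 0%N x - D x).
    apply/in_L2P; split; last exact: (key 0%N).1.
    by apply: measurable_funB => //; exact: in_L2_measurable.
  by move=> /(in_L2B (wL 0%N)); apply: in_L2_eq => x _; rewrite opprB addrC subrK.
move=> e e0; have e4 : 0 < e / 4 by rewrite divr_gt0.
have : (4^-1 : R) ^+ k @[k --> \oo] --> (0 : R).
  by apply: cvg_expr; rewrite ger0_norm ?invr_ge0// invf_lt1// ltr1n.
move/cvgrPdist_le => /(_ _ e4)[N _ HN]; exists N => k /HN /=.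
rewrite sub0r normrN ger0_norm ?exprn_ge0 ?invr_ge0// => h.
by rewrite nsqE; apply: le_trans (key k).2 _; lra.
Qed.

End riesz_fischer.

Section L2_space.
Context {R : realType}.
Local Notation mu := (@lebesgue_measure R).
Local Notation Om := (@Omega R).

(** Elements of this module are functions rather than classes, so the inner
    product [dotO] is only semidefinite on it; the abstract results on sticky
    curves allow this. *)
Definition L2space := LfunType mu (@lee1n R 2).

Lemma L2space_in_L2 (f : L2space) : in_L2 (f : R -> R).
Proof.
have := LfunP f => fL.
apply/in_L2P; split.
  by move: (fL); rewrite inE => /andP[+ _]; rewrite inE/= => mf; apply: measurable_funTS.
have := Lfun2_integrable_sqr fL.
by apply: integrableS => //; exact: measurable_Omega.
Qed.

Lemma L2space_of (f : R -> R) : in_L2 f ->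
  exists F : L2space, forall x, Om x -> F x = f x.
Proof.
move=> fL; exists (@Lfun_Sub _ _ _ mu _ (@lee1n R 2) _ fL) => x Ox.
by rewrite Lfun_valP patchE mem_set.
Qed.

Lemma L2spaceD (f g : L2space) x : (f + g) x = f x + g x.
Proof. by []. Qed.

Lemma L2spaceN (f : L2space) x : (- f) x = - f x.
Proof. by []. Qed.

Lemma L2spaceZ (a : R) (f : L2space) x : (a *: f) x = a * f x.
Proof. by []. Qed.

End L2_space.

(** * Lipschitz functions with nonpositive derivative almost everywhere *)

Section lipschitz_nonincreasing.
Context {R : realType}.
Local Notation mu := (@lebesgue_measure R).
Let lam : {measure set (measurableTypeR R) -> \bar R} := mu.
Implicit Types (r s t h e d : R).

(** Cover the exceptional times by an open set W of measure at most 3 e. The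
    function psi s = phi s - e s - L m(s), where m(s) is the measure of the part
    of W before s, does not exceed psi s immediately to the right of s: in W
    because phi grows at a rate at most L, which the last term compensates, and
    elsewhere because of the derivative. The supremum of the times up to which
    psi stays below its initial value is therefore T, and phi is nonincreasing
    up to an error proportional to e. *)
Lemma lipschitz_ae_nonincreasing (phi : R -> R) (T L : R) (N : set R) :
  0 <= T -> 0 <= L ->
  (forall s t, 0 <= s <= T -> 0 <= t <= T -> `|phi t - phi s| <= L * `|t - s|) ->
  mu.-negligible N ->
  (forall s, 0 < s < T -> ~ N s -> forall e, 0 < e ->
    exists2 d : R, 0 < d & forall h, 0 < h -> h < d -> phi (s + h) - phi s <= e * h) ->
  phi T <= phi 0.
Proof.
move=> T0 L0 lip [N' [mN' N'0 NN']] der.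
apply/ler_addgt0Pr => e0 e00.
pose e := e0 / (T + 3 * L + 1).
have D0 : 0 < T + 3 * L + 1 by lra.
have e_gt0 : 0 < e by rewrite divr_gt0.
have [|U [oU N'U mU]] := @lebesgue_regularity_outer R N' e mN' _ e_gt0.
  by rewrite [X in (X < _)%E]N'0 ltry.
(* The interval around 0 takes care of the initial time, where nothing is
   assumed. *)
pose W := U `|` `]- e, e[%classic.
have oW : open W by apply: openU => //; exact: interval_open.
have mW : measurable (W : set (measurableTypeR R)) by exact: open_measurable.
have muW : (mu W <= (3 * e)%:E)%E.
  have mU' : measurable (U : set (measurableTypeR R)) by exact: open_measurable.
  apply: le_trans (@measureU2 _ _ _ lam _ _ mU' (measurable_itv _)) _.
  have -> : (3 * e)%:E = (e%:E + (2 * e)%:E)%E by rewrite -EFinD; congr EFin; ring.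
  apply: leeD.
    have -> : U = (U `\` N') `|` N' by rewrite setUC setDUK.
    apply: le_trans (@measureU2 _ _ _ lam _ _ (measurableD mU' mN') mN') _.
    by rewrite [X in (_ + X)%E]N'0 adde0 ltW.
  have E : mu `]- e, e[%classic = (2 * e)%:E.
    rewrite lebesgue_measure_itv/= lte_fin (_ : - e < e)%R; last by lra.
    by rewrite -EFinD; congr EFin; ring.
  by rewrite [X in (X <= _)%E]E.
pose Ws s : set R := W `&` `]0, s[%classic.
pose J s h : set R := `]s, s + h[%classic.
pose m s := fine (mu (Ws s)).
have mWs s : measurable (Ws s : set (measurableTypeR R)).
  by apply: measurableI => //; exact: measurable_itv.
have mfin s : (mu (Ws s) <= (3 * e)%:E)%E.
  by apply: le_trans muW; apply: (le_measure lam); rewrite ?inE//; exact: subIsetl.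
have mE s : mu (Ws s) = (m s)%:E.
  rewrite /m fineK// ge0_fin_numE; first by rewrite (le_lt_trans (mfin s))// ltry.
  exact: (measure_ge0 lam).
have m0 s : 0 <= m s by rewrite -lee_fin -mE; exact: (measure_ge0 lam).
have m3 s : m s <= 3 * e by rewrite -lee_fin -mE.
have mono s t : s <= t -> m s <= m t.
  move=> st; rewrite -lee_fin -!mE; apply: (le_measure lam); rewrite ?inE//.
  apply: setIS => x /=; rewrite !in_itv/= => /andP[-> xs]; exact: lt_le_trans st.
have grow s h : 0 <= s -> 0 < h -> (forall x, s < x < s + h -> W x) ->
    m s + h <= m (s + h).
  move=> s0 h0 sub; rewrite -lee_fin EFinD -!mE.
  have E : mu (J s h) = h%:E.
    rewrite /J lebesgue_measure_itv/= lte_fin ltrDl h0 -EFinD; congr EFin; ring.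
  rewrite -E; have <- : mu ((Ws s) `|` J s h) =
      (mu (Ws s) + mu (J s h))%E.
    apply: (@measureU _ _ _ lam) => //; first exact: measurable_itv.
    rewrite -subset0 => x [[_ /=]]; rewrite !in_itv/= => /andP[_ xs] /andP[sx _].
    by rewrite ltNge (ltW sx) in xs.
  apply: (le_measure lam); rewrite ?inE//.
    by apply: measurableU => //; exact: measurable_itv.
  move=> x; rewrite /J /Ws => -[[Wx]|] /=; rewrite !in_itv/=.
    by move=> /andP[-> xs]; split=> //; rewrite (lt_trans xs)// ltrDl.
  move=> /andP[sx xsh]; split; first by apply: sub; rewrite sx.
  by rewrite (le_lt_trans s0 sx).
pose psi s := phi s - e * s - L * m s.
have right s : 0 <= s -> s < T -> exists2 d : R, 0 < d &
    forall h, 0 < h -> h < d -> s + h <= T -> psi (s + h) <= psi s.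
  move=> s0 sT; have [Wis|nWs] := pselect (W s).
    have /nbhs_ballP[d /= d0 Hd] : nbhs s W by exact: open_nbhs_nbhs.
    exists d => // h h0 hd shT.
    have := lip s (s + h); rewrite s0 (ltW sT) shT addr_ge0 ?(ltW h0)// => /(_ isT isT).
    rewrite addrAC subrr add0r (gtr0_norm h0) => /ler_normlW k1.
    have k2 : m s + h <= m (s + h).
      apply: grow => // x /andP[sx xsh]; apply: Hd.
      by rewrite /ball/= ltr_norml; apply/andP; split; lra.
    have k3 : L * (m s + h) <= L * m (s + h) by rewrite ler_wpM2l.
    have k4 : 0 <= e * h by rewrite mulr_ge0// ltW.
    rewrite /psi; lra.
  have sp : 0 < s.
    rewrite lt_neqAle s0 andbT; apply/eqP => s00; apply: nWs; right => /=.
    by rewrite -s00 in_itv/=; apply/andP; split; lra.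
  have nN : ~ N s by move=> Ns; apply: nWs; left; exact/N'U/NN'.
  have [d d0 Hd] := der s ltac:(by rewrite sp) nN _ e_gt0.
  exists d => // h h0 hd _; have := Hd h h0 hd.
  have : L * m s <= L * m (s + h) by rewrite ler_wpM2l// mono// lerDl ltW.
  rewrite /psi; lra.
have leftb r s : 0 <= r -> r <= s -> s <= T -> psi s <= psi r + L * (s - r).
  move=> r0 rs sT.
  have := lip r s; rewrite r0 (le_trans rs sT) (le_trans r0 rs) sT => /(_ isT isT) /ler_normlW.
  rewrite ger0_norm ?subr_ge0// => k1.
  have : L * m r <= L * m s by rewrite ler_wpM2l// mono.
  have : e * r <= e * s by rewrite ler_wpM2l// ltW.
  rewrite /psi; lra.
pose S := [set s | 0 <= s <= T /\ forall r, 0 <= r <= s -> psi r <= psi 0].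
have S0 : S 0.
  split; first by rewrite lexx.
  by move=> r; rewrite -eq_le eq_sym => /eqP ->.
have hS : has_sup S by split; [exists 0|exists T => s [/andP[]]].
pose c := sup S.
have c0 : 0 <= c by apply: ub_le_sup => //; exact: hS.2.
have cT : c <= T by apply: ge_sup; [exact: hS.1|move=> s [/andP[]]].
have belowc r : 0 <= r -> r < c -> psi r <= psi 0.
  move=> r0 rc; have [s [_ Hs] rs] := sup_gt hS.1 rc.
  by apply: Hs; rewrite r0 ltW.
have Sc : psi c <= psi 0.
  move: (c0); rewrite le_eqVlt => /predU1P[<-//|cpos].
  apply/ler_addgt0Pr => h h0.
  pose r := Num.max 0 (c - h / (L + 1)).
  have L1 : 0 < L + 1 by lra.
  have r0 : 0 <= r by rewrite le_max lexx.
  have rc : r < c by rewrite gt_max cpos/= gtrBl divr_gt0.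
  have k1 := leftb r c r0 (ltW rc) cT; have k2 := belowc r r0 rc.
  have k3 : L * (c - r) <= (L + 1) * (h / (L + 1)).
    apply: ler_pM => //; [lra|lra|].
    by rewrite lerBlDl -lerBlDr le_max lexx orbT.
  have k4 : (L + 1) * (h / (L + 1)) = h by field; rewrite gt_eqF.
  lra.
have cTe : c = T.
  apply/eqP; rewrite eq_le cT leNgt; apply/negP => cltT.
  have [d d0 Hd] := right c c0 cltT.
  pose k := Num.min (d / 2) (T - c).
  have k0 : 0 < k by rewrite lt_min divr_gt0// subr_gt0.
  have kd : k <= d / 2 by rewrite ge_min lexx.
  have kT : k <= T - c by rewrite ge_min lexx orbT.
  have : S (c + k).
    split; first by apply/andP; split; lra.
    move=> r /andP[r0 rck].
    have [rc|cr|->//] := ltgtP r c; first exact: belowc.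
    apply: le_trans Sc; have -> : r = c + (r - c) by ring.
    by apply: Hd; lra.
  by move/(ub_le_sup hS.2); rewrite -/c; lra.
have := Sc; rewrite cTe /psi mulr0 subr0.
have : L * m T <= L * (3 * e) by rewrite ler_wpM2l.
have : 0 <= L * m 0 by rewrite mulr_ge0.
have : (T + 3 * L + 1) * e = e0 by rewrite /e mulrC divfK// gt_eqF.
lra.
Qed.

End lipschitz_nonincreasing.

(** * Laws of functions on the unit interval *)

Section laws.
Context {R : realType}.
Local Notation mu := (@lebesgue_measure R).
Local Notation Om := (@Omega R).
Let T1 := measurableTypeR R.

Definition Omega_law : set T1 -> \bar R := mrestr mu (measurable_itv `]0, 1[).

HB.instance Definition _ := Measure.on Omega_law.

Let muO_T : Omega_law setT = 1%E.
Proof. by rewrite /Omega_law /mrestr setTI; exact: mu_Omega. Qed.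

HB.instance Definition _ := Measure_isProbability.Build _ T1 R Omega_law muO_T.

Let muO : probability T1 R := Omega_law.

Lemma law_of (X : R -> R) : measurable_fun Om X ->
  exists P : probability T1 R, forall A, measurable A -> P A = push_Omega X A.
Proof.
move=> mX; pose X' : T1 -> T1 := X \_ Om.
have mX' : measurable_fun [set: T1] X'.
  exact/(measurable_restrictT _ (@measurable_Omega R)).
pose XF := [the {mfun T1 >-> T1} of mfun_Sub (mem_set mX')].
exists (distribution muO XF) => A mA.
rewrite /distribution /push_Omega /pushforward /= /mrestr.
congr (mu _); apply/seteqP; split=> x [] /= + Ox; rewrite /X' patchE mem_set//.
Qed.

Lemma push_Omega_eq (X Y : R -> R) A : (forall x, Om x -> X x = Y x) ->
  push_Omega X A = push_Omega Y A.
Proof.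
move=> XY; rewrite /push_Omega /pushforward /mrestr; congr (mu _).
by apply/seteqP; split=> x [] /= + Ox; rewrite XY.
Qed.

(** Change of variables: the integral of v^2 under the law of X is that of
    v(X)^2 on the unit interval. *)
Lemma comp_law_in_L2 (X : R -> R) (P : probability T1 R) (v : T1 -> R) :
  measurable_fun Om X -> (forall A, measurable A -> P A = push_Omega X A) ->
  v \in Lfun P 2%:E -> in_L2 (fun m => v (X m)).
Proof.
move=> mX PX vL; pose X' : T1 -> T1 := X \_ Om.
have mX' : measurable_fun [set: T1] X'.
  exact/(measurable_restrictT _ (@measurable_Omega R)).
have mv : measurable_fun [set: T1] v.
  by move: (vL); rewrite inE => /andP[+ _]; rewrite inE.
have mvX' : measurable_fun [set: T1] (v \o X') by exact: measurableT_comp.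
have mvX : measurable_fun Om (fun m => v (X m)).
  apply: (eq_measurable_fun (v \o X')); last exact: measurable_funTS.
  by move=> x Ox; rewrite /= /X' patchE Ox.
have /integrableP[_ fin] := Lfun2_integrable_sqr vL.
apply/in_L2P; split=> //; apply/integrableP; split.
  by apply/measurable_EFinP; exact: measurable_funX.
apply: le_lt_trans fin; rewrite le_eqVlt; apply/orP; left; apply/eqP.
pose f (y : T1) : \bar R := (`|(v y ^+ 2)%:E|)%E.
have mf : measurable_fun [set: T1] f.
  by apply: measurableT_comp => //; apply/measurable_EFinP; exact: measurable_funX.
transitivity (\int[pushforward muO X']_y f y)%E; last first.
  apply: eq_measure_integral => A mA _; apply: etrans (esym (PX A mA)).
  rewrite /push_Omega /pushforward /= /Omega_law /mrestr.
  by congr (mu _); apply/seteqP; split=> x [] /= + Ox; rewrite /X' patchE mem_set.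
rewrite ge0_integral_pushforward//; last by move=> y _; exact: abse_ge0.
have mC : measurable (~` Om : set T1) by apply: measurableC; exact: measurable_Omega.
have C0 : muO (~` Om) = 0%E.
  by rewrite /muO /= /Omega_law /mrestr setICl; exact: (measure0 mu).
rewrite preimage_setT [RHS](ge0_negligible_integral mC)//; last 2 first.
- exact: (measurableT_comp mf mX').
- by move=> x _; exact: abse_ge0.
rewrite setTD setCK.
transitivity (\int[mu]_(x in Om) (f \o X') x)%E.
  by apply: eq_integral => x xO; rewrite /= /f /X' patchE xO.
apply: eq_measure_integral => A mA AO /=; rewrite /Omega_law /mrestr.
by rewrite (setIidl AO).
Qed.

End laws.

(** * Uniqueness and monotonicity of the projection *)

Section projections.
Context {R : realType}.
Local Notation mu := (@lebesgue_measure R).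
Local Notation Om := (@Omega R).
Implicit Types (g kappa X Y : R -> R) (x y al be theta : R).

(** The two functions agree almost everywhere, and a right-continuous function
    that does not vanish at m does not vanish on an interval to the right of
    m. *)
Lemma cone_dist0 X Y : cone X -> cone Y ->
  dotO (fun x => X x - Y x) (fun x => X x - Y x) = 0 ->
  forall m, Om m -> X m = Y m.
Proof.
move=> CX CY XY0 m Omm; apply: contrapT => neq.
have XL := cone_L2 CX; have YL := cone_L2 CY.
have [N [mN N0 HN]] := dotO_ae0 (in_L2B XL YL) XY0.
have [_ _ cX] := CX; have [_ _ cY] := CY.
have c : X y - Y y @[y --> m^'+] --> X m - Y m.
  by apply: cvgB; [exact: cX|exact: cY].
have e0 : 0 < `|X m - Y m| by rewrite normr_gt0 subr_eq0; apply/eqP.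
have /cvgrPdist_lt /(_ _ e0)[d /= d0 Hd] := c.
have := Omm; rewrite OmegaE => /andP[m0 m1].
pose k := Num.min d (1 - m).
have k0 : 0 < k by rewrite lt_min d0 subr_gt0.
have kd : k <= d by rewrite ge_min lexx.
have k1 : k <= 1 - m by rewrite ge_min lexx orbT.
pose J : set R := `]m, m + k[%classic.
have sub : J `<=` N.
  move=> y; rewrite /J/=; rewrite in_itv/= => /andP[my ymk]; apply: HN => /= H.
  have Oy : Om y by rewrite OmegaE; apply/andP; split; lra.
  have : `|X m - Y m - (X y - Y y)| < `|X m - Y m|.
    by apply: Hd => //; rewrite /ball_/= ltr_norml; apply/andP; split; lra.
  by rewrite H// subr0 ltxx.
have : (mu J <= mu N)%E.
  apply: (le_measure (mu : {measure set (measurableTypeR R) -> \bar R})) => //;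
    by rewrite inE//; exact: measurable_itv.
rewrite [X in (_ <= X)%E]N0 /J lebesgue_measure_itv/= lte_fin ltrDl k0 -EFinD lee_fin.
lra.
Qed.

Definition projection g X := [/\ cone X, polar_cone (fun x => g x - X x) &
  dotO (fun x => g x - X x) X = 0].

Lemma projection_unique g X Y : in_L2 g -> projection g X -> projection g Y ->
  forall m, Om m -> X m = Y m.
Proof.
move=> gL [CX [rX pX] oX] [CY [rY pY] oY]; apply: cone_dist0 => //.
have XL := cone_L2 CX; have YL := cone_L2 CY.
apply/eqP; rewrite eq_le dotO_ge0 andbT.
have := pX _ CY; have := pY _ CX; move: oX oY.
by rewrite !dotOBl ?dotOBr//; [rewrite [dotO Y X]dotOC; lra|exact: in_L2B].
Qed.

(** Compare the integral of kappa between x and y with that of the constant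
    kappa x. *)
Lemma prim_support kappa al be x : integrableO kappa -> 0 <= al -> be <= 1 ->
  al <= x <= be ->
  (forall y, Om y -> al <= y -> y <= x -> kappa y <= kappa x) ->
  (forall y, Om y -> x <= y -> y <= be -> kappa x <= kappa y) ->
  forall y, al <= y <= be -> prim kappa x + kappa x * (y - x) <= prim kappa y.
Proof.
move=> ki al0 be1 /andP[alx xbe] lo hi y /andP[aly ybe].
have ii a b : integrableO (fun x : R => (a <= x < b)%R%:R).
  exact/in_L2_integrable/indicator_itv_L2.
have [xy|/ltW yx] := leP x y.
  have E := prim_sub ki xy.
  have : kappa x * (y - x) <= meanO (fun z => (x <= z < y)%R%:R * kappa z).
    rewrite -(mean_itv (le_trans al0 alx) xy (le_trans ybe be1)) -meanOZ//.
    apply: le_meanO.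
    - exact: integrableOZ.
    - by apply: integrableO_if => //; exact: measurable_lec_ltc.
    - move=> z Oz; case: (boolP (x <= z < y)%R) => [/andP[xz zy]|_].
        by rewrite mulr1 mul1r hi//; lra.
      by rewrite mulr0 mul0r.
  by rewrite -E; lra.
have E := prim_sub ki yx.
have : meanO (fun z => (y <= z < x)%R%:R * kappa z) <= kappa x * (x - y).
  rewrite -(mean_itv (le_trans al0 aly) yx (le_trans xbe be1)) -meanOZ//.
  apply: le_meanO.
  - by apply: integrableO_if => //; exact: measurable_lec_ltc.
  - exact: integrableOZ.
  - move=> z Oz; case: (boolP (y <= z < x)%R) => [/andP[yz zx]|_].
      by rewrite mulr1 mul1r lo//; lra.
    by rewrite mulr0 mul0r.
by rewrite -E; lra.
Qed.

(** A function lies below its chord at a point where it has a supporting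
    line. *)
Lemma prim_chord kappa al be x : integrableO kappa -> 0 <= al -> be <= 1 ->
  al <= x <= be ->
  (forall y, Om y -> al <= y -> y <= x -> kappa y <= kappa x) ->
  (forall y, Om y -> x <= y -> y <= be -> kappa x <= kappa y) ->
  (be - al) * prim kappa x <= (be - x) * prim kappa al + (x - al) * prim kappa be.
Proof.
move=> ki al0 be1 h lo hi; have /andP[alx xbe] := h.
have S := prim_support ki al0 be1 h lo hi.
have := S al; have := S be; rewrite !lexx (le_trans alx xbe) => /(_ isT) h1 /(_ isT) h2.
have : (be - x) * (prim kappa x + kappa x * (al - x)) <= (be - x) * prim kappa al.
  by apply: ler_wpM2l => //; lra.
have : (x - al) * (prim kappa x + kappa x * (be - x)) <= (x - al) * prim kappa be.
  by apply: ler_wpM2l => //; lra.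
nra.
Qed.

Lemma cone_prim_chord kappa al be x : cone kappa -> 0 <= al -> be <= 1 ->
  al <= x -> x <= be ->
  (be - al) * prim kappa x <= (be - x) * prim kappa al + (x - al) * prim kappa be.
Proof.
move=> Ck al0 be1 alx xbe; have ki := in_L2_integrable (cone_L2 Ck).
have [x0|x0] := leP x 0.
  have -> : x = 0 by lra.
  have -> : al = 0 by lra.
  rewrite prim0; lra.
have [x1|x1] := leP 1 x.
  have -> : x = 1 by lra.
  have -> : be = 1 by lra.
  lra.
have Ox : Om x by rewrite OmegaE x0.
apply: prim_chord => //; first by rewrite alx.
  by move=> y Oy _ yx; exact: cone_mono.
by move=> y Oy xy _; exact: cone_mono.
Qed.

(** The pairing with Y is the integral of - P dY, and so decreases when the
    primitive P increases. *)
Lemma polar_difference w1 w2 Y : polar_cone w1 -> polar_cone w2 ->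
  (forall c, Om c -> prim w1 c <= prim w2 c) -> cone Y -> dotO w2 Y <= dotO w1 Y.
Proof.
move=> p1 p2 le12 CY; have YL := cone_L2 CY.
have [r1 _] := p1; have [r2 _] := p2; have r21 := in_L2B r2 r1.
have i1 := in_L2_integrable r1; have i2 := in_L2_integrable r2.
rewrite -subr_le0 -dotOBl//; apply: polar_le.
- exact: in_L2_integrable.
- by move=> x y; exact: cone_mono.
- exact: integrableO_mul.
- by rewrite (meanOB i2 i1) (polar_prim p1).1 (polar_prim p2).1 subrr.
by move=> c c01 _; rewrite (primB c i2 i1) subr_ge0 le12// OmegaE.
Qed.

Local Notation proj g := (right_derivative (convex_envelope (prim g))).

Section rescaled_data.
Variables (g1 g2 kappa : R -> R) (theta : R).
Hypotheses (g1L : in_L2 g1) (g2L : in_L2 g2) (Ck : cone kappa).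
Hypothesis theta1 : 1 <= theta.
Hypothesis g2E : forall x, Om x -> g2 x = theta * g1 x - kappa x.

Let primE x : prim g2 x = theta * prim g1 x - prim kappa x.
Proof.
have g1i := in_L2_integrable g1L; have ki := in_L2_integrable (cone_L2 Ck).
by rewrite (prim_eq x g2E) primB ?primZ//; exact: integrableOZ.
Qed.

Lemma rescaled_projection_flat : Omega_flat (proj g1) `<=` Omega_flat (proj g2).
Proof.
apply: (@rescaled_envelope_flat _ (prim g1) (prim g2) (prim kappa) theta).
- exact/prim_continuous/in_L2_integrable.
- exact/prim_continuous/in_L2_integrable.
- exact: le_trans ler01 theta1.
- by move=> x _; exact: primE.
- by move=> al be x al0 be1 alx xbe; exact: cone_prim_chord.
Qed.

Lemma rescaled_projection_polar Y : cone Y ->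
  dotO (fun x => g2 x - proj g2 x) Y <= dotO (fun x => g1 x - proj g1 x) Y.
Proof.
move=> CY; have [_ p1 _] := envelope_projection g1L.
have [_ p2 _] := envelope_projection g2L.
(* Only the primitives of the two residuals matter, whatever the slopes X1 and
   X2 are. *)
have gen (X1 X2 P1 P2 : R -> R) :
    polar_cone (fun x => g1 x - X1 x) -> polar_cone (fun x => g2 x - X2 x) ->
    (forall c, Om c -> prim (fun x => g1 x - X1 x) c = prim g1 c - P1 c) ->
    (forall c, Om c -> prim (fun x => g2 x - X2 x) c = prim g2 c - P2 c) ->
    (forall c, Om c -> theta * (prim g1 c - P1 c) <= prim g2 c - P2 c) ->
    dotO (fun x => g2 x - X2 x) Y <= dotO (fun x => g1 x - X1 x) Y.
  move=> q1 q2 E1 E2 gap; apply: (polar_difference q1 q2) => // c Oc.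
  have := (polar_prim q1).2 c; rewrite E1// E2// => h.
  apply: le_trans (gap c Oc).
  by rewrite -[leLHS]mul1r ler_wpM2r.
refine (gen _ _ _ _ p1 p2 (prim_residual g1L) (prim_residual g2L) _) => c Oc.
have t0 : 0 < theta by apply: lt_le_trans theta1.
have ks x : Om x -> exists k, forall y, Om y ->
    prim kappa x + k * (y - x) <= prim kappa y.
  move=> Ox; exists (kappa x) => y Oy.
  have O01 z : Om z -> 0 <= z <= 1 by rewrite OmegaE => /andP[/ltW-> /ltW->].
  apply: (@prim_support _ 0 1) => //; try exact: O01.
  - exact/in_L2_integrable/cone_L2.
  - by move=> z Oz _ zx; exact: cone_mono.
  - by move=> z Oz xz _; exact: cone_mono.
exact: (@rescaled_envelope_gap _ (prim g1) (prim g2) (prim kappa) theta c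
  (prim_continuous (in_L2_integrable g1L))
  (prim_continuous (in_L2_integrable g2L)) t0 (fun x _ => primE x) ks Oc).
Qed.

End rescaled_data.

Lemma projection_id X : cone X -> forall m, Om m -> proj X m = X m.
Proof.
move=> CX; apply: (@projection_unique X) => //; first exact: cone_L2.
  exact: (envelope_projection (cone_L2 CX)).
have Z x : X x - X x = 0 by rewrite subrr.
have d0 Y : dotO (fun x => X x - X x) Y = 0.
  by rewrite /dotO (@meanO_eq _ _ (fun=> 0)) ?meanO_cst// => x _; rewrite Z mul0r.
split=> //; split; last by move=> Y _; rewrite d0.
by apply: in_L2_eq (in_L2_cst 0) => x _; rewrite Z.
Qed.

End projections.

(** * The Euler-Poisson flow *)

Section euler_poisson_projections.
Context {R : realType}.
Local Notation mu := (@lebesgue_measure R).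
Local Notation Om := (@Omega R).
Local Notation proj g := (right_derivative (convex_envelope (prim g))).
Variables (lam : R) (Xbar V : R -> R).
Hypotheses (lam0 : 0 <= lam) (CX : cone Xbar) (VL : in_L2 V).
Hypothesis V_of_X : forall x y, Xbar x = Xbar y -> V x = V y.
Implicit Types (s t x y m : R) (Y : R -> R).

Definition free_flow t m := Xbar m + t * V m - lam * (t ^+ 2 / 2) * (m - 2^-1).

Lemma cone_centered : cone (fun m : R => m - 2^-1).
Proof.
split.
- apply: (@in_L2_le _ _ (fun=> 1)); last 2 first.
  + exact: integrableO_cst.
  + by move=> x; rewrite OmegaE => /andP[x0 x1]; nra.
  apply: measurable_funB; last exact: measurable_cst.
  exact: measurable_id.
- by move=> x y _ _ xy; rewrite lerD2r.
- move=> x _; apply: cvgB; last exact: cvg_cst.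
  exact: cvg_at_right_filter (@cvg_id _ _).
Qed.

Lemma free_flow_L2 t : in_L2 (free_flow t).
Proof.
apply: in_L2B; first by apply: in_L2D; [exact: cone_L2|exact: in_L2Z].
exact/in_L2Z/cone_L2/cone_centered.
Qed.

Lemma free_flow0 : free_flow 0 = Xbar.
Proof. by apply/funext => m; rewrite /free_flow expr0n/=; ring. Qed.

Lemma euler_poisson_impulse t m (Z : R -> R -> R) : 0 < t ->
  \int[mu]_(s in `[0, t]) euler_poisson_force lam (Z s) m = - (lam * t * (m - 2^-1)).
Proof.
move=> t0; rewrite /euler_poisson_force Rintegral_cst//.
rewrite [X in fine X]lebesgue_measure_itv/= lte_fin t0/=.
by ring.
Qed.

Lemma EP_potentialE t m : Om m -> EP_potential lam Xbar V t m = prim (free_flow t) m.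
Proof.
rewrite OmegaE => /andP[m0 m1].
rewrite /EP_potential /prim /meanO Rintegral_mkcond [RHS]Rintegral_mkcond.
apply: eq_Rintegral => x _; rewrite !patchE.
have [Ix|nI] := boolP (x \in `]0, m[%classic).
  move: Ix; rewrite inE/= in_itv/= => /andP[x0 xm].
  have Ox : x \in Om by rewrite inE OmegaE x0 (lt_trans xm).
  rewrite Ox xm mul1r.
  by rewrite /free_flow; field.
have [Ox|//] := boolP (x \in Om).
move: Ox nI; rewrite inE OmegaE notin_setE/= in_itv/= => /andP[-> _] /negP/negbTE /= ->.
by rewrite mul0r.
Qed.

Lemma convex_envelope_eq (f g : R -> R) : (forall x, Om x -> f x = g x) ->
  convex_envelope f = convex_envelope g.
Proof.
move=> fg; apply/funext => m; congr sup.
by apply/seteqP; split=> y [a [b [H ->]]]; exists a, b; split=> // z Oz;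
  [rewrite -fg//|rewrite fg//]; exact: H.
Qed.

Lemma EP_flowE t : EP_flow lam Xbar V t = proj (free_flow t).
Proof. by congr right_derivative; apply: convex_envelope_eq => x; exact: EP_potentialE. Qed.

Lemma EP_flow_projection t : projection (free_flow t) (EP_flow lam Xbar V t).
Proof. by rewrite EP_flowE; exact: envelope_projection (free_flow_L2 t). Qed.

Lemma EP_flow0 m : Om m -> EP_flow lam Xbar V 0 m = Xbar m.
Proof. by rewrite EP_flowE free_flow0; exact: projection_id. Qed.

(** The nondecreasing function to subtract from the rescaled free motion
    [t / s * free_flow s] to obtain [free_flow t]: the terms in V match, and lam
    >= 0 makes the last term nondecreasing. *)
Let kappa s t m := (t / s - 1) * Xbar m + lam / 2 * t * (t - s) * (m - 2^-1).

Let cone_kappa s t : 0 < s -> s <= t -> cone (kappa s t).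
Proof.
move=> s0 st; apply: coneD; apply: coneZ => //; last exact: cone_centered.
  by rewrite subr_ge0 ler_pdivlMr// mul1r.
by rewrite !mulr_ge0//; lra.
Qed.

Let free_flow_rescaled s t m : 0 < s ->
  free_flow t m = t / s * free_flow s m - kappa s t m.
Proof. by move=> s0; rewrite /free_flow /kappa; field; rewrite gt_eqF. Qed.

Let theta1 s t : 0 < s -> s <= t -> 1 <= t / s.
Proof. by move=> s0 st; rewrite ler_pdivlMr// mul1r. Qed.

Lemma EP_flow_polar s t Y : 0 < s -> s <= t -> cone Y ->
  dotO (fun x => free_flow t x - EP_flow lam Xbar V t x) Y <=
  dotO (fun x => free_flow s x - EP_flow lam Xbar V s x) Y.
Proof.
move=> s0 st CY; rewrite !EP_flowE.
exact: (rescaled_projection_polar (free_flow_L2 s) (free_flow_L2 t)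
  (cone_kappa s0 st) (theta1 s0 st) (fun x _ => free_flow_rescaled t x s0) CY).
Qed.

(** Where Xbar is constant so is V, and the attractive force makes the free
    motion nonincreasing; its primitive is concave, hence above its chord. *)
Lemma initial_flat t : Omega_flat Xbar `<=` Omega_flat (EP_flow lam Xbar V t).
Proof.
move=> m /Omega_flatP[d [d0 md0 md1 Hd]]; rewrite EP_flowE.
have E x : m - d < x < m + d ->
    free_flow t x = Xbar m + t * V m - lam * (t ^+ 2 / 2) * (x - 2^-1).
  by move=> /Hd Ex; rewrite /free_flow Ex (V_of_X Ex).
have al0 : 0 <= m - d / 2 by lra.
have be1 : m + d / 2 <= 1 by lra.
have fi := in_L2_integrable (free_flow_L2 t).
have c0 : 0 <= lam * (t ^+ 2 / 2) by rewrite mulr_ge0// divr_ge0// sqr_ge0.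
have dec x y : m - d / 2 <= x -> x <= y -> y <= m + d / 2 -> free_flow t y <= free_flow t x.
  move=> h1 h2 h3; rewrite !E; try (apply/andP; split; lra).
  have : lam * (t ^+ 2 / 2) * (x - 2^-1) <= lam * (t ^+ 2 / 2) * (y - 2^-1).
    by apply: ler_wpM2l => //; lra.
  lra.
apply: (above_chord_flat (prim_continuous fi) al0 be1); [lra|lra|].
move=> x /andP[h1 h2].
have fNi : integrableO (fun x => - free_flow t x).
  by apply: integrableO_eq (integrableOZ (-1) fi) => y _; rewrite mulN1r.
have := @prim_chord _ (fun x => - free_flow t x) _ _ x fNi al0 be1.
rewrite h1 h2 => /(_ isT); rewrite !primN//.
have n1 y : Om y -> m - d / 2 <= y -> y <= x -> - free_flow t y <= - free_flow t x.
  by move=> _ k1 k2; rewrite lerN2 dec.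
have n2 y : Om y -> x <= y -> y <= m + d / 2 -> - free_flow t x <= - free_flow t y.
  by move=> _ k1 k2; rewrite lerN2 dec.
move=> /(_ n1 n2); lra.
Qed.

Lemma EP_flow_sticky : sticky (EP_flow lam Xbar V).
Proof.
move=> s t; rewrite le_eqVlt => /predU1P[<- _|s0 st].
  apply: subset_trans (initial_flat t) => m [Om_m nX]; split=> //.
  have nO : \forall x \near m, Om x by exact: (open_nbhs_nbhs (conj (interval_open _ _) Om_m)).
  apply: filterS2 nX nO => x E Ox.
  by rewrite -(EP_flow0 Ox) -(EP_flow0 Om_m).
rewrite !EP_flowE.
exact: (rescaled_projection_flat (free_flow_L2 s) (free_flow_L2 t)
  (cone_kappa s0 st) (theta1 s0 st) (fun x _ => free_flow_rescaled t x s0)).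
Qed.

End euler_poisson_projections.

(** * Existence *)

Section sticky_projections_solve.
Context {R : realType}.
Local Notation mu := (@lebesgue_measure R).
Local Notation Om := (@Omega R).
Implicit Types (s t h e tau : R) (Y : R -> R).
Variables (lam : R) (Xbar V : R -> R) (X : R -> R -> R).
Hypotheses (lam0 : 0 <= lam) (CX : cone Xbar) (VL : in_L2 V).
Local Notation g := (free_flow lam Xbar V).
Hypothesis proj : forall t, 0 <= t -> projection (g t) (X t).
Hypothesis st : sticky X.
Hypothesis mono : forall s t Y, 0 < s -> s <= t -> cone Y ->
  dotO (fun x => g t x - X t x) Y <= dotO (fun x => g s x - X s x) Y.

Let M (m : R) := m - 2^-1.
Let ML : in_L2 M := cone_L2 cone_centered.
Let gL t : in_L2 (g t) := free_flow_L2 lam CX VL t.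
Let XL t : 0 <= t -> in_L2 (X t).
Proof. by move=> /proj[/cone_L2]. Qed.

Let ip (u v : @L2space R) := dotO (u : R -> R) (v : R -> R).

Let ipC u v : ip u v = ip v u. Proof. exact: dotOC. Qed.
Let ipDl u v w : ip (u + v) w = ip u w + ip v w.
Proof. rewrite /ip -dotODl//; exact: L2space_in_L2. Qed.
Let ipZl (a : R) u v : ip (a *: u) v = a * ip u v.
Proof. rewrite /ip -dotOZl//; exact: L2space_in_L2. Qed.
Let ip_ge0 u : 0 <= ip u u. Proof. exact: dotO_ge0. Qed.
Let ip_complete (w : nat -> @L2space R) :
  (forall k, ip (w k.+1 - w k) (w k.+1 - w k) <= 4^-1 ^+ k) ->
  exists D, forall e : R, 0 < e ->
    exists N, forall k, (N <= k)%N -> ip (w k - D) (w k - D) <= e.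
Proof.
move=> fast.
have [D DL HD] := @riesz_fischer _ (fun k => w k : R -> R)
  (fun k => L2space_in_L2 (w k)) fast.
have [D' ED] := L2space_of DL; exists D' => e /HD[N HN]; exists N => k /HN.
rewrite /ip; congr (_ <= _).
by apply: dotO_eq => x Ox; rewrite L2spaceD L2spaceN ED.
Qed.

(** The flat set only grows in time, so residuals are orthogonal to later
    positions. *)
Let orth s t : 0 <= s -> s <= t -> dotO (fun x => g s x - X s x) (X t) = 0.
Proof.
move=> s0 st'; have [Cs ps os] := proj s0; have [Ct _ _] := proj (le_trans s0 st').
exact: (flat_orthogonal ps Cs os Ct (st s0 st')).
Qed.

(** The curve and its data are transported to the module of square-integrable
    functions, where the results on sticky curves apply. The inclusion is tested
    there with every Y in K and, for the orthogonality to X t, with X t and its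
    opposite. *)
Lemma sticky_projections_solve : locally_lipschitz_L2 X /\
  {ae mu, forall t : R, 0 < t ->
    exists2 Xdot : R -> R, is_L2_derivative X t Xdot &
      subdiff_cone (X t) (fun m =>
        V m + \int[mu]_(s in `[0, t]) euler_poisson_force lam (X s) m - Xdot m)}.
Proof.
have [X0H EX0] := L2space_of (cone_L2 CX).
have [VH EV] := L2space_of VL.
have [MH EM] := L2space_of ML.
have /choice[XH EX] : forall t, exists F : @L2space R,
    0 <= t -> forall x, Om x -> F x = X t x.
  move=> t; have [t0|_] := leP 0 t; last by exists 0.
  by have [F EF] := L2space_of (XL t0); exists F.
have Eg s x : Om x -> free_path X0H VH MH lam s x = g s x.
  move=> Ox; rewrite /free_path L2spaceD L2spaceN L2spaceD !L2spaceZ.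
  by rewrite EX0// EV// EM.
have orthH s t : 0 <= s -> s <= t ->
    ip (free_path X0H VH MH lam s - XH s) (XH t) = 0.
  move=> s0 st'; rewrite -(orth s0 st'); apply: dotO_eq => x Ox; last first.
    by rewrite EX// (le_trans s0 st').
  by rewrite L2spaceD L2spaceN Eg// EX.
have resH s Y (YH : @L2space R) : 0 <= s -> (forall x, Om x -> YH x = Y x) ->
    ip (free_path X0H VH MH lam s - XH s) YH = dotO (fun x => g s x - X s x) Y.
  by move=> s0 EY; apply: dotO_eq => x Ox; rewrite ?EY// L2spaceD L2spaceN Eg// EX.
have polarH s t : 0 <= s -> 0 <= t ->
    ip (free_path X0H VH MH lam t - XH t) (XH s) <= 0.
  move=> s0 t0; rewrite (@resH t (X s))//; last by move=> x; exact: EX.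
  by have [_ [_ p] _] := proj t0; apply: p; case: (proj s0).
split.
  move=> T T0; exists (Num.sqrt (2 * (ip VH VH + (lam * T) ^+ 2 * ip MH MH))).
  have key s t : 0 <= s -> s <= t -> t <= T ->
      dotO (fun m => X t m - X s m) (fun m => X t m - X s m) <=
      (t - s) ^+ 2 * (2 * (ip VH VH + (lam * T) ^+ 2 * ip MH MH)).
    move=> s0 st' tT; have t0 := le_trans s0 st'.
    have := sticky_curve_lipschitz ipC ipDl ipZl ip_ge0 orthH polarH s0 st'.
    have -> : ip (XH t - XH s) (XH t - XH s) =
        dotO (fun m => X t m - X s m) (fun m => X t m - X s m).
      by apply: dotO_eq => x Ox; rewrite L2spaceD L2spaceN !EX.
    move=> /le_trans; apply; apply: ler_wpM2l; first exact: sqr_ge0.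
    pose tau := lam * ((s + t) / 2).
    have tau0 : 0 <= tau by rewrite mulr_ge0//; lra.
    have tauT : tau <= lam * T by apply: ler_wpM2l => //; lra.
    have h1 : tau ^+ 2 * ip MH MH <= (lam * T) ^+ 2 * ip MH MH.
      by rewrite ler_wpM2r// lerXn2r// nnegrE// (le_trans tau0).
    have := ip_ge0 (VH + tau *: MH); rewrite -/tau.
    have mulE a u w : ip (u + a *: w) (u + a *: w) =
        ip u u + 2 * a * ip u w + a ^+ 2 * ip w w.
      rewrite ipDl ![ip _ (_ + _)]ipC !ipDl !ipZl ![ip _ (a *: _)]ipC !ipZl.
      by rewrite [ip w u]ipC; ring.
    rewrite -scaleNr !mulE sqrrN; lra.
  have dL s t : 0 <= s -> 0 <= t -> in_L2 (fun m => X t m - X s m).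
    by move=> s0 t0; apply: in_L2B; exact: XL.
  have C0 : 0 <= 2 * (ip VH VH + (lam * T) ^+ 2 * ip MH MH).
    by rewrite mulr_ge0// addr_ge0// mulr_ge0// sqr_ge0.
  move=> s t /andP[s0 sT] /andP[t0 tT].
  rewrite (L2normE (dL _ _ s0 t0)) lee_fin.
  rewrite -(sqrtr_sqr (t - s)) -sqrtrM// mulrC ler_wsqrtr//.
  have [st'|/ltW ts] := leP s t; first exact: key.
  have -> : (t - s) ^+ 2 = (s - t) ^+ 2 by ring.
  apply: le_trans (key _ _ t0 ts sT); rewrite le_eqVlt; apply/orP; left; apply/eqP.
  by apply: meanO_eq => x _; ring.
have [N [cN HN]] := sticky_curve_derivable ipC ipDl ipZl ip_ge0 ip_complete
  lam0 orthH polarH.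
have N0 : mu.-negligible N.
  exists N; split=> //; last exact: countable_lebesgue_measure0.
  exact: countable_measurable.
apply: negligibleS N0 => t /= H; apply: contrapT => Nt; apply: H => t0.
have t0' := ltW t0.
have [D HD] := HN t t0 Nt.
have DL : in_L2 (D : R -> R) by exact: L2space_in_L2.
exists D.
  split=> //.
  have E h : 0 <= t + h -> L2norm (fun m => h^-1 * (X (t + h) m - X t m) - D m) =
      (Num.sqrt (ip (h^-1 *: (XH (t + h) - XH t) - D)
                    (h^-1 *: (XH (t + h) - XH t) - D)))%:E.
    move=> th0; rewrite L2normE; last first.
      by apply: in_L2B => //; apply: in_L2Z; apply: in_L2B; exact: XL.
    congr (Num.sqrt _)%:E; apply: dotO_eq => x Ox;
      by rewrite L2spaceD L2spaceN L2spaceZ L2spaceD L2spaceN !EX.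
  have nt : \forall h \near (0 : R)^', 0 <= t + h.
    apply: cvg_within; exists t => // h /=; rewrite sub0r normrN ltr_norml => /andP[? _].
    lra.
  apply/fine_cvgP; split; first by apply: filterS nt => h /E ->.
  apply/cvgrPdist_le => e e0.
  have e20 : 0 < e ^+ 2 by rewrite exprn_gt0.
  have [d d0 Hd] := HD _ e20.
  have nd : \forall h \near (0 : R)^', h != 0 /\ `|h| < d.
    by exists d => // h /=; rewrite sub0r normrN => hd h0; split.
  apply: filterS2 nt nd => h /= /E -> [h0 hd].
  rewrite /= sub0r normrN ger0_norm ?sqrtr_ge0//.
  by rewrite -[leRHS](ger0_norm (ltW e0)) -sqrtr_sqr ler_wsqrtr// Hd.
have [Ct pt ot] := proj t0'.
have WL : in_L2 (fun m => V m - lam * t * M m - D m).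
  by apply: in_L2B => //; apply: in_L2B => //; exact: in_L2Z.
have WH Y (YH : @L2space R) : (forall x, Om x -> YH x = Y x) ->
    ip (VH - (lam * t) *: MH - D) YH = dotO (fun m => V m - lam * t * M m - D m) Y.
  move=> EY; apply: dotO_eq => x Ox; rewrite ?EY//.
  by rewrite !L2spaceD !L2spaceN L2spaceZ EV// EM.
have incl (y : @L2space R) := @sticky_curve_inclusion R (@L2space R) ip ipC ipDl ipZl
  ip_ge0 X0H VH MH lam XH t D y t0 HD.
have -> : (fun m => V m + \int[mu]_(s in `[0, t]) euler_poisson_force lam (X s) m - D m)
    = (fun m => V m - lam * t * M m - D m).
  by apply/funext => m; rewrite euler_poisson_impulse.
apply/subdiff_coneP => //; split.
  split=> // Y CY; have [YH EY] := L2space_of (cone_L2 CY).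
  rewrite -(WH _ _ EY); apply: incl => s s0 st'.
  have s0' := ltW s0.
  have h := mono s0 (ltW st') CY.
  rewrite -(resH t Y YH t0' EY) -(resH s Y YH s0' EY) in h.
  exact: h.
have Xt := EX t t0'.
have eq_le2 (a b c : R) : a = c -> b = c -> a <= b by move=> -> ->.
have oD s : 0 < s -> s < t -> ip (free_path X0H VH MH lam s - XH s) (XH t) = 0.
  by move=> s0 st'; exact: orthH (ltW s0) (ltW st').
have o_t : ip (free_path X0H VH MH lam t - XH t) (XH t) = 0.
  exact: orthH t0' (lexx t).
rewrite -(WH _ _ Xt); apply/eqP; rewrite eq_le; apply/andP; split.
  apply: incl => s s0 st'.
  exact: (eq_le2 _ _ _ o_t (oD s s0 st')).
have NE u : ip u (- XH t) = - ip u (XH t).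
  by rewrite [LHS]ipC -scaleN1r ipZl mulN1r ipC.
rewrite -oppr_le0 -NE; apply: incl => s s0 st'.
by rewrite !NE; apply: (eq_le2 _ _ (- 0)); congr (- _); [exact: o_t|exact: oD].
Qed.

End sticky_projections_solve.

(** * Uniqueness *)

Section sticky_solutions_project.
Context {R : realType}.
Local Notation mu := (@lebesgue_measure R).
Local Notation Om := (@Omega R).
Implicit Types (s t h e : R).

Lemma dotO_CS_sqrt (u v : R -> R) : in_L2 u -> in_L2 v ->
  `|dotO u v| <= Num.sqrt (dotO u u) * Num.sqrt (dotO v v).
Proof.
move=> uL vL; rewrite -sqrtr_sqr -sqrtrM ?dotO_ge0//.
by apply: ler_wsqrtr; exact: dotO_CS.
Qed.

Lemma L2norm_cvg0 (u : R -> R -> R) e : (forall h, in_L2 (u h)) -> 0 < e ->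
  L2norm (u h) @[h --> (0 : R)^'] --> (0 : \bar R)%E ->
  exists2 d : R, 0 < d &
    forall h, h != 0 -> `|h| < d -> Num.sqrt (dotO (u h) (u h)) <= e.
Proof.
move=> uL e0 /fine_cvgP[_ /cvgrPdist_le /(_ e e0)].
case=> d /= d0 Hd; exists d => // h h0 hd.
have := Hd h; rewrite /= !sub0r !normrN => /(_ hd h0).
by rewrite L2normE//= ger0_norm// sqrtr_ge0.
Qed.

Variables (lam : R) (Xbar V : R -> R) (Y : R -> R -> R).
Hypotheses (lam0 : 0 <= lam) (CX : cone Xbar) (VL : in_L2 V).
Local Notation g := (free_flow lam Xbar V).
Hypothesis coneY : forall t, 0 <= t -> cone (Y t).
Hypothesis lipY : locally_lipschitz_L2 Y.
Hypothesis initY : forall m, Om m -> Y 0 m = Xbar m.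
Hypothesis inclY : {ae mu, forall t : R, 0 < t ->
    exists2 Ydot : R -> R, is_L2_derivative Y t Ydot &
      subdiff_cone (Y t) (fun m =>
        V m + \int[mu]_(s in `[0, t]) euler_poisson_force lam (Y s) m - Ydot m)}.
Hypothesis stY : sticky Y.

Let M (m : R) := m - 2^-1.
Let ML : in_L2 M := cone_L2 cone_centered.
Let gL t : in_L2 (g t) := free_flow_L2 lam CX VL t.
Let YL t : 0 <= t -> in_L2 (Y t). Proof. by move=> /coneY/cone_L2. Qed.

Let dot_g s t k : in_L2 k -> dotO (g t) k - dotO (g s) k =
  (t - s) * (dotO V k - lam * ((s + t) / 2) * dotO M k).
Proof.
move=> kL; have XL := cone_L2 CX.
have E r : dotO (g r) k = dotO Xbar k + r * dotO V k - lam * (r ^+ 2 / 2) * dotO M k.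
  rewrite -(dotOZl r)// -(dotOZl (lam * _))// -dotODl//; last exact: in_L2Z.
  by rewrite -dotOBl//; [apply: in_L2D => //; exact: in_L2Z|exact: in_L2Z].
by rewrite !E; field.
Qed.

(** Between the initial time, where the residual vanishes, and t, the pairing of
    the residual with Z - Y t has the derivative <w, Z> - <w, Y t> with w in the
    subdifferential at the current position: the first term is nonpositive and,
    by stickiness, the second is zero. *)
Lemma residual_pairing_le0 t Z : 0 <= t -> cone Z ->
  dotO (fun x => g t x - Y t x) (fun x => Z x - Y t x) <= 0.
Proof.
move=> t0 CZ; pose k x := Z x - Y t x.
have kL : in_L2 k by apply: in_L2B; [exact: cone_L2|exact: YL].
pose phi s := dotO (fun x => g s x - Y s x) k.
have phiE s : 0 <= s -> phi s = dotO (g s) k - dotO (Y s) k.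
  by move=> s0; rewrite /phi (dotOBl (gL s) (YL s0) kL).
have phi0 : phi 0 = 0.
  rewrite /phi (@dotO_eq _ _ (fun=> 0) _ k)//.
    by rewrite /dotO (@meanO_eq _ _ (fun=> 0)) ?meanO_cst// => x _; rewrite mul0r.
  by move=> x Ox; rewrite free_flow0 initY// subrr.
rewrite -/(phi t) -phi0.
have [L HL] := lipY t0.
pose K := Num.sqrt (dotO k k).
have K0 : 0 <= K by exact: sqrtr_ge0.
have [N [mN mu0 HN]] := inclY.
apply: (@lipschitz_ae_nonincreasing _ phi t
  (`|dotO V k| + lam * t * `|dotO M k| + `|L| * K) N) => //.
- by rewrite !addr_ge0// !mulr_ge0.
- move=> a b /andP[a0 at_] /andP[b0 bt].
  rewrite !phiE//.
  have -> : dotO (g b) k - dotO (Y b) k - (dotO (g a) k - dotO (Y a) k) =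
      (dotO (g b) k - dotO (g a) k) - dotO (fun x => Y b x - Y a x) k.
    by rewrite dotOBl//; [ring|exact: YL|exact: YL].
  rewrite dot_g//; apply: le_trans (ler_normB _ _) _.
  rewrite [leRHS]mulrDl; apply: lerD.
    rewrite normrM mulrC; apply: ler_wpM2r => //.
    apply: le_trans (ler_normB _ _) _; rewrite lerD2l normrM ler_wpM2r//.
    by rewrite ger0_norm ?ler_wpM2l ?mulr_ge0//; lra.
  have dL : in_L2 (fun x => Y b x - Y a x) by apply: in_L2B; exact: YL.
  apply: le_trans (dotO_CS_sqrt dL kL) _.
  rewrite mulrAC; apply: ler_wpM2r => //.
  have := HL a b; rewrite a0 at_ b0 bt => /(_ isT isT).
  rewrite L2normE// lee_fin => /le_trans; apply.
  by rewrite ler_wpM2r// ler_norm.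
- by exists N; split.
move=> s /andP[s0 st] Ns e e0; have s0' := ltW s0.
have := Ns; have [H|nH] := pselect (0 < s -> exists2 Ydot : R -> R, is_L2_derivative Y s Ydot &
      subdiff_cone (Y s) (fun m =>
        V m + \int[mu]_(s in `[0, s]) euler_poisson_force lam (Y s) m - Ydot m)); last first.
  by move=> nN; exfalso; apply: nN; apply: HN.
move=> _; have [D [DL dD] sD] := H s0.
move: sD; have -> : (fun m => V m +
    \int[mu]_(r in `[0, s]) euler_poisson_force lam (Y r) m - D m) =
    (fun m => V m - lam * s * M m - D m).
  by apply/funext => m; rewrite euler_poisson_impulse.
move=> /(subdiff_coneP _ (coneY s0'))[pw ow].
set w := (fun m => _) in pw ow.
have wL : in_L2 w by exact: pw.1.
have wk : dotO w k <= 0.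
  rewrite /k dotOBr//; [|exact: cone_L2|exact: YL].
  rewrite (flat_orthogonal pw (coneY s0') ow (coneY t0) (stY s0' (ltW st))) subr0.
  exact: pw.2.
have wkE : dotO w k = dotO V k - lam * s * dotO M k - dotO D k.
  rewrite /w dotOBl//; last by apply: in_L2B => //; exact: in_L2Z.
  by rewrite dotOBl// ?dotOZl//; exact: in_L2Z.
pose q h x := h^-1 * (Y (s + h) x - Y s x) - D x.
(* The curve is only known at nonnegative times; u agrees with q for small h. *)
pose u h : R -> R := if 0 <= s + h then q h else (fun=> 0).
have uL h : in_L2 (u h).
  rewrite /u; case: ifPn => [sh|_]; last exact: in_L2_cst.
  by apply: in_L2B => //; apply: in_L2Z; apply: in_L2B; exact: YL.
have du : L2norm (u h) @[h --> (0 : R)^'] --> (0 : \bar R)%E.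
  apply: cvg_trans dD; apply: near_eq_cvg; exists s => // h /=.
  rewrite sub0r normrN ltr_norml => /andP[hs _] _.
  by rewrite /u ifT//; lra.
pose c := e / (2 * (K + 1)).
have K1 : 0 < K + 1 by lra.
have c0 : 0 < c by rewrite divr_gt0// mulr_gt0.
have [d d0 Hd] := L2norm_cvg0 uL c0 du.
pose B := lam / 2 * `|dotO M k|.
have B0 : 0 <= B by rewrite !mulr_ge0//.
pose d' := Num.min d (e / (2 * (B + 1))).
have B1 : 0 < B + 1 by lra.
exists d'; first by rewrite lt_min d0 divr_gt0// mulr_gt0.
move=> h h0; rewrite lt_min => /andP[hd hB].
have sh0 : 0 <= s + h by lra.
have hn0 : h != 0 by rewrite gt_eqF.
have qb : - dotO (q h) k <= e / 2.
  have qL : in_L2 (q h) by have := uL h; rewrite /u ifT.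
  apply: le_trans (ler_norm _) _; rewrite normrN.
  apply: le_trans (dotO_CS_sqrt qL kL) _; rewrite -/K.
  have := Hd h hn0; rewrite gtr0_norm// /u ifT// => /(_ hd) qc.
  apply: (@le_trans _ _ (c * (K + 1))).
    by apply: ler_pM => //; rewrite ?sqrtr_ge0//; lra.
  by rewrite /c le_eqVlt; apply/orP; left; apply/eqP; field; rewrite gt_eqF.
have hb : - (lam / 2 * dotO M k) * h <= e / 2.
  apply: (@le_trans _ _ (B * h)).
    rewrite ler_pM2r//; apply: le_trans (ler_norm _) _.
    by rewrite normrN normrM ger0_norm// divr_ge0.
  apply: (@le_trans _ _ ((B + 1) * (e / (2 * (B + 1))))).
    by apply: ler_pM => //; [exact: ltW|rewrite lerDl|exact: ltW].
  by rewrite le_eqVlt; apply/orP; left; apply/eqP; field; rewrite gt_eqF.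
have qE : dotO (Y (s + h)) k - dotO (Y s) k = h * (dotO (q h) k + dotO D k).
  have -> : dotO (q h) k = h^-1 * (dotO (Y (s + h)) k - dotO (Y s) k) - dotO D k.
    rewrite /q dotOBl//; last by apply: in_L2Z; apply: in_L2B; exact: YL.
    rewrite dotOZl//; last by apply: in_L2B; exact: YL.
    by rewrite dotOBl//; exact: YL.
  by field.
rewrite !phiE//.
have gE := dot_g s (s + h) kL.
have : h * (dotO w k + - (lam / 2 * dotO M k) * h - dotO (q h) k) <= h * e.
  by rewrite ler_pM2l//; lra.
rewrite wkE; lra.
Qed.

Lemma sticky_solutions_project t : 0 <= t -> projection (g t) (Y t).
Proof.
move=> t0; have Ct := coneY t0.
have rL : in_L2 (fun x => g t x - Y t x) by apply: in_L2B => //; exact: YL.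
have /(subdiff_coneP _ Ct)[p o] : subdiff_cone (Y t) (fun x => g t x - Y t x).
  split=> // Z CZ; rewrite meanOE.
    by rewrite lee_fin; exact: residual_pairing_le0.
  apply: integrableO_mul => //; apply: in_L2B; last exact: YL.
  exact: cone_L2.
by split.
Qed.

End sticky_solutions_project.

Unset Implicit Arguments.

Theorem theorem6p11 (R : realType) (lambda : R) (hlambda : 0 <= lambda)
    (Xbar : R -> R) (hXbar : cone Xbar)
    (rhobar : probability (measurableTypeR R) R)
    (hrhobar : forall A, measurable A -> rhobar A = push_Omega Xbar A)
    (vbar : measurableTypeR R -> R) (hvbar : vbar \in Lfun rhobar 2%:E) :
  let Vbar : R -> R := fun m => vbar (Xbar m) in
  let F : (R -> R) -> R -> R := euler_poisson_force lambda in
  let Xt : R -> R -> R := EP_flow lambda Xbar Vbar in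
  (exists rho : R -> probability (measurableTypeR R) R,
     lagrangian_solution F Xbar Vbar rho Xt /\ sticky Xt) /\
  (forall (rho : R -> probability (measurableTypeR R) R) (Y : R -> R -> R),
     lagrangian_solution F Xbar Vbar rho Y -> sticky Y ->
     forall t, 0 <= t ->
       (forall m, Omega m -> Y t m = Xt t m) /\
       (forall A, measurable A -> rho t A = push_Omega (Xt t) A)).
Proof.
move=> V F X.
have VL : in_L2 V.
  exact: comp_law_in_L2 (in_L2_measurable (cone_L2 hXbar)) hrhobar hvbar.
have VX x y : Xbar x = Xbar y -> V x = V y by rewrite /V => ->.
have prX (t : R) : projection (free_flow lambda Xbar V t) (X t).
  exact: EP_flow_projection.
have stX : sticky X by exact: EP_flow_sticky.
have coneX t : cone (X t) by have [] := prX t.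
split.
  have [lipX inclX] : locally_lipschitz_L2 X /\ _ :=
    sticky_projections_solve hlambda hXbar VL (fun t _ => prX t) stX
      (fun s t Y s0 st CY => EP_flow_polar hlambda hXbar VL s0 st CY).
  have /choice[rho Hrho] : forall t, exists P : probability (measurableTypeR R) R,
      forall A, measurable A -> P A = push_Omega (X t) A.
    by move=> t; apply: law_of; apply: in_L2_measurable; exact: cone_L2.
  exists rho; split=> //; split=> //.
  - by move=> m Om_m; exact: EP_flow0.
  - by move=> t _ A; exact: Hrho.
move=> rho Y [coneY lipY initY inclY lawY] stY t t0.
have prY : projection (free_flow lambda Xbar V t) (Y t) :=
  sticky_solutions_project hlambda hXbar VL coneY lipY initY inclY stY t0.
have YX m : Omega m -> Y t m = X t m.
  exact: (projection_unique (free_flow_L2 lambda hXbar VL t) prY (prX t)).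
split=> // A mA; rewrite (lawY t t0 A mA); exact: push_Omega_eq.
Qed.
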